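(* Let $\mathcal{H}$ be a complex Hilbert space and $T\in\boldsymbol{B}(\mathcal{H})$. For $h\in\mathcal{H}$, let $W_{T,h}$ be the unilateral weighted shift in $\ell^2$ with weights $\big\{\mathrm{e}^{\frac12(\|T^{n+1}h\|^2-\|T^nh\|^2)}\big\}_{n=0}^\infty$. Then the following assertions hold: (i) $T$ is CPD if and only if $W_{T,h}$ is a (possibly unbounded) subnormal operator for all $h\in\mathcal{H}$; (ii) the following conditions are equivalent: (ii-a) $T$ is a subnormal contraction, (ii-b) $T$ is a CPD contraction, (ii-c) $W_{T,h}$ is subnormal and $\|W_{T,h}\|=1$ for all $h\in\mathcal{H}$, (ii-d) $W_{T,h}$ is CPD and $\|W_{T,h}\|=1$ for all $h\in\mathcal{H}$.
   Context: $\boldsymbol{B}(\mathcal{H})$ is the algebra of bounded linear operators on $\mathcal{H}$. A real sequence $\{\gamma_n\}_{n=0}^\infty$ is conditionally positive definite (CPD) if $\sum_{i,j=0}^k \gamma_{i+j}\lambda_i\bar\lambda_j\geq 0$ for all finite complex sequences $\lambda_0,\ldots,\lambda_k$ with $\sum_{i=0}^k\lambda_i=0$. A bounded operator $T$ on a Hilbert space is CPD if $\{\|T^nh\|^2\}_{n=0}^\infty$ is CPD for every vector $h$. A contraction is an operator of norm at most $1$. The weighted shift is $W_{T,h}=UD_{T,h}$, where $U$ is the (isometric) unilateral shift on $\ell^2$ ($Ue_n=e_{n+1}$, $\{e_n\}_{n=0}^\infty$ the standard orthonormal basis) and $D_{T,h}$ is the (possibly unbounded, normal) diagonal operator in $\ell^2$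 with diagonal $\big\{\mathrm{e}^{\frac12(\|T^{n+1}h\|^2-\|T^nh\|^2)}\big\}_{n=0}^\infty$ with respect to this basis, on its maximal domain. In (ii-c) and (ii-d), $\|W_{T,h}\|=1$ includes that $W_{T,h}$ is bounded. A densely defined operator $S$ in a complex Hilbert space $\mathcal{M}$ is subnormal if there are a complex Hilbert space $\mathcal{K}\supseteq\mathcal{M}$ (isometric embedding) and a (possibly unbounded) normal operator $N$ in $\mathcal{K}$ such that the domain of $S$ is contained in the domain of $N$ and $Sf=Nf$ for all $f$ in the domain of $S$; for bounded everywhere defined $S$ this is the usual notion with $N$ bounded. *)

(* Defs.v *)
From HB Require Import structures.
From mathcomp Require Import all_boot all_order all_algebra.
From mathcomp Require Import all_classical all_reals all_analysis.
From mathcomp Require Import complex ring lra.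
Set Implicit Arguments. Unset Strict Implicit. Unset Printing Implicit Defensive.
Import Order.TTheory GRing.Theory Num.Theory.
Import numFieldNormedType.Exports.
Local Open Scope classical_set_scope.
Local Open Scope complex_scope.
Local Open Scope ring_scope.

(* Complex scalars are R[i] for R : realType. *)

HB.instance Definition _ (R : realType) := NormedModule.copy R[i] R[i]^o.

(* Norms over R[i] take values in R[i]; nrm x is the norm of x as an element of R. *)
Definition nrm (R : realType) (V : normedZmodType R[i]) (x : V) : R :=
  complex.Re `|x|.

Section Nrm.
Context (R : realType).
Implicit Type V : normedZmodType R[i].

Lemma nrmE V (x : V) : `|x| = (nrm x)%:C.
Proof. by rewrite /nrm RRe_real// normr_real. Qed.

Lemma nrm_ge0 V (x : V) : 0 <= nrm x.
Proof. by rewrite -ler0c -nrmE. Qed.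

Lemma nrm0 V : nrm (0 : V) = 0.
Proof. by rewrite /nrm normr0. Qed.

Lemma nrmN V (x : V) : nrm (- x) = nrm x.
Proof. by rewrite /nrm normrN. Qed.

Lemma nrmD V (x y : V) : nrm (x + y) <= nrm x + nrm y.
Proof. by rewrite -lecR rmorphD/= -!nrmE ler_normD. Qed.

Lemma nrm_sqrD V (x y : V) :
  nrm (x + y) ^+ 2 <= 2 * nrm x ^+ 2 + 2 * nrm y ^+ 2.
Proof.
apply: (@le_trans _ _ ((nrm x + nrm y) ^+ 2)).
  by rewrite ler_sqr ?nnegrE ?addr_ge0 ?nrm_ge0// nrmD.
by have := sqr_ge0 (nrm x - nrm y); rewrite sqrrB sqrrD; lra.
Qed.

Lemma nrm_conj (x : R[i]) : nrm x^* = nrm x.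
Proof. by rewrite /nrm norm_conjC. Qed.

Lemma nrmM (x y : R[i]) : nrm (x * y) = nrm x * nrm y.
Proof. by apply: complexI; rewrite rmorphM/= -!nrmE normrM. Qed.

Lemma Re_le_nrm (x : R[i]) : `|complex.Re x| <= nrm x.
Proof. by rewrite -lecR -nrmE normc_ge_Re. Qed.

Lemma Im_le_nrm (x : R[i]) : `|complex.Im x| <= nrm x.
Proof.
have := Re_le_nrm (x * 'i%C); rewrite ReiNIm normrN => /le_trans; apply.
rewrite nrmM /nrm/= [X in _ * X](_ : _ = 1) ?mulr1//.
by rewrite /= expr0n/= expr1n add0r sqrtr1.
Qed.

Lemma nrm_le_ReIm (x : R[i]) :
  nrm x <= `|complex.Re x| + `|complex.Im x|.
Proof.
rewrite {1}(complexE x) (le_trans (nrmD _ _))// nrmM.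
rewrite (_ : nrm 'i%C = 1); last by rewrite /nrm/= expr0n/= expr1n add0r sqrtr1.
by rewrite mul1r /nrm !normc_def/= !expr0n/= !addr0 !sqrtr_sqr.
Qed.

Lemma complex_eqE (x y : R[i]) :
  complex.Re x = complex.Re y -> complex.Im x = complex.Im y -> x = y.
Proof. by case: x y => [a b] [c d] /= -> ->. Qed.

Lemma complex_gt0 (e : R[i]) : 0 < e -> exists2 r : R, 0 < r & e = r%:C.
Proof.
move=> e0; exists (complex.Re e); last by rewrite RRe_real// gtr0_real.
by move: e0; rewrite ltcE => /andP[].
Qed.

Lemma cvg_nrmP (I : Type) (V : pseudoMetricNormedZmodType R[i]) (F : set_system I)
    (FF : Filter F) (f : I -> V) (l : V) :
  f @ F --> l <-> (forall e : R, 0 < e -> \forall x \near F, nrm (l - f x) < e).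
Proof.
split=> [/cvgrPdist_lt h e e0|h].
  have e0' : (0 : R[i]) < e%:C by rewrite ltcR.
  by apply: filterS (h _ e0') => x; rewrite nrmE ltcR.
apply/cvgrPdist_lt => _ /complex_gt0[e e0 ->].
by apply: filterS (h _ e0) => x; rewrite nrmE ltcR.
Qed.

Lemma cvg_ReIm (I : Type) (F : set_system I) (FF : Filter F) (f : I -> R[i]) (a b : R) :
  (@complex.Re R \o f) @ F --> a -> (@complex.Im R \o f) @ F --> b ->
  f @ F --> (a +i* b : R[i]).
Proof.
move=> /cvgrPdist_lt fa /cvgrPdist_lt fb; apply/cvg_nrmP => e e0.
have e20 : 0 < e / 2 by rewrite divr_gt0.
apply: filterS (filterI (fa _ e20) (fb _ e20)) => x [/= xa xb].
rewrite (le_lt_trans (nrm_le_ReIm _))// (splitr e).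
by move: xa xb; case: (f x) => c d /= *; rewrite ltrD.
Qed.

Lemma complex_complete (F : set_system R[i]) :
  ProperFilter F -> cauchy F -> cvg F.
Proof.
move=> FF /cauchy_ballP Fc; apply/cvg_ex.
have aux (g : R[i] -> R) : (forall x y, `|g x - g y| <= nrm (x - y)) ->
    cvg (g @ F).
  move=> gn; apply/cauchy_cvgP/cauchy_ballP => e e0.
  have e0' : (0 : R[i]) < e%:C by rewrite ltcR.
  have [A [FA AA]] : exists A, F A /\ forall x y, A x -> A y -> nrm (x - y) < e.
    have [[A B] /= [FA FB] AB] := Fc _ e0'.
    exists (A `&` B); split; first exact: filterI.
    move=> x y [Ax Bx] [Ay By]; have := AB (x, y) (conj Ax By).
    by rewrite -ball_normE/= nrmE ltcR.
  exists (g @` A, g @` A) => /=.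
    by split; apply: (@filterS _ F _ A) FA => x Ax; exists x.
  move=> [_ _] [/= [x Ax <-] [y Ay <-]].
  by rewrite -ball_normE/= (le_lt_trans (gn _ _))// AA.
have /cvg_ex[a Fa] : cvg (@complex.Re R @ F).
  by apply: aux => x y; rewrite -raddfB Re_le_nrm.
have /cvg_ex[b Fb] : cvg (@complex.Im R @ F).
  by apply: aux => x y; rewrite -raddfB Im_le_nrm.
exists (a +i* b); exact: (@cvg_ReIm _ F _ id).
Qed.

Lemma cvg_conj (I : Type) (F : set_system I) (FF : Filter F) (f : I -> R[i]) (l : R[i]) :
  f @ F --> l -> (fun x => (f x)^*) @ F --> l^*.
Proof.
move=> /cvg_nrmP fl; apply/cvg_nrmP => e e0.
by apply: filterS (fl _ e0) => x; rewrite -rmorphB/= nrm_conj.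
Qed.

End Nrm.
HB.instance Definition _ (R : realType) :=
  Uniform_isComplete.Build R[i] (@complex_complete R).

Section SqSum.
Context (R : realType).
Implicit Types f g : nat -> R[i].

Definition sq_summable f : Prop := cvgn (series (fun n => nrm (f n) ^+ 2)).

Lemma sq_summableP f :
  sq_summable f <-> exists M, forall n, \sum_(i < n) nrm (f i) ^+ 2 <= M.
Proof.
have nd : {homo series (fun n => nrm (f n) ^+ 2) : n m / (n <= m)%N >-> n <= m}.
  by apply: nondecreasing_series => n _ _; rewrite sqr_ge0.
split=> [cf|[M fM]].
  exists (limn (series (fun n => nrm (f n) ^+ 2))) => n.
  by have := nondecreasing_cvgn_le nd cf n; rewrite /series/= big_mkord.
apply: nondecreasing_is_cvgn => //; exists M => _ [n _ <-].
by rewrite /series/= big_mkord.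
Qed.

Lemma sq_summable0 : sq_summable 0.
Proof.
by apply/sq_summableP; exists 0 => n; rewrite big1// => i _; rewrite nrm0 expr0n.
Qed.

Lemma sq_summableP_lin (a : R[i]) f g :
  sq_summable f -> sq_summable g -> sq_summable (a *: f + g).
Proof.
move=> /sq_summableP[M fM] /sq_summableP[N gN]; apply/sq_summableP.
exists (2 * (nrm a ^+ 2 * M) + 2 * N) => n.
apply: (@le_trans _ _
    (\sum_(i < n) (2 * (nrm a ^+ 2 * nrm (f i) ^+ 2) + 2 * nrm (g i) ^+ 2))).
  by apply: ler_sum => i _; rewrite (le_trans (nrm_sqrD _ _))// nrmM exprMn.
rewrite big_split/= -!mulr_sumr; apply: lerD; apply: ler_wpM2l => //; last exact: gN.
by rewrite ler_wpM2l ?sqr_ge0 ?fM.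
Qed.

Lemma cvg_series_complex (u : nat -> R[i]) :
  cvgn (series (fun n => nrm (u n))) -> cvgn (series u).
Proof.
move=> cu.
have ReI (g : {additive R[i] -> R}) : (forall x, `|g x| <= nrm x) ->
    cvgn (g \o series u).
  move=> gn.
  have -> : g \o series u = series (g \o u).
    by apply/funext => n /=; rewrite /series/= raddf_sum.
  apply: (@normed_cvg R R); apply: series_le_cvg cu => n //=.
    exact: nrm_ge0.
have /cvg_ex[a ua] : cvgn (@complex.Re R \o series u).
  by apply: ReI => x; exact: Re_le_nrm.
have /cvg_ex[b ub] : cvgn (@complex.Im R \o series u).
  by apply: ReI => x; exact: Im_le_nrm.
by apply/cvg_ex; exists (a +i* b); apply: cvg_ReIm.
Qed.

Lemma cvg_ip f g : sq_summable f -> sq_summable g ->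
  cvgn (series (fun n => f n * (g n)^*)).
Proof.
move=> /sq_summableP[M fM] /sq_summableP[N gN]; apply: cvg_series_complex.
apply: nondecreasing_is_cvgn.
  by apply: nondecreasing_series => n _ _; rewrite nrm_ge0.
exists (M + N) => _ [n _ <-]; rewrite /series/= big_mkord.
rewrite (le_trans _ (lerD (fM n) (gN n)))// -big_split/= ler_sum// => i _.
rewrite nrmM nrm_conj.
have := sqr_ge0 (nrm (f i) - nrm (g i)).
have := nrm_ge0 (f i); have := nrm_ge0 (g i).
by nra.
Qed.

Definition l2_pred : {pred (nat -> R[i])} := fun f => `[< sq_summable f >].

Lemma l2_submod_closed : submod_closed l2_pred.
Proof.
split; first exact/asboolP/sq_summable0.
by move=> a f g /asboolP sf /asboolP sg; apply/asboolP/sq_summableP_lin.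
Qed.

HB.instance Definition _ := GRing.isSubmodClosed.Build _ _ l2_pred
  l2_submod_closed.

Record l2 := L2 { l2_seq :> nat -> R[i]; _ : l2_pred l2_seq }.
HB.instance Definition _ := [isSub for l2_seq].
HB.instance Definition _ := gen_eqMixin l2.
HB.instance Definition _ := gen_choiceMixin l2.
HB.instance Definition _ := [SubChoice_isSubLmodule of l2 by <:].

Lemma l2_summable (f : l2) : sq_summable f.
Proof. by have /asboolP := valP f. Qed.

Definition l2_of f (sf : sq_summable f) : l2 := @L2 f (asboolT sf).

Lemma l2P (f g : l2) : f =1 g -> f = g.
Proof. by move=> fg; apply/val_inj/funext. Qed.

Lemma l2D (f g : l2) n : (f + g) n = f n + g n. Proof. by []. Qed.
Lemma l2Z (a : R[i]) (f : l2) n : (a *: f) n = a * f n. Proof. by []. Qed.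
Lemma l2B (f g : l2) n : (f - g) n = f n - g n. Proof. by []. Qed.
Lemma l20 n : (0 : l2) n = 0. Proof. by []. Qed.

Definition l2dot (f g : l2) : R[i] := limn (series (fun n => f n * (g n)^*)).

Lemma cvg_l2dot (f g : l2) :
  series (fun n => f n * (g n)^*) @ \oo --> l2dot f g.
Proof. by apply: cvg_ip; exact: l2_summable. Qed.

Lemma l2dot_linearl (g : l2) a (f h : l2) :
  l2dot (a *: f + h) g = a * l2dot f g + l2dot h g.
Proof.
apply: cvg_lim => //.
rewrite [X in X @ _ --> _](_ : _ = (fun n => a *
  series (fun n => f n * (g n)^*) n + series (fun n => h n * (g n)^*) n)).
  by apply: cvgD; [apply: cvgMr|]; exact: cvg_l2dot.
apply/funext => n; rewrite /series/= mulr_sumr -big_split/=.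
by apply: eq_bigr => i _; rewrite mulrDl mulrA.
Qed.

Lemma l2dotC (f g : l2) : l2dot f g = (l2dot g f)^*.
Proof.
apply: cvg_lim => //.
rewrite [X in X @ _ --> _](_ : _ = (fun n =>
  (series (fun n => g n * (f n)^*) n)^*)).
  by apply: cvg_conj; exact: cvg_l2dot.
apply/funext => n; rewrite /series/= rmorph_sum/=.
by apply: eq_bigr => i _; rewrite rmorphM/= conjCK mulrC.
Qed.

Lemma l2dotxx (f : l2) :
  l2dot f f = (limn (series (fun n => nrm (f n) ^+ 2)))%:C.
Proof.
apply: cvg_lim => //; apply: (@cvg_ReIm R nat).
  rewrite [X in X @ _ --> _](_ : _ = series (fun n => nrm (f n) ^+ 2)).
    exact: l2_summable.
  apply/funext => n; rewrite /series/= raddf_sum; apply: eq_bigr => i _.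
  by rewrite -normCK nrmE -rmorphXn.
rewrite [X in X @ _ --> _](_ : _ = cst 0); first exact: cvg_cst.
apply/funext => n; rewrite /series/= raddf_sum big1// => i _.
by rewrite -normCK nrmE -rmorphXn.
Qed.

Lemma l2dot_ge (f : l2) n :
  \sum_(i < n) nrm (f i) ^+ 2 <= limn (series (fun n => nrm (f n) ^+ 2)).
Proof.
have nd : {homo series (fun n => nrm (f n) ^+ 2) : n m / (n <= m)%N >-> n <= m}.
  by apply: nondecreasing_series => m _ _; rewrite sqr_ge0.
by have := nondecreasing_cvgn_le nd (@l2_summable f) n; rewrite /series/= big_mkord.
Qed.

Lemma l2dot_gt0 (f : l2) : f != 0 -> 0 < l2dot f f.
Proof.
move=> f0; rewrite l2dotxx ltcR.
have [n fn] : exists n, f n != 0.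
  apply: contrapT => /forallNP fz; move/eqP: f0; apply; apply: l2P => n.
  by have /negP := fz n; rewrite negbK => /eqP.
apply: lt_le_trans (l2dot_ge f n.+1).
rewrite big_ord_recr/= ltr_wpDl ?sumr_ge0// => [i _|]; first by rewrite sqr_ge0.
rewrite exprn_gt0// lt_neqAle nrm_ge0 andbT eq_sym.
by apply: contra fn => /eqP fn; rewrite -normr_eq0 nrmE fn.
Qed.

End SqSum.

Section DotTriangle.
Variables (C : numClosedFieldType) (U : lmodType C).
Variable dot : {dot U for (@Num.conj C)}.

Lemma dot_CauchySchwarz u v : `|dot u v| ^+ 2 <= dot u u * dot v v.
Proof.
have [->|nz_v] := eqVneq v 0; first by rewrite linear0r normr0 expr0n/= mulr_ge0 ?dnorm_ge0.
have v0 : 0 < dot v v by rewrite dnorm_gt0.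
pose a := dot u v / dot v v.
have ov : dot (u - a *: v) v = 0.
  by rewrite linearBl/= linearZl_LR/= divfK ?gt_eqF ?subrr.
have := dnorm_ge0 dot (u - a *: v).
rewrite linearBr/= linearZr_LR/=; rewrite ov mulr0 subr0 linearBl/= linearZl_LR/=.
rewrite (hermC _ v u)/= expr0 mul1r subr_ge0 /a mulrAC ler_pdivrMr//.
by rewrite -normCK.
Qed.

Lemma dot_triangle u v :
  sqrtC (dot (u + v) (u + v)) <= sqrtC (dot u u) + sqrtC (dot v v).
Proof.
rewrite -ler_sqr ?rpredD ?nnegrE ?addr_ge0 ?sqrtC_ge0 ?dnorm_ge0//.
rewrite sqrrD !sqrtCK addrAC dnormD lerD2l.
have CS : `|dot u v| <= sqrtC (dot u u) * sqrtC (dot v v).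
  rewrite -(sqrCK (normr_ge0 _)) -sqrtCM ?nnegrE ?dnorm_ge0//.
  by rewrite ler_sqrtC ?qualifE/= ?mulr_ge0 ?dnorm_ge0 ?exprn_ge0// dot_CauchySchwarz.
rewrite -mulr_natr -[_ + _](divfK (negbT (pnatr_eq0 C 2))) -/('Re _).
rewrite ler_pM2r ?ltr0n//.
have := leif_Re_Creal (dot u v); rewrite ReE => -[h _].
exact: le_trans h CS.
Qed.
End DotTriangle.

Lemma nrm_distl (R : realType) (V : normedZmodType R[i]) (x y : V) :
  `|nrm x - nrm y| <= nrm (x - y).
Proof.
rewrite ler_norml; apply/andP; split.
  by have := nrmD (y - x) x; rewrite -(nrmN (y - x)) opprB subrK; lra.
by have := nrmD (x - y) y; rewrite subrK; lra.
Qed.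

(* hdot is linear in its first argument and conjugate-linear in the second. *)
HB.mixin Record isHilbert (R : realType) H & CompleteNormedModule R[i] H := {
  hdot : {dot H for (@Num.conj R[i])};
  hdotxx : forall x : H, hdot x x = `|x| ^+ 2 }.

#[short(type="hilbertType")]
HB.structure Definition Hilbert (R : realType) :=
  { H of CompleteNormedModule R[i] H & isHilbert R H }.

Section L2Hilbert.
Context (R : realType).
Notation l2 := (l2 R).

Lemma l2dot_bilinear :
  bilinear_for ( *%R : R[i] -> R[i] -> R[i]) (Num.conj \; *%R) (@l2dot R).
Proof.
split => g a f h.
  exact: l2dot_linearl.
by rewrite l2dotC l2dot_linearl rmorphD rmorphM/= -!l2dotC.
Qed.

HB.instance Definition _ := @bilinear_isBilinear.Build R[i] l2 l2 R[i]
  _ _ (@l2dot R) l2dot_bilinear.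

Lemma l2dot_herm (f g : l2) : l2dot f g = (-1) ^+ false * (l2dot g f)^*.
Proof. by rewrite expr0 mul1r -l2dotC. Qed.

HB.instance Definition _ := @isHermitianSesquilinear.Build R[i] l2 false
  (@Num.conj R[i]) (@l2dot R) l2dot_herm.

HB.instance Definition _ := @isDotProduct.Build R[i] l2 (@l2dot R)
  (@l2dot_gt0 R).

Definition l2norm (f : l2) : R[i] := sqrtC (l2dot f f).

Lemma l2normD f g : l2norm (f + g) <= l2norm f + l2norm g.
Proof. exact: (dot_triangle (@l2dot R)). Qed.

Lemma l2normZ (a : R[i]) (f : l2) : l2norm (a *: f) = `|a| * l2norm f.
Proof.
rewrite /l2norm (dnormZ (@l2dot R)) sqrtCM ?nnegrE ?exprn_ge0 ?dnorm_ge0//.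
by rewrite sqrCK.
Qed.

Lemma l2norm0_eq0 (f : l2) : l2norm f = 0 -> f = 0.
Proof.
by move=> /eqP; rewrite sqrtC_eq0 (dnorm_eq0 (@l2dot R)) => /eqP.
Qed.

HB.instance Definition _ :=
  Lmodule_isNormed.Build R[i] l2 l2normD l2normZ l2norm0_eq0.

Lemma l2_norm_sqr (f : l2) : l2dot f f = `|f| ^+ 2.
Proof. by rewrite sqrtCK. Qed.

Lemma l2_nrm_sqr (f : l2) :
  nrm f ^+ 2 = limn (series (fun n => nrm (f n) ^+ 2)).
Proof.
by apply: complexI; rewrite rmorphXn/= -nrmE -l2_norm_sqr l2dotxx.
Qed.

Lemma l2_nrm_ge (f : l2) n : \sum_(i < n) nrm (f i) ^+ 2 <= nrm f ^+ 2.
Proof. by rewrite l2_nrm_sqr l2dot_ge. Qed.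

Lemma l2_nrm_le (f : nat -> R[i]) M :
  (forall n, \sum_(i < n) nrm (f i) ^+ 2 <= M ^+ 2) -> 0 <= M ->
  exists2 g : l2, f =1 g & nrm g <= M.
Proof.
move=> fM M0.
have sf : sq_summable f by apply/sq_summableP; exists (M ^+ 2).
exists (l2_of sf) => //.
rewrite -ler_sqr ?nnegrE ?nrm_ge0// l2_nrm_sqr; apply: limr_le.
  exact: (@l2_summable _ (l2_of sf)).
by near=> n; rewrite /series/= big_mkord.
Unshelve. all: by end_near. Qed.

Lemma l2_coord_le (f : l2) n : nrm (f n) <= nrm f.
Proof.
rewrite -ler_sqr ?nnegrE ?nrm_ge0//; apply: le_trans (l2_nrm_ge f n.+1).
by rewrite big_ord_recr/= lerDr sumr_ge0// => i _; rewrite sqr_ge0.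
Qed.

Lemma l2_complete (F : set_system l2) : ProperFilter F -> cauchy F -> cvg F.
Proof.
move=> FF /cauchy_ballP Fc.
have small (e : R) : 0 < e ->
    exists2 A, F A & forall x y, A x -> A y -> nrm (x - y) < e.
  move=> e0; have e0' : (0 : R[i]) < e%:C by rewrite ltcR.
  have [[A B] /= [FA FB] AB] := Fc _ e0'.
  exists (A `&` B); first exact: filterI.
  move=> x y [Ax Bx] [Ay By]; have := AB (x, y) (conj Ax By).
  by rewrite -ball_normE/= nrmE ltcR.
have coord n : cvg ((fun x : l2 => x n) @ F).
  apply/cauchy_cvgP/cauchy_ballP => _ /complex_gt0[e e0 ->].
  have [A FA AA] := small _ e0.
  exists ((fun x : l2 => x n) @` A, (fun x : l2 => x n) @` A) => /=.
    by split; apply: (@filterS _ F _ A) FA => x Ax; exists x.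
  move=> [_ _] [/= [x Ax <-] [y Ay <-]].
  rewrite -ball_normE/= nrmE ltcR -l2B (le_lt_trans (l2_coord_le _ _))//.
  exact: AA.
pose f n := lim ((fun x : l2 => x n) @ F).
have near_f (e : R) : 0 < e ->
    \forall x \near F, exists2 g : l2,
      (forall n, f n - (x : l2) n = g n) & nrm g <= e.
  move=> e0; have [A FA AA] := small _ e0.
  apply: (@filterS _ F _ A) (FA) => x Ax.
  apply: (@l2_nrm_le (fun n => f n - x n)); last exact: ltW.
  move=> n.
  have cv : (fun y : l2 => \sum_(i < n) nrm (y i - x i) ^+ 2) @ F -->
      \sum_(i < n) nrm (f i - x i) ^+ 2.
    apply: cvg_big => [xy|i _]; first exact: add_continuous.
    have cvi : (fun y : l2 => nrm (y i - x i)) @ F --> nrm (f i - x i).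
      apply/cvgrPdist_lt => d d0.
      have /cvg_nrmP/(_ _ d0) := coord i; apply: filterS => y.
      apply: le_lt_trans.
      rewrite (_ : f i - y i = (f i - x i) - (y i - x i)); last by ring.
      exact: nrm_distl.
    by apply: cvgM.
  rewrite -(cvg_lim (@Rhausdorff R) cv); apply: limr_le; first exact: cvgP cv.
  apply: (@filterS _ F _ A) FA => y Ay.
  apply: (@le_trans _ _ (nrm (y - x) ^+ 2)); first exact: (l2_nrm_ge (y - x)).
  by rewrite ler_sqr ?nnegrE ?nrm_ge0 ?ltW// AA.
have [x0 [g fg _]] := filter_ex (near_f _ ltr01).
apply/cvg_ex; exists (x0 + g); apply/(cvg_nrmP _ id) => e e0.
have e20 : 0 < e / 2 by rewrite divr_gt0.
apply: filterS (near_f _ e20) => x [h fh hn].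
rewrite (_ : x0 + g - x = h).
  by rewrite (le_lt_trans hn)// ltr_pdivrMr// ltr_pMr// ltr1n.
by apply: l2P => n; rewrite l2B l2D -fg -fh; ring.
Qed.

HB.instance Definition _ := Uniform_isComplete.Build l2 l2_complete.
HB.instance Definition _ := isHilbert.Build R l2 l2_norm_sqr.
End L2Hilbert.

Lemma l2_hdotE (R : realType) (f g : l2 R) : hdot f g = l2dot f g.
Proof. by []. Qed.

(* A possibly unbounded linear operator from H to K is given by its graph. *)
Record operator (R : realType) (H K : hilbertType R) := Operator {
  graph :> set (H * K);
  graph0 : graph 0;
  graph_lin : forall (a : R[i]) p q, graph p -> graph q -> graph (a *: p + q);
  graph_fun : forall x y z, graph (x, y) -> graph (x, z) -> y = z }.

Section Relations.
Context (R : realType) (H K L : hilbertType R).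

Definition opdom (S : set (H * K)) : set H := [set x | exists y, S (x, y)].

Definition densely_defined (S : set (H * K)) : Prop :=
  closure (opdom S) = setT.

Definition adjoint (S : set (H * K)) : set (K * H) :=
  [set p | forall q, S q -> hdot q.2 p.1 = hdot q.1 p.2].

Definition rel_comp (T : set (K * L)) (S : set (H * K)) : set (H * L) :=
  [set p | exists2 y, S (p.1, y) & T (y, p.2)].

(* +oo when S is unbounded *)
Definition opnorm (S : set (H * K)) : \bar R :=
  ereal_sup [set (nrm p.2)%:E | p in [set p | S p /\ nrm p.1 <= 1]].

Definition bounded_op (S : set (H * K)) : Prop :=
  opdom S = setT /\ (opnorm S < +oo)%E.

End Relations.

Section Operators.
Context (R : realType).
Implicit Types H K L : hilbertType R.

Lemma op_comp0 H K L (T : operator K L) (S : operator H K) : rel_comp T S 0.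
Proof. by exists 0; exact: graph0. Qed.

Lemma op_comp_lin H K L (T : operator K L) (S : operator H K) (a : R[i]) p q :
  rel_comp T S p -> rel_comp T S q -> rel_comp T S (a *: p + q).
Proof.
move=> [y Sy Ty] [z Sz Tz]; exists (a *: y + z).
  exact: (graph_lin a Sy Sz).
exact: (graph_lin a Ty Tz).
Qed.

Lemma op_comp_fun H K L (T : operator K L) (S : operator H K) x y z :
  rel_comp T S (x, y) -> rel_comp T S (x, z) -> y = z.
Proof.
move=> [u Su Tu] [v Sv Tv]; apply: (graph_fun Tu).
by rewrite (graph_fun Su Sv).
Qed.

Definition op_comp H K L (T : operator K L) (S : operator H K) : operator H L :=
  Operator (op_comp0 T S) (@op_comp_lin _ _ _ T S) (@op_comp_fun _ _ _ T S).

Definition lin_op H K (f : {linear H -> K}) : operator H K.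
Proof.
apply: (@Operator _ _ _ [set p | p.2 = f p.1]) => /=.
- by rewrite linear0.
- by move=> a p q -> ->; rewrite linearP.
- by move=> x y z -> ->.
Defined.

(* S x for x in the domain of S, and 0 otherwise *)
Definition op_fun H K (S : operator H K) (x : H) : K :=
  xget 0 [set y | graph S (x, y)].

Lemma lin_opE H K (f : {linear H -> K}) : op_fun (lin_op f) = f.
Proof.
apply/funext => x; rewrite /op_fun; case: xgetP => [y _ /=//|np].
by case: (np (f x)).
Qed.

Definition contractive_op H (S : operator H H) : Prop :=
  bounded_op S /\ (opnorm S <= 1)%E.

(* The adjoint is the operator adjoint as N is densely defined; equality of the
   two products includes equality of their domains. *)
Definition normal_op H (N : operator H H) : Prop :=
  [/\ densely_defined N, closed N &
      rel_comp (adjoint N) N = rel_comp N (adjoint N)].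

(* H is identified with a subspace of K by means of the isometry V *)
Definition normal_extension H K (S : operator H H) (V : {linear H -> K})
    (N : operator K K) : Prop :=
  [/\ forall x, `|V x| = `|x|, normal_op N &
      forall x y, graph S (x, y) -> graph N (V x, V y)].

Definition subnormal H (S : operator H H) : Prop :=
  densely_defined S /\
  exists (K : hilbertType R) (V : {linear H -> K}) (N : operator K K),
    normal_extension S V N.

(* For a bounded everywhere defined S the normal extension is required to be
   bounded and everywhere defined as well. *)
Definition bounded_subnormal H (S : operator H H) : Prop :=
  bounded_op S /\
  exists (K : hilbertType R) (V : {linear H -> K}) (N : operator K K),
    bounded_op N /\ normal_extension S V N.

(* 0 <= z in R[i] means that z is real and nonnegative. *)
Definition cpd_seq (c : nat -> R) : Prop :=
  forall k (lam : nat -> R[i]), \sum_(i < k.+1) lam i = 0 ->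
  0 <= \sum_(i < k.+1) \sum_(j < k.+1) (c (i + j)%N)%:C * lam i * (lam j)^*.

Definition cpd_op H (S : operator H H) : Prop :=
  bounded_op S /\
  forall x, cpd_seq (fun n => nrm (iter n (op_fun S) x) ^+ 2).

End Operators.

Section WeightedShift.
Context (R : realType).

Definition shift_seq (f : nat -> R[i]) (n : nat) : R[i] :=
  if n is m.+1 then f m else 0.

Lemma shift_subproof (f : l2 R) : sq_summable (shift_seq f).
Proof.
apply/sq_summableP; exists (nrm f ^+ 2) => -[|n].
  by rewrite big_ord0 sqr_ge0.
by rewrite big_ord_recl/= nrm0 expr0n add0r l2_nrm_ge.
Qed.

Definition l2_shift (f : l2 R) : l2 R := l2_of (@shift_subproof f).

Lemma l2_shift_linear : linear l2_shift.
Proof.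
by move=> a f g; apply: l2P => -[|n]; rewrite l2D l2Z //= mulr0 addr0.
Qed.

HB.instance Definition _ :=
  GRing.isLinear.Build R[i] (l2 R) (l2 R) _ l2_shift l2_shift_linear.

(* the maximal domain: diag_op d is defined at f iff (d n * f n)_n is in l2 *)
Definition diag_graph (d : nat -> R[i]) : set (l2 R * l2 R) :=
  [set p : l2 R * l2 R | forall n, p.2 n = d n * p.1 n].

Lemma diag_graph0 d : diag_graph d 0.
Proof. by move=> n; rewrite mulr0. Qed.

Lemma diag_graph_lin d (a : R[i]) p q :
  diag_graph d p -> diag_graph d q -> diag_graph d (a *: p + q).
Proof. by move=> hp hq n; rewrite !l2D !l2Z hp hq; ring. Qed.

Lemma diag_graph_fun d f g h :
  diag_graph d (f, g) -> diag_graph d (f, h) -> g = h.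
Proof. by move=> fg fh; apply: l2P => n; rewrite fg fh. Qed.

Definition diag_op (d : nat -> R[i]) : operator (l2 R) (l2 R) :=
  @Operator R (l2 R) (l2 R) (diag_graph d) (diag_graph0 d)
    (@diag_graph_lin d) (@diag_graph_fun d).

Definition weighted_shift (w : nat -> R[i]) : operator (l2 R) (l2 R) :=
  op_comp (lin_op l2_shift) (diag_op w).

Lemma weighted_shiftE w (f g : l2 R) : graph (weighted_shift w) (f, g) <->
  g 0%N = 0 /\ forall n, g n.+1 = w n * f n.
Proof.
split=> [[h /= hE gE]|[g0 gS]].
  by split=> [|n]; rewrite gE//= hE.
suff sh : sq_summable (fun n => w n * f n).
  by exists (l2_of sh) => //=; apply: l2P => -[|n] /=; rewrite ?g0 ?gS.
apply/sq_summableP; exists (nrm g ^+ 2) => n.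
apply: le_trans (l2_nrm_ge g n.+1); rewrite big_ord_recl/= g0 nrm0 expr0n add0r.
by apply: ler_sum => i _; rewrite gS.
Qed.

End WeightedShift.

Definition shift_weight (R : realType) (H : hilbertType R)
    (T : {linear H -> H}) (h : H) (n : nat) : R :=
  expR (2^-1 * (nrm (iter n.+1 T h) ^+ 2 - nrm (iter n T h) ^+ 2)).

Definition Wshift (R : realType) (H : hilbertType R)
    (T : {linear H -> H}) (h : H) : operator (l2 R) (l2 R) :=
  weighted_shift (fun n => (shift_weight T h n)%:C).

(* Main.v *)
(* Write g n = |T^n h|^2. The orbit of e_0 under W_(T,h) has squared norms
   exp (g n - g 0). By Schoenberg's theorem, g is CPD iff exp (t g) has positive
   semidefinite Hankel matrices for all t > 0, and rescaling h produces the factor t.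

   An operator N that is normal satisfies <z_i, z_j> = |N^(i+j) x|^2 with
   z_i = N^*^i N^i x, so the squared norms along an orbit of a subnormal operator have
   positive semidefinite Hankel matrices. Conversely, measures are avoided by working in
   reproducing kernel Hilbert spaces:
   - for a shift with squared norms c n, the Hankel matrices of c and of its shift define
     a form on the symbols z^n |z|^(i-n). In the resulting space N is the product of the
     translation z/|z|, which is unitary, and of multiplication by |z|. The latter
     exchanges the even and the odd functions; taking its maximal extension on the even
     ones and the adjoint of that on the odd ones makes it selfadjoint.
   - for a contraction T with positive semidefinite Hankel matrices for all orbits, the
     sums of (-1)^r C(l,r) |T^r f|^2 are nonnegative, as in Hausdorff's moment problem.
     Integrating the binomial expansion of (t + (1 - t))^n against these forms, and
     letting n tend to infinity, gives the Bram-Halmos positivity of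
     <T^b f, T^a g>, hence a normal extension.

   For a contraction, g is nonincreasing, hence convergent, and a convergent CPD sequence
   with nonnegative limit has positive semidefinite Hankel matrices. The weights of
   W_(T,h) are then at most 1 and tend to 1. *)
Require Import Defs.
From HB Require Import structures.
From mathcomp Require Import all_boot all_order all_algebra.
From mathcomp Require Import all_classical all_reals all_analysis.
From mathcomp Require Import complex ring lra zify.
Set Implicit Arguments. Unset Strict Implicit. Unset Printing Implicit Defensive.
Import Order.TTheory GRing.Theory Num.Theory.
Import numFieldNormedType.Exports.
Local Open Scope classical_set_scope.
Local Open Scope complex_scope.
Local Open Scope ring_scope.

(** Two constructions of a normal extension are needed because subnormality has two meanings here.
    For (i) the shift may be unbounded and its moments indeterminate: multiplication by [|z|] on
    combinations of symbols is then symmetric, but need not be essentially selfadjoint. Only the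
    moments of even order of [|z|] are prescribed, so even and odd symbols may be declared
    orthogonal. An operator that exchanges two orthogonal subspaces, acting as a closed densely
    defined operator one way and as its adjoint the other way, is selfadjoint whatever the
    deficiency indices. For (ii) the extension has to be bounded. A shift with weights at most 1 is
    therefore treated in the same way as [T]: all its orbits, not only those of the basis vectors,
    have positive semidefinite Hankel matrices, and the construction for contractions applies to it.
    That construction does not work from conditional positivity, which is why convergence of the
    squared norms along orbits is needed. Passing from the shifts back to [T] uses nothing but the
    orbit of the first basis vector, which always lies in the domain. *)

Lemma nrm_real (R : realType) (r : R) : nrm (r%:C : R[i]) = `|r|.
Proof. by rewrite /nrm normc_def/= expr0n/= addr0 sqrtr_sqr. Qed.

Lemma conj_real (R : realType) (r : R) : (r%:C : R[i])^* = r%:C.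
Proof. exact: conjc_real. Qed.

(** * Reproducing kernel Hilbert spaces *)

Section Combinations.
Context (R : realType) (X : Type).
Notation C := R[i].
Notation comb := (seq (C * X)).
Implicit Types (f : X -> C) (v w : comb) (k : X -> X -> C).

(** A list of pairs is a formal combination of points, and [ev f w] is going to be the inner product
    of [f] with the element that [w] represents; hence the conjugated coefficients. *)
Definition ev f w : C := \sum_(p <- w) p.1^* * f p.2.
Definition kfun k v : X -> C := fun x => \sum_(p <- v) p.1 * k p.2 x.
Definition kform k v w : C := ev (kfun k v) w.
Definition combZ (a : C) v : comb := [seq (a * p.1, p.2) | p <- v].

Lemma ev_cat f v w : ev f (v ++ w) = ev f v + ev f w.
Proof. by rewrite /ev big_cat. Qed.

Lemma ev_scale f a w : ev f (combZ a w) = a^* * ev f w.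
Proof.
rewrite /ev big_map mulr_sumr; apply: eq_bigr => p _ /=.
by rewrite rmorphM mulrA.
Qed.

Lemma ev_lin a f g w : ev (a *: f + g) w = a * ev f w + ev g w.
Proof.
rewrite /ev mulr_sumr -big_split/=; apply: eq_bigr => p _.
by rewrite -[(a *: f + g) p.2]/(a * f p.2 + g p.2); ring.
Qed.

Lemma evB f g w : ev (f - g) w = ev f w - ev g w.
Proof. by rewrite addrC -scaleN1r ev_lin mulN1r addrC. Qed.

Lemma ev1 f x : ev f [:: (1, x)] = f x.
Proof. by rewrite /ev big_seq1/= rmorph1 mul1r. Qed.

Lemma kform_catl k u v w : kform k (u ++ v) w = kform k u w + kform k v w.
Proof.
rewrite /kform -[X in X + _]mul1r -ev_lin scale1r; congr ev.
by apply/funext => x; rewrite /kfun big_cat.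
Qed.

Lemma kform_scalel k a v w : kform k (combZ a v) w = a * kform k v w.
Proof.
rewrite /kform /ev mulr_sumr; apply: eq_bigr => p _.
rewrite /kfun big_map mulrCA; congr (_ * _).
by rewrite mulr_sumr; apply: eq_bigr => q _ /=; rewrite mulrA.
Qed.

Lemma kformE k v w :
  kform k v w = \sum_(p <- v) \sum_(q <- w) p.1 * q.1^* * k p.2 q.2.
Proof.
rewrite /kform /ev exchange_big/=; apply: eq_bigr => q _.
by rewrite /kfun mulr_sumr; apply: eq_bigr => p _; ring.
Qed.

Lemma kform_conj k v w : (forall x y, k y x = (k x y)^*) ->
  kform k w v = (kform k v w)^*.
Proof.
move=> kC; rewrite !kformE exchange_big/= rmorph_sum; apply: eq_bigr => p _.
rewrite rmorph_sum; apply: eq_bigr => q _.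
by rewrite (kC p.2) !rmorphM/= conjCK mulrAC mulrC mulrA mulrAC.
Qed.

End Combinations.

Record psdkernel (R : realType) (X : Type) := PsdKernel {
  kern :> X -> X -> R[i];
  kernC : forall x y, kern y x = (kern x y)^*;
  kern_ge0 : forall v, 0 <= kform kern v v }.

Section Form.
Context (R : realType) (X : Type) (k : psdkernel R X).
Notation C := R[i].
Notation comb := (seq (C * X)).
Implicit Types (f : X -> C) (v w : comb).

Definition kq v : R := complex.Re (kform k v v).
Definition knorm v : R := Num.sqrt (kq v).

Lemma kformC v w : kform k w v = (kform k v w)^*.
Proof. exact: kform_conj (kernC k). Qed.

Lemma kformxx v : kform k v v = (kq v)%:C.
Proof. by rewrite RRe_real// ger0_real// kern_ge0. Qed.

Lemma kq_ge0 v : 0 <= kq v.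
Proof. by rewrite -ler0c -kformxx kern_ge0. Qed.

Lemma knorm_ge0 v : 0 <= knorm v. Proof. exact: sqrtr_ge0. Qed.

Lemma knorm_sqr v : knorm v ^+ 2 = kq v.
Proof. by rewrite sqr_sqrtr ?kq_ge0. Qed.

Lemma kform_catr u v w : kform k u (v ++ w) = kform k u v + kform k u w.
Proof. exact: ev_cat. Qed.

Lemma kform_scaler a v w : kform k v (combZ a w) = a^* * kform k v w.
Proof. exact: ev_scale. Qed.

Lemma kq_cat_scale v w a : kq (v ++ combZ a w) =
  kq v + 2 * complex.Re (a^* * kform k v w) + nrm a ^+ 2 * kq w.
Proof.
rewrite /kq kform_catl !kform_catr kform_scalel !kform_scaler kform_scalel.
rewrite (kformC v w).
rewrite (_ : a * (kform k v w)^* = (a^* * kform k v w)^*); last first.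
  by rewrite rmorphM/= conjCK.
rewrite [a^* * (_ * _)]mulrA [a^* * a]mulrC -normCK nrmE -rmorphXn/= kformxx.
set z := a^* * _.
rewrite kformxx -rmorphM/= !raddfD/=; case: z => x y /=; ring.
Qed.

(** The form may be degenerate, so [dot_CauchySchwarz] does not apply. Positivity at [v - r b w],
    for [b] the form of [v] and [w] and [r] real, gives a nonnegative polynomial of degree at most 2
    in [r]. *)
Lemma kq_CauchySchwarz v w : nrm (kform k v w) ^+ 2 <= kq v * kq w.
Proof.
set b := kform k v w.
have h (r : R) : 0 <= kq v - 2 * r * nrm b ^+ 2 + r ^+ 2 * (nrm b ^+ 2 * kq w).
  have := kq_ge0 (v ++ combZ (- r%:C * b) w).
  rewrite kq_cat_scale -/b rmorphM rmorphN/= conj_real -mulrA [b^* * b]mulrC.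
  rewrite -normCK [`|b|]nrmE -rmorphXn/= nrmM nrmN.
  rewrite nrm_real exprMn real_normK ?num_real//=.
  move/le_trans; apply.
  by rewrite le_eqVlt; apply/orP; left; apply/eqP; ring.
have v0 := kq_ge0 v; have w0 := kq_ge0 w.
have [w_0|w_n0] := eqVneq (kq w) 0.
  rewrite w_0 mulr0 leNgt; apply/negP => b0.
  (* At this [r] the polynomial, now of degree 1, has the value -1. *)
  have := h ((kq v + 1) / (2 * nrm b ^+ 2)); rewrite w_0 !mulr0 addr0.
  have -> : 2 * ((kq v + 1) / (2 * nrm b ^+ 2)) * nrm b ^+ 2 = kq v + 1.
    by field; rewrite -sqrf_eq0 gt_eqF.
  lra.
have := h (kq w)^-1.
have -> : kq v - 2 * (kq w)^-1 * nrm b ^+ 2 + (kq w)^-1 ^+ 2 * (nrm b ^+ 2 * kq w)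
   = (kq v * kq w - nrm b ^+ 2) / kq w by field.
by rewrite pmulr_lge0 ?invr_gt0 ?lt0r ?w_n0// subr_ge0.
Qed.

Lemma knorm_CauchySchwarz v w : nrm (kform k v w) <= knorm v * knorm w.
Proof.
rewrite -ler_sqr ?nnegrE ?nrm_ge0 ?mulr_ge0 ?knorm_ge0//.
by rewrite exprMn !knorm_sqr kq_CauchySchwarz.
Qed.

(* [combZ (-1) w] represents [- w], so [cdiff v w] represents [v - w]. *)
Definition cdiff v w : comb := v ++ combZ (-1) w.

Lemma kform_diffl u v w : kform k (cdiff u v) w = kform k u w - kform k v w.
Proof. by rewrite kform_catl kform_scalel mulN1r. Qed.

Lemma ev_diff f v w : ev f (cdiff v w) = ev f v - ev f w.
Proof. by rewrite ev_cat ev_scale rmorphN rmorph1 mulN1r. Qed.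

End Form.

Section ComplexSequences.
Context (R : realType).

Lemma cvgn_cauchy (V : completeNormedModType R[i]) (u : nat -> V) (d : nat -> R) :
  d @ \oo --> 0 -> (forall n m, nrm (u n - u m) <= d n + d m) -> cvgn u.
Proof.
move=> d0 ud; apply/cauchy_cvgP/cauchy_ballP => _ /complex_gt0[e e0 ->].
have e20 : 0 < e / 2 by rewrite divr_gt0.
move/cvgrPdist_lt: d0 => /(_ _ e20)[N _ dN].
have FN : (u @ \oo) [set u n | n in [set n | (N <= n)%N]].
  by exists N => // n Nn /=; exists n.
exists ([set u n | n in [set n | (N <= n)%N]], [set u n | n in [set n | (N <= n)%N]]) => //=.
move=> [_ _] [/= [n Nn <-] [m Nm <-]]; rewrite -ball_normE/= nrmE ltcR.
rewrite (le_lt_trans (ud n m))// [ltRHS]splitr ltrD//.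
  by have := dN n Nn; rewrite /= sub0r normrN; apply/le_lt_trans/ler_norm.
by have := dN m Nm; rewrite /= sub0r normrN; apply/le_lt_trans/ler_norm.
Qed.

Lemma cvg_nrm_sqz (V : normedModType R[i]) (u : nat -> V) (l : V) (d : nat -> R) :
  d @ \oo --> 0 -> (forall n, nrm (l - u n) <= d n) -> u @ \oo --> l.
Proof.
move=> /cvgrPdist_lt d0 ud; apply/cvg_nrmP => e e0.
apply: filterS (d0 _ e0) => n /=; rewrite sub0r normrN => dn.
by rewrite (le_lt_trans (ud n))// (le_lt_trans _ dn)// ler_norm.
Qed.

Lemma cvg_nrm (V : normedModType R[i]) I (F : set_system I) {FF : Filter F}
    (u : I -> V) (l : V) : u @ F --> l -> (fun i => nrm (u i)) @ F --> nrm l.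
Proof.
move=> /cvg_nrmP ul; apply/cvgrPdist_lt => e e0.
by apply: filterS (ul _ e0) => i; apply/le_lt_trans/nrm_distl.
Qed.

Lemma cvgC_nrmB I (F : set_system I) {FF : Filter F} (u : I -> R[i]) (l c : R[i]) :
  u @ F --> l -> (fun i => nrm (u i - c)) @ F --> nrm (l - c).
Proof.
move=> /cvg_nrmP ul; apply/cvgrPdist_lt => e e0.
apply: filterS (ul _ e0) => i; apply: le_lt_trans.
by rewrite (_ : l - u i = (l - c) - (u i - c)) ?nrm_distl//; ring.
Qed.

Lemma cvg_Re I (F : set_system I) {FF : Filter F} (u : I -> R[i]) l :
  u @ F --> l -> (fun i => complex.Re (u i)) @ F --> complex.Re l.
Proof.
move=> /cvg_nrmP ul; apply/cvgrPdist_lt => e e0.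
by apply: filterS (ul _ e0) => i; apply: le_lt_trans; rewrite -raddfB Re_le_nrm.
Qed.

Lemma cvg_inv_succ : (fun n => n.+1%:R^-1 : R) @ \oo --> 0.
Proof. exact: cvg_harmonic. Qed.

Lemma cvgn_uniq (u : nat -> R[i]) (a b : R[i]) :
  u @ \oo --> a -> u @ \oo --> b -> a = b.
Proof.
move=> ua ub; rewrite -(cvg_lim (@norm_hausdorff _ R[i]) ua).
exact: (cvg_lim (@norm_hausdorff _ R[i]) ub).
Qed.

End ComplexSequences.

(** * The Hilbert space of a positive semidefinite kernel, as a space of functions *)

Section RKHS.
Context (R : realType) (X : Type) (k : psdkernel R X).
Notation C := R[i].
Notation comb := (seq (C * X)).
Implicit Types (f g : X -> C) (u v w : comb).

(* By duality this says that [f - kfun k v] has norm at most [e] in the space with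
   reproducing kernel [k], whose elements are thus realized as functions on [X]. *)
Definition approximates f v (e : R) : Prop :=
  forall w, nrm (ev f w - kform k v w) <= e * knorm k w.

(** With functions as elements, null vectors of the form need no quotient, equality is pointwise,
    and operators can be given by formulas. *)
Definition rkhs_pred : {pred (X -> C)} :=
  fun f => `[< forall e : R, 0 < e -> exists v, approximates f v e >].

Lemma approx_lin a f g v w (d e : R) : approximates f v d -> approximates g w e ->
  approximates (a *: f + g) (combZ a v ++ w) (nrm a * d + e).
Proof.
move=> fv gw u; rewrite ev_lin kform_catl kform_scalel.
rewrite (_ : _ - _ = a * (ev f u - kform k v u) + (ev g u - kform k w u)); last by ring.
rewrite (le_trans (nrmD _ _))// mulrDl lerD// nrmM -mulrA ler_wpM2l ?nrm_ge0//.
Qed.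

Lemma approx_le f v (d e : R) : d <= e -> approximates f v d -> approximates f v e.
Proof.
by move=> de fv w; rewrite (le_trans (fv w))// ler_wpM2r ?knorm_ge0.
Qed.

Lemma approx_kfun v : approximates (kfun k v) v 0.
Proof. by move=> w; rewrite subrr nrm0 mul0r. Qed.

Lemma rkhs_kfun v : rkhs_pred (kfun k v).
Proof. by apply/asboolP => e /ltW e0; exists v; apply: approx_le (approx_kfun v). Qed.

Lemma rkhs_submod_closed : submod_closed rkhs_pred.
Proof.
split.
  have -> : 0 = kfun k [::] by apply/funext => x; rewrite /kfun big_nil.
  exact: rkhs_kfun.
move=> a f g /asboolP fa /asboolP ga; apply/asboolP => e e0.
have a0 : 0 < nrm a + 1 by rewrite ltr_wpDl ?nrm_ge0.
have [|v fv] := fa (e / 2 / (nrm a + 1)); first by rewrite !divr_gt0.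
have [|w gw] := ga (e / 2); first by rewrite divr_gt0.
exists (combZ a v ++ w); apply: approx_le (approx_lin a fv gw).
rewrite [leRHS]splitr lerD2r mulrA ler_pdivrMr// mulrC ler_wpM2l//.
  by rewrite divr_ge0 ?ltW.
by rewrite lerDl.
Qed.

HB.instance Definition _ := GRing.isSubmodClosed.Build _ _ rkhs_pred
  rkhs_submod_closed.

Record rkhs := RKHS { rkhs_fun :> X -> C; _ : rkhs_pred rkhs_fun }.
HB.instance Definition _ := [isSub for rkhs_fun].
HB.instance Definition _ := gen_eqMixin rkhs.
HB.instance Definition _ := gen_choiceMixin rkhs.
HB.instance Definition _ := [SubChoice_isSubLmodule of rkhs by <:].

Implicit Types phi psi : rkhs.

Lemma rkhsP phi psi : phi =1 psi -> phi = psi.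
Proof. by move=> fg; apply/val_inj/funext. Qed.

Lemma rkhs_approx phi (e : R) : 0 < e -> exists v, approximates phi v e.
Proof. by move: e; apply/asboolP/(valP phi). Qed.

Definition comb_rkhs v : rkhs := RKHS (rkhs_kfun v).

Lemma approx_ev_le phi : exists2 M : R, 0 <= M & forall w, nrm (ev phi w) <= M * knorm k w.
Proof.
have [v av] := rkhs_approx phi ltr01.
exists (knorm k v + 1); first by rewrite addr_ge0 ?knorm_ge0.
move=> w; rewrite -[ev phi w](subrK (kform k v w)) (le_trans (nrmD _ _))//.
by rewrite addrC mulrDl lerD// knorm_CauchySchwarz.
Qed.

Lemma knorm_le v (e : R) : 0 <= e ->
  (forall w, nrm (kform k v w) <= e * knorm k w) -> knorm k v <= e.
Proof.
move=> e0 /(_ v); rewrite kformxx -knorm_sqr.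
rewrite (_ : nrm _ = knorm k v ^+ 2); last first.
  by rewrite /nrm normc_def/= expr0n/= addr0 sqrtr_sqr ger0_norm// sqr_ge0.
have := knorm_ge0 k v; rewrite le_eqVlt => /predU1P[<-//|v0].
by rewrite expr2 ler_pM2r.
Qed.

Lemma approx_diff f v w (d e : R) : 0 <= d -> 0 <= e ->
  approximates f v d -> approximates f w e -> knorm k (cdiff v w) <= d + e.
Proof.
move=> d0 e0 fv fw; apply: knorm_le => [|u]; first exact: addr_ge0.
rewrite kform_diffl (_ : _ - _ =
  (ev f u - kform k w u) - (ev f u - kform k v u)); last by ring.
by rewrite (le_trans (nrmD _ _))// nrmN mulrDl addrC lerD.
Qed.

Definition rep phi n : comb :=
  sval (cid (@rkhs_approx phi (n.+1%:R^-1) ltac:(by []))).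

Lemma repP phi n : approximates phi (rep phi n) n.+1%:R^-1.
Proof. by rewrite /rep; case: cid. Qed.

Definition rdot phi psi : C := limn (fun n => ev phi (rep psi n)).

(** The inner product does not depend on the chosen approximations of [psi]: by [approx_diff] two of
    them are close in [knorm], and [ev phi] is bounded for it. *)
Lemma cvg_ev_approx phi psi (u : nat -> comb) (d : nat -> R) :
  d @ \oo --> 0 -> (forall n, 0 <= d n) -> (forall n, approximates psi (u n) (d n)) ->
  (fun n => ev phi (u n)) @ \oo --> rdot phi psi.
Proof.
have [M M0 phiM] := approx_ev_le phi.
have cau (v w : comb) (a b : R) : 0 <= a -> 0 <= b -> approximates psi v a ->
    approximates psi w b -> nrm (ev phi v - ev phi w) <= M * a + M * b.
  move=> a0 b0 va wb; rewrite -ev_diff -mulrDr (le_trans (phiM _))//.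
  by rewrite ler_wpM2l// (approx_diff a0 b0 va wb).
have crep : (fun n => ev phi (rep psi n)) @ \oo --> rdot phi psi.
  apply: (@cvgn_cauchy _ _ _ (fun n => M * n.+1%:R^-1)).
    by rewrite -(mulr0 M); apply: cvgMr; exact: cvg_inv_succ.
  by move=> n m; apply: cau => //; exact: repP.
move=> d0 dge0 ud; apply: (@cvg_nrm_sqz _ _ _ _ (fun n => M * d n)).
  by rewrite -(mulr0 M); apply: cvgMr.
move=> n.
have h : (fun m => M * m.+1%:R^-1 + M * d n) @ \oo --> M * d n.
  rewrite -[X in _ --> X]add0r -[X in _ --> X + _](mulr0 M).
  by apply: cvgD; [apply: cvgMr; exact: cvg_inv_succ|exact: cvg_cst].
have h' : (fun m => nrm (ev phi (rep psi m) - ev phi (u n))) @ \oo -->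
    nrm (rdot phi psi - ev phi (u n)).
  exact: cvgC_nrmB.
apply: (ler_cvg_to h' h); apply: nearW => m.
by apply: cau => //; exact: repP.
Qed.

Lemma cvg_rdot phi psi : (fun n => ev phi (rep psi n)) @ \oo --> rdot phi psi.
Proof.
apply: (@cvg_ev_approx _ _ _ (fun n => n.+1%:R^-1)); first exact: cvg_inv_succ.
  by move=> n; rewrite invr_ge0.
by move=> n; exact: repP.
Qed.
Arguments cvg_rdot : clear implicits.

Lemma rdot_comb phi v : rdot phi (comb_rkhs v) = ev phi v.
Proof.
have h : (fun n => ev phi v) @ \oo --> rdot phi (comb_rkhs v).
  apply: (@cvg_ev_approx _ _ _ (fun n => 0)) => //; first exact: cvg_cst.
  by move=> n; exact: approx_kfun.
exact/esym/(cvgn_uniq (cvg_cst _) h).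
Qed.

Lemma rdot_linearl psi a phi phi' :
  rdot (a *: phi + phi') psi = a * rdot phi psi + rdot phi' psi.
Proof.
apply: (cvgn_uniq (cvg_rdot _ _)).
rewrite [X in X @ _ --> _](_ : _ = (fun n =>
   a * ev phi (rep psi n) + ev phi' (rep psi n))).
  by apply: cvgD; [apply: cvgMr|]; exact: cvg_rdot.
by apply/funext => n; rewrite -ev_lin.
Qed.

Lemma knorm_approx_le phi v (M e : R) : 0 <= M -> 0 <= e -> approximates phi v e ->
  (forall w, nrm (ev phi w) <= M * knorm k w) -> knorm k v <= M + e.
Proof.
move=> M0 e0 av Mw; apply: knorm_le => [|w]; first exact: addr_ge0.
rewrite (_ : kform k v w = ev phi w - (ev phi w - kform k v w)); last by ring.
by rewrite (le_trans (nrmD _ _))// nrmN mulrDl lerD.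
Qed.

Lemma rdotC phi psi : rdot phi psi = (rdot psi phi)^*.
Proof.
have [M M0 phiM] := approx_ev_le phi; have [N N0 psiN] := approx_ev_le psi.
have h : (fun n => ev phi (rep psi n) - (ev psi (rep phi n))^*) @ \oo -->
    rdot phi psi - (rdot psi phi)^*.
  by apply: cvgB; [|apply: cvg_conj]; exact: cvg_rdot.
apply/eqP; rewrite -subr_eq0; apply/eqP; apply: (cvgn_uniq h).
apply: (@cvg_nrm_sqz _ _ _ _ (fun n => n.+1%:R^-1 * (M + N + 2))).
  by rewrite -(mul0r (M + N + 2)); apply: cvgMl; exact: cvg_inv_succ.
move=> n; set e : R := n.+1%:R^-1; rewrite sub0r nrmN.
have e0 : 0 <= e by rewrite invr_ge0.
have e1 : e <= 1 by rewrite invf_le1 ?ler1n.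
set u := rep psi n; set v := rep phi n.
(* Both values are compared with the form of the two approximations, which is Hermitian. *)
rewrite (_ : _ - _ = (ev phi u - kform k v u) - (ev psi v - kform k u v)^*); last first.
  by rewrite rmorphB/= -kformC; ring.
rewrite (le_trans (nrmD _ _))// nrmN nrm_conj.
rewrite (le_trans (lerD (repP phi n u) (repP psi n v)))// -/e -mulrDr ler_wpM2l//.
have := knorm_approx_le M0 e0 (repP phi n) phiM.
have := knorm_approx_le N0 e0 (repP psi n) psiN.
by rewrite -/u -/v; lra.
Qed.

Lemma cvg_kq_rep phi : (fun n => (kq k (rep phi n))%:C : C) @ \oo --> rdot phi phi.
Proof.
have [M M0 phiM] := approx_ev_le phi.
rewrite -[X in _ --> X](subr0); rewrite [X in X @ _ --> _](_ : _ = (fun n => ev phi (rep phi n) -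
   (ev phi (rep phi n) - kform k (rep phi n) (rep phi n)))); last first.
  by apply/funext => n; rewrite kformxx; ring.
apply: cvgB; first exact: cvg_rdot.
apply: (@cvg_nrm_sqz _ _ _ _ (fun n => n.+1%:R^-1 * (M + 1))).
  by rewrite -(mul0r (M + 1)); apply: cvgMl; exact: cvg_inv_succ.
move=> n; have e0 : 0 <= n.+1%:R^-1 :> R by rewrite invr_ge0.
have e1 : n.+1%:R^-1 <= 1 :> R by rewrite invf_le1 ?ler1n.
rewrite sub0r nrmN (le_trans (repP phi n _))// ler_wpM2l//.
by rewrite (le_trans (knorm_approx_le M0 e0 (repP phi n) phiM))// lerD2l.
Qed.
Arguments cvg_kq_rep : clear implicits.

Lemma rdotxx phi : rdot phi phi = (complex.Re (rdot phi phi))%:C.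
Proof.
apply: (cvgn_uniq (cvg_kq_rep phi)).
apply: cvg_ReIm; last by rewrite [X in X @ _ --> _](_ : _ = cst 0)//; exact: cvg_cst.
exact: (cvg_Re (cvg_kq_rep phi)).
Qed.

Lemma cvg_kq_rep_Re phi : (fun n => kq k (rep phi n)) @ \oo --> complex.Re (rdot phi phi).
Proof. exact: (cvg_Re (cvg_kq_rep phi)). Qed.
Arguments cvg_kq_rep_Re : clear implicits.

Lemma rdot_Re_ge0 phi : 0 <= complex.Re (rdot phi phi).
Proof.
apply: (ler_cvg_to _ (cvg_kq_rep_Re phi)); first exact: cvg_cst.
by apply: nearW => n; exact: kq_ge0.
Qed.

Lemma ev_sqr_le phi w : nrm (ev phi w) ^+ 2 <= complex.Re (rdot phi phi) * kq k w.
Proof.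
have h1 : (fun n => nrm (kform k (rep phi n) w)) @ \oo --> nrm (ev phi w).
  rewrite -[ev phi w]subr0; under eq_fun do rewrite -[kform _ _ _]subr0.
  apply: cvgC_nrmB; apply: (@cvg_nrm_sqz _ _ _ _ (fun n => n.+1%:R^-1 * knorm k w)).
    by rewrite -(mul0r (knorm k w)); apply: cvgMl; exact: cvg_inv_succ.
  by move=> n; exact: repP.
have h2 : (fun n => kq k (rep phi n) * kq k w) @ \oo --> complex.Re (rdot phi phi) * kq k w.
  by apply: cvgMl; exact: cvg_kq_rep_Re.
have h3 : (fun n => nrm (kform k (rep phi n) w) * nrm (kform k (rep phi n) w)) @ \oo --> nrm (ev phi w) * nrm (ev phi w).
  exact: cvgM.
rewrite expr2; apply: (ler_cvg_to h3 h2); apply: nearW => n /=.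
by rewrite -expr2 kq_CauchySchwarz.
Qed.

Lemma rdot_gt0 phi : phi != 0 -> 0 < rdot phi phi.
Proof.
move=> phi0; rewrite rdotxx ltcR lt0r rdot_Re_ge0 andbT.
apply: contra phi0 => /eqP r0; apply/eqP/rkhsP => x.
rewrite -[LHS]ev1; have := ev_sqr_le phi [:: (1, x)].
rewrite r0 mul0r => h; apply/eqP; rewrite -normr_eq0 nrmE.
rewrite (_ : nrm _ = 0)//; apply/eqP; rewrite -sqrf_eq0; apply/eqP/le_anti.
by rewrite h sqr_ge0.
Qed.

Lemma rdot_bilinear :
  bilinear_for ( *%R : R[i] -> R[i] -> R[i]) (Num.conj \; *%R) rdot.
Proof.
split => psi a f h; first exact: rdot_linearl.
by rewrite rdotC rdot_linearl rmorphD rmorphM/= -!rdotC.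
Qed.

HB.instance Definition _ := @bilinear_isBilinear.Build R[i] rkhs rkhs R[i]
  _ _ rdot rdot_bilinear.

Lemma rdot_herm phi psi : rdot phi psi = (-1) ^+ false * (rdot psi phi)^*.
Proof. by rewrite expr0 mul1r -rdotC. Qed.

HB.instance Definition _ := @isHermitianSesquilinear.Build R[i] rkhs false
  (@Num.conj R[i]) rdot rdot_herm.

HB.instance Definition _ := @isDotProduct.Build R[i] rkhs rdot rdot_gt0.

Definition rknorm phi : C := sqrtC (rdot phi phi).

Lemma rknormD phi psi : rknorm (phi + psi) <= rknorm phi + rknorm psi.
Proof. exact: (dot_triangle rdot). Qed.

Lemma rknormZ (a : C) phi : rknorm (a *: phi) = `|a| * rknorm phi.
Proof.
rewrite /rknorm (dnormZ rdot) sqrtCM ?nnegrE ?exprn_ge0 ?dnorm_ge0//.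
by rewrite sqrCK.
Qed.

Lemma rknorm0_eq0 phi : rknorm phi = 0 -> phi = 0.
Proof. by move=> /eqP; rewrite sqrtC_eq0 (dnorm_eq0 rdot) => /eqP. Qed.

HB.instance Definition _ :=
  Lmodule_isNormed.Build R[i] rkhs rknormD rknormZ rknorm0_eq0.

Lemma rk_norm_sqr phi : rdot phi phi = `|phi| ^+ 2.
Proof. by rewrite sqrtCK. Qed.

Lemma rk_nrm_sqr phi : nrm phi ^+ 2 = complex.Re (rdot phi phi).
Proof. by rewrite rk_norm_sqr nrmE -rmorphXn. Qed.

Lemma ev_le phi w : nrm (ev phi w) <= nrm phi * knorm k w.
Proof.
rewrite -ler_sqr ?nnegrE ?nrm_ge0 ?mulr_ge0 ?nrm_ge0 ?knorm_ge0//.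
by rewrite exprMn knorm_sqr rk_nrm_sqr ev_sqr_le.
Qed.

(** Together with [ev_le] this identifies the norm of [phi] with that of the functional [ev phi];
    elements known only as functions are estimated in this way. *)
Lemma rk_nrm_le phi (M : R) : 0 <= M ->
  (forall w, nrm (ev phi w) <= M * knorm k w) -> nrm phi <= M.
Proof.
move=> M0 Mw; have h := cvg_kq_rep_Re phi; rewrite -rk_nrm_sqr in h.
have h' : (fun n => (M + n.+1%:R^-1) ^+ 2) @ \oo --> M ^+ 2.
  rewrite -[in X in _ --> X](addr0 M); apply: cvgM;
    by apply: cvgD; [exact: cvg_cst|exact: cvg_inv_succ].
rewrite -ler_sqr ?nnegrE ?nrm_ge0//; apply: (ler_cvg_to h h'); apply: nearW => n.
have e0 : 0 <= n.+1%:R^-1 :> R by rewrite invr_ge0.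
rewrite -knorm_sqr ler_sqr ?nnegrE ?knorm_ge0 ?addr_ge0//.
exact: knorm_approx_le (repP phi n) Mw.
Qed.

Lemma rkhs_complete (F : set_system rkhs) : ProperFilter F -> cauchy F -> cvg F.
Proof.
move=> FF /cauchy_ballP Fc.
have small (e : R) : 0 < e ->
    exists2 A, F A & forall x y, A x -> A y -> nrm (x - y) < e.
  move=> e0; have e0' : (0 : R[i]) < e%:C by rewrite ltcR.
  have [[A B] /= [FA FB] AB] := Fc _ e0'.
  exists (A `&` B); first exact: filterI.
  move=> x y [Ax Bx] [Ay By]; have := AB (x, y) (conj Ax By).
  by rewrite -ball_normE/= nrmE ltcR.
have coord (w : comb) : cvg ((fun phi : rkhs => ev phi w) @ F).
  apply/cauchy_cvgP/cauchy_ballP => _ /complex_gt0[e e0 ->].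
  have k0 : 0 < knorm k w + 1 by rewrite ltr_wpDl ?knorm_ge0.
  have [|A FA AA] := small (e / (knorm k w + 1)); first by rewrite divr_gt0.
  exists ((fun x : rkhs => ev x w) @` A, (fun x : rkhs => ev x w) @` A) => /=.
    by split; apply: (@filterS _ F _ A) FA => x Ax; exists x.
  move=> [_ _] [/= [x Ax <-] [y Ay <-]].
  rewrite -ball_normE/= nrmE ltcR -evB (le_lt_trans (ev_le (x - y) _))//.
  rewrite (@le_lt_trans _ _ (nrm (x - y) * (knorm k w + 1)))//.
    by rewrite ler_wpM2l ?nrm_ge0// lerDl.
  by rewrite -ltr_pdivlMr// AA.
pose f x := lim ((fun phi : rkhs => phi x) @ F).
have evf w : (fun phi : rkhs => ev phi w) @ F --> ev f w.
  rewrite /ev; apply: cvg_big => [xy|p _]; first exact: add_continuous.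
  apply: cvgMr; have := coord [:: (1, p.2)].
  by under [X in X @ _]eq_fun do rewrite ev1.
(* The pointwise limit is close to [phi] uniformly on combinations of [knorm] at most 1. This puts
   it into the space and makes the convergence one in norm. *)
have near_f (e : R) : 0 < e ->
    \forall phi \near F, forall w, nrm (ev f w - ev (phi : rkhs) w) <= e * knorm k w.
  move=> e0; have [A FA AA] := small _ e0.
  apply: (@filterS _ F _ A) (FA) => phi Aphi w.
  have h := @cvgC_nrmB _ _ F _ _ _ (ev phi w) (evf w).
  apply: (ler_cvg_to (h _) (cvg_cst (e * knorm k w))).
  apply: (@filterS _ F _ A) FA => psi Apsi.
  by rewrite -evB (le_trans (ev_le (psi - phi) w))// ler_wpM2r ?knorm_ge0// ltW// AA.
have pf : rkhs_pred f.
  apply/asboolP => e e0; have e20 : 0 < e / 2 by rewrite divr_gt0.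
  have [phi fphi] := filter_ex (near_f _ e20).
  have [v av] := rkhs_approx phi e20; exists v => w.
  rewrite (_ : _ - _ = (ev f w - ev phi w) + (ev phi w - kform k v w)); last by ring.
  by rewrite (le_trans (nrmD _ _))// (splitr e) mulrDl lerD.
apply/cvg_ex; exists (RKHS pf); apply/(cvg_nrmP _ id) => e e0.
have e20 : 0 < e / 2 by rewrite divr_gt0.
apply: filterS (near_f _ e20) => phi fphi.
apply: (@le_lt_trans _ _ (e / 2)); last by rewrite ltr_pdivrMr// ltr_pMr// ltr1n.
by apply: rk_nrm_le => [|w]; [exact: ltW|rewrite evB].
Qed.

HB.instance Definition _ := Uniform_isComplete.Build rkhs rkhs_complete.
HB.instance Definition _ := isHilbert.Build R rkhs rk_norm_sqr.

End RKHS.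

Lemma complexRe_conj (R : realType) (z : R[i]) : complex.Re z^* = complex.Re z.
Proof. by case: z. Qed.

(** * Inner product calculus *)

Section HilbertSpace.
Context (R : realType) (H : hilbertType R).
Implicit Types (x y z : H) (a : R[i]).

Lemma hdotC x y : hdot x y = (hdot y x)^*.
Proof. by rewrite (hermC (@hdot R H)) expr0 mul1r. Qed.

Lemma hdotDl x y z : hdot (x + y) z = hdot x z + hdot y z.
Proof. by rewrite linearDl. Qed.

Lemma hdotDr x y z : hdot x (y + z) = hdot x y + hdot x z.
Proof. by rewrite linearDr. Qed.

Lemma hdotBl x y z : hdot (x - y) z = hdot x z - hdot y z.
Proof. by rewrite linearBl. Qed.

Lemma hdotBr x y z : hdot x (y - z) = hdot x y - hdot x z.
Proof. by rewrite linearBr. Qed.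

Lemma hdotZl a x z : hdot (a *: x) z = a * hdot x z.
Proof. by rewrite linearZl_LR. Qed.

Lemma hdotZr a x z : hdot x (a *: z) = a^* * hdot x z.
Proof. by rewrite linearZr_LR. Qed.

Lemma hdotNl x z : hdot (- x) z = - hdot x z.
Proof. by rewrite linearNl. Qed.

Lemma hdotNr x z : hdot z (- x) = - hdot z x.
Proof. by rewrite linearNr. Qed.

Lemma hdot0l z : hdot 0 z = 0. Proof. exact: linear0l. Qed.

Lemma hdot0r z : hdot z 0 = 0. Proof. exact: linear0r. Qed.

Lemma hdot_suml I (r : seq I) P (F : I -> H) z :
  hdot (\sum_(i <- r | P i) F i) z = \sum_(i <- r | P i) hdot (F i) z.
Proof. exact: (big_morph (hdot^~ z) (fun x y => hdotDl x y z) (hdot0l z)). Qed.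

Lemma hdot_sumr I (r : seq I) P (F : I -> H) z :
  hdot z (\sum_(i <- r | P i) F i) = \sum_(i <- r | P i) hdot z (F i).
Proof. exact: (big_morph (hdot z) (hdotDr z) (hdot0r z)). Qed.

Lemma hdot_nrm x : hdot x x = (nrm x ^+ 2)%:C.
Proof. by rewrite hdotxx nrmE rmorphXn. Qed.

Lemma nrm_hdot x : nrm x ^+ 2 = complex.Re (hdot x x).
Proof. by rewrite hdot_nrm. Qed.

Lemma hdot_CauchySchwarz x y : nrm (hdot x y) <= nrm x * nrm y.
Proof.
rewrite -ler_sqr ?nnegrE ?nrm_ge0 ?mulr_ge0 ?nrm_ge0// exprMn.
have := dot_CauchySchwarz (@hdot R H) x y.
by rewrite !hdot_nrm nrmE -rmorphXn/= -rmorphM/= lecR.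
Qed.

Lemma nrm_eq0 x : nrm x = 0 -> x = 0.
Proof. by move=> h; apply/eqP; rewrite -normr_eq0 nrmE h. Qed.

Lemma nrmZ a x : nrm (a *: x) = nrm a * nrm x.
Proof. by apply: complexI; rewrite rmorphM/= -!nrmE normrZ. Qed.

Lemma hdot_inj x y : (forall z, hdot x z = hdot y z) -> x = y.
Proof.
move=> h; apply/eqP; rewrite -subr_eq0; apply/eqP/nrm_eq0/eqP.
by rewrite -sqrf_eq0 nrm_hdot hdotBl h subrr.
Qed.

Lemma cvg_hdotl (u : nat -> H) l z :
  u @ \oo --> l -> (fun n => hdot (u n) z) @ \oo --> hdot l z.
Proof.
move=> ul; apply: (@cvg_nrm_sqz _ _ _ _ (fun n => nrm (l - u n) * nrm z)).
  rewrite -(mul0r (nrm z)); apply: cvgMl; apply/cvgrPdist_lt => e e0.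
  move/cvg_nrmP: ul => /(_ _ e0); apply: filterS => n.
  by rewrite sub0r normrN ger0_norm// nrm_ge0.
by move=> n; rewrite -hdotBl hdot_CauchySchwarz.
Qed.

Lemma cvg_hdotr (u : nat -> H) l z :
  u @ \oo --> l -> (fun n => hdot z (u n)) @ \oo --> hdot z l.
Proof.
move=> ul; rewrite hdotC; under eq_fun do rewrite hdotC.
by apply: cvg_conj; exact: cvg_hdotl.
Qed.

Lemma parallelogram x y :
  nrm (x + y) ^+ 2 + nrm (x - y) ^+ 2 = 2 * nrm x ^+ 2 + 2 * nrm y ^+ 2.
Proof.
rewrite !nrm_hdot !hdotDl !hdotDr !hdotNl !hdotNr opprK !raddfD !raddfN/=; ring.
Qed.

Lemma nrm_sqrB x y : nrm (x - y) ^+ 2 =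
  nrm x ^+ 2 - 2 * complex.Re (hdot x y) + nrm y ^+ 2.
Proof.
rewrite !nrm_hdot hdotBl !hdotBr (hdotC y x) !raddfB/=.
by rewrite complexRe_conj; ring.
Qed.

End HilbertSpace.

(** * Weighted composition operators and their adjoints *)

Section WeightedComposition.
Context (R : realType) (X : Type) (k : psdkernel R X).
Notation C := R[i].
Notation comb := (seq (C * X)).

Definition cmap (b : X -> C) (m : X -> X) (w : comb) : comb :=
  [seq (p.1 * (b p.2)^*, m p.2) | p <- w].

Lemma ev_cmap b m f w : ev (fun x => b x * f (m x)) w = ev f (cmap b m w).
Proof.
by rewrite /ev big_map; apply: eq_bigr => p _; rewrite /= rmorphM/= conjCK mulrA.
Qed.

(* [wt], [wm] define the operator f |-> wt * (f \o wm) on functions, and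
   [wt'], [wm'] define its adjoint. *)
Record wmap := Wmap {
  wt : X -> C; wm : X -> X; wt' : X -> C; wm' : X -> X;
  wadjE : forall x y, wt x * k y (wm x) = (wt' y)^* * k (wm' y) x;
  wcontr : forall w, kq k (cmap wt wm w) <= kq k w;
  wcontr' : forall w, kq k (cmap wt' wm' w) <= kq k w }.

Lemma wadj_subproof (W : wmap) x y :
  wt' W x * k y (wm' W x) = (wt W y)^* * k (wm W y) x.
Proof.
by rewrite (kernC k (wm' W x) y) -[wt' W x]conjCK -rmorphM/= -wadjE rmorphM/= -kernC.
Qed.

Definition wadj (W : wmap) : wmap :=
  Wmap (@wadj_subproof W) (@wcontr' W) (@wcontr W).

Implicit Types W : wmap.

Definition wfun W (f : X -> C) : X -> C := fun x => wt W x * f (wm W x).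

Lemma kfun_wadj W v : wfun W (kfun k v) = kfun k (cmap (wt' W) (wm' W) v).
Proof.
apply/funext => x; rewrite /wfun /kfun mulr_sumr big_map.
by apply: eq_bigr => p _; rewrite /= mulrCA wadjE mulrA.
Qed.

Lemma approx_wfun W f v e : 0 <= e -> approximates k f v e ->
  approximates k (wfun W f) (cmap (wt' W) (wm' W) v) e.
Proof.
move=> e0 av w; rewrite /kform -kfun_wadj !ev_cmap.
by rewrite (le_trans (av _))// ler_wpM2l// ler_wsqrtr// wcontr.
Qed.

Lemma rkhs_wfun W (f : rkhs k) : rkhs_pred k (wfun W f).
Proof.
apply/asboolP => e e0; have [v av] := rkhs_approx f e0.
by exists (cmap (wt' W) (wm' W) v); apply: approx_wfun => //; exact: ltW.
Qed.

Definition wop W (f : rkhs k) : rkhs k := RKHS (rkhs_wfun W f).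

Lemma wopE W f x : wop W f x = wt W x * f (wm W x). Proof. by []. Qed.

Lemma wop_linear W : linear (wop W).
Proof.
move=> a f g; apply: rkhsP => x.
rewrite -[(a *: wop W f + wop W g) x]/(a * wop W f x + wop W g x) !wopE.
by rewrite -[(a *: f + g) _]/(a * f _ + g _); ring.
Qed.

HB.instance Definition _ W :=
  GRing.isLinear.Build R[i] (rkhs k) (rkhs k) _ (wop W) (wop_linear W).

Lemma wop_nrm W f : nrm (wop W f) <= nrm f.
Proof.
apply: rk_nrm_le => [|w]; first exact: nrm_ge0.
by rewrite ev_cmap (le_trans (ev_le _ _))// ler_wpM2l ?nrm_ge0// ler_wsqrtr// wcontr.
Qed.

(** Evaluating [wop W f] on a combination is evaluating [f] on its image under [cmap]. The images of
    approximations of [g] approximate [wop (wadj W) g], so [cvg_ev_approx] gives the limit. *)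
Lemma wop_adj W (f g : rkhs k) : hdot (wop W f) g = hdot f (wop (wadj W) g).
Proof.
rewrite -[LHS]/(rdot _ _) -[RHS]/(rdot _ _).
have h := @cvg_rdot _ _ k (wop W f) g.
apply: (@cvgn_uniq R _ _ _ h).
rewrite (_ : (fun _ => _) = (fun n => ev f (cmap (wt W) (wm W) (rep g n)))); last first.
  by apply/funext => n; rewrite -ev_cmap.
apply: (@cvg_ev_approx _ _ _ _ _ _ (fun n => n.+1%:R^-1)); first exact: cvg_inv_succ.
  by move=> n; rewrite invr_ge0.
by move=> n; apply: (@approx_wfun (wadj W)); rewrite ?invr_ge0//; exact: repP.
Qed.

End WeightedComposition.

Section Evaluation.
Context (R : realType) (X : Type) (k : psdkernel R X).
Notation C := R[i].

Definition iota_rk (x : X) : rkhs k := comb_rkhs k [:: (1, x)].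

Lemma iota_rkE x y : iota_rk x y = k x y.
Proof. by rewrite /iota_rk/= /kfun big_seq1 mul1r. Qed.

Lemma hdot_comb (f : rkhs k) v : hdot f (comb_rkhs k v) = ev f v.
Proof. exact: rdot_comb. Qed.

Lemma hdot_iota (f : rkhs k) x : hdot f (iota_rk x) = f x.
Proof. by rewrite hdot_comb ev1. Qed.

Lemma comb_rkhs_sum v : comb_rkhs k v = \sum_(p <- v) p.1 *: iota_rk p.2.
Proof.
apply: hdot_inj => f; rewrite hdotC hdot_comb.
rewrite hdot_suml /ev rmorph_sum/=.
by apply: eq_bigr => p _; rewrite hdotZl rmorphM/= conjCK hdotC hdot_iota.
Qed.

Lemma rkhs_dense (f : rkhs k) (e : R) : 0 < e -> exists v, nrm (f - comb_rkhs k v) <= e.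
Proof.
move=> e0; have [v av] := rkhs_approx f e0; exists v.
by apply: rk_nrm_le => [|w]; [exact: ltW|rewrite evB].
Qed.

End Evaluation.

Lemma Re_realM (R : realType) (r : R) (z : R[i]) :
  complex.Re (r%:C * z) = r * complex.Re z.
Proof. by case: z => a b /=; ring. Qed.

Lemma nrm_sqrDE (R : realType) (H : hilbertType R) (x y : H) :
  nrm (x + y) ^+ 2 = nrm x ^+ 2 + 2 * complex.Re (hdot x y) + nrm y ^+ 2.
Proof. by rewrite -[y in LHS]opprK nrm_sqrB hdotNr nrmN !raddfN/=; ring. Qed.

(** * Unbounded normal operators *)

Section Graphs.
Context (R : realType) (H : hilbertType R).
Implicit Types (x y z u w a b : H) (S : set (H * H)).

Lemma graphD (N : operator H H) a b u w : graph N (a, b) -> graph N (u, w) -> graph N (a + u, b + w).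
Proof. by move=> h1 h2; have := graph_lin 1 h1 h2; rewrite !scale1r. Qed.

Lemma graphZ (N : operator H H) (c : R[i]) a b : graph N (a, b) -> graph N (c *: a, c *: b).
Proof. by move=> h1; have := graph_lin c h1 (graph0 N); rewrite !addr0. Qed.

Lemma graphB (N : operator H H) a b u w : graph N (a, b) -> graph N (u, w) -> graph N (a - u, b - w).
Proof. by move=> h1 h2; have := graphD h1 (graphZ (-1) h2); rewrite !scaleN1r. Qed.

Lemma adjointB S a b u w : adjoint S (a, b) -> adjoint S (u, w) -> adjoint S (a - u, b - w).
Proof. by move=> h1 h2 q /[dup] /h1/= e1 /h2/= e2; rewrite !hdotBr e1 e2. Qed.

Lemma adjointD S a b u w : adjoint S (a, b) -> adjoint S (u, w) -> adjoint S (a + u, b + w).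
Proof. by move=> h1 h2 q /[dup] /h1/= e1 /h2/= e2; rewrite !hdotDr e1 e2. Qed.

Lemma adjointZ S (c : R[i]) a b : adjoint S (a, b) -> adjoint S (c *: a, c *: b).
Proof. by move=> h q /h/= e; rewrite !hdotZr e. Qed.

Lemma adjoint_cvg S (a b : nat -> H) u w : a @ \oo --> u -> b @ \oo --> w ->
  (forall n, adjoint S (a n, b n)) -> adjoint S (u, w).
Proof.
move=> au bw h q Sq /=; have c1 := @cvg_hdotr _ _ _ _ q.2 au; apply: (@cvgn_uniq R _ _ _ c1).
under eq_fun do rewrite (h _ q Sq)/=.
exact: cvg_hdotr.
Qed.

Lemma closed_graph_cvg S (a b : nat -> H) u w : closed S -> a @ \oo --> u ->
  b @ \oo --> w -> (forall n, S (a n, b n)) -> S (u, w).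
Proof.
move=> cS au bw Sab.
apply: (@closed_cvg _ _ \oo _ (fun n => (a n, b n)) _ cS); first exact: nearW.
exact: cvg_pair.
Qed.

Lemma dense_orth S y : densely_defined S ->
  (forall x, opdom S x -> hdot x y = 0) -> y = 0.
Proof.
move=> dS orth; apply: nrm_eq0; apply/eqP; rewrite eq_le nrm_ge0 andbT.
apply/ler_addgt0Pr => e e0; rewrite add0r.
have e0' : (0 : R[i]) < e%:C by rewrite ltcR.
have : closure (opdom S) y by rewrite dS.
move=> /(_ _ (nbhsx_ballx y _ e0'))[x [Sx]]; rewrite -ball_normE/= nrmE ltcR => xy.
have [->|y0] := eqVneq (nrm y) 0; first exact: ltW.
have y1 : 0 < nrm y by rewrite lt0r y0 nrm_ge0.
rewrite -(ler_pM2r y1) -expr2 nrm_hdot -[X in hdot X _](subrK x) hdotDl (orth x)// addr0.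
rewrite (le_trans (ler_norm _))// (le_trans (Re_le_nrm _))//.
by rewrite (le_trans (hdot_CauchySchwarz _ _))// ler_wpM2r ?nrm_ge0// ltW.
Qed.

Lemma adjoint_fun S x y z : densely_defined S ->
  adjoint S (x, y) -> adjoint S (x, z) -> y = z.
Proof.
move=> dS xy xz; apply/eqP; rewrite -subr_eq0; apply/eqP.
apply: (dense_orth dS) => a [b Sab].
by have := adjointB xy xz Sab => /= <-; rewrite subrr hdot0r.
Qed.

(* The point of the graph of [N] nearest to [(z, 0)] for the norm
   [||u||^2 + e^2 ||w||^2]; it solves [(1 + e^2 N^* N) u = z]. *)
Lemma graph_resolvent (N : operator H H) z (e : R) : closed (graph N) -> 0 < e ->
  exists u w, graph N (u, w) /\ adjoint N (w, ((e ^+ 2)^-1)%:C *: (z - u)).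
Proof.
move=> cN e0.
pose J (p : H * H) := nrm (z - p.1) ^+ 2 + e ^+ 2 * nrm p.2 ^+ 2.
have J0 p : 0 <= J p by rewrite /J addr_ge0 ?sqr_ge0// mulr_ge0 ?sqr_ge0.
pose A := [set J p | p in graph N].
have hinfA : has_inf A.
  split; first by exists (J 0); exists 0 => //; exact: graph0.
  by exists 0 => _ [p _ <-].
pose I := inf A.
have Imin p : graph N p -> I <= J p.
  by move=> Np; apply: ge_inf; [exact: hinfA.2|exists p].
pose d n : R := n.+1%:R^-1.
have d0 n : 0 < d n by rewrite invr_gt0.
(* The excess over the infimum is a square so that the distances obtained from [mid] are linear in
   [d n] and [d m], as [cvgn_cauchy] requires. *)
have : forall n, exists p, graph N p /\ J p < I + d n ^+ 2.
  move=> n; have dn : 0 < d n ^+ 2 by rewrite exprn_gt0.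
  by have [_ [p Np <-] h] := inf_adherent dn hinfA; exists p.
move=> /choice[p hp].
have mid n m : nrm ((p n).1 - (p m).1) ^+ 2 + e ^+ 2 * nrm ((p n).2 - (p m).2) ^+ 2
    <= (2 * d n + 2 * d m) ^+ 2.
  have [Nn Jn] := hp n; have [Nm Jm] := hp m.
  have h1 := parallelogram (z - (p n).1) (z - (p m).1).
  have h2 := parallelogram (p n).2 (p m).2.
  (* The midpoint is in the graph, so [J] is at least [I] there; the parallelogram law then bounds
     the distance of the two points. *)
  have Nmid : graph N (2^-1 *: ((p n).1 + (p m).1), 2^-1 *: ((p n).2 + (p m).2)).
    apply: graphZ; apply: graphD; rewrite -surjective_pairing//.
  have := Imin _ Nmid; rewrite /J/=.
  have e2 : nrm (2^-1 : R[i]) = 2^-1.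
    by rewrite (_ : 2^-1 = (2^-1 : R)%:C) ?nrm_real ?ger0_norm ?invr_ge0// fmorphV rmorph_nat.
  have -> : z - 2^-1 *: ((p n).1 + (p m).1) = 2^-1 *: ((z - (p n).1) + (z - (p m).1)).
    rewrite -[in LHS](scale1r z) -[X in X *: z](@mulVf _ 2) ?pnatr_eq0// -scalerA -scalerBr.
    by rewrite scaler_nat mulr2n opprD addrACA.
  rewrite !nrmZ e2 !exprMn.
  have -> : (p n).1 - (p m).1 = - ((z - (p n).1) - (z - (p m).1)).
    by rewrite opprB opprB [RHS]addrC subrKA.
  rewrite nrmN; move: Jn Jm h1 h2; rewrite /J.
  set q1 := nrm (_ - _ + _) ^+ 2; set q2 := nrm (_ - _ - _) ^+ 2.
  set q3 := nrm ((p n).2 + (p m).2) ^+ 2; set q4 := nrm ((p n).2 - (p m).2) ^+ 2.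
  move=> Jn Jm h1 h2 Im.
  have h2' : e ^+ 2 * q3 + e ^+ 2 * q4 = e ^+ 2 * (2 * nrm (p n).2 ^+ 2 + 2 * nrm (p m).2 ^+ 2).
    by rewrite -mulrDr h2.
  have dd : 0 <= d n * d m by rewrite mulr_ge0 ?ltW.
  have := sqr_ge0 (d n); have := sqr_ge0 (d m); move: Im Jn Jm dd.
  by rewrite sqrrD !exprMn; lra.
have dn0 : (fun n => 2 * d n) @ \oo --> 0.
  by rewrite -(mulr0 2); apply: cvgMr; exact: cvg_inv_succ.
have dnn n m : 0 <= 2 * d n + 2 * d m by rewrite addr_ge0// mulr_ge0// ltW.
have /cvg_ex[u u_lim] : cvgn (fun n => (p n).1).
  apply: (cvgn_cauchy dn0) => n m; rewrite -ler_sqr ?nnegrE ?nrm_ge0//.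
  by apply: le_trans (mid n m); rewrite lerDl mulr_ge0 ?sqr_ge0.
have /cvg_ex[w w_lim] : cvgn (fun n => (p n).2).
  apply: (@cvgn_cauchy _ _ _ (fun n => e^-1 * (2 * d n))).
    by rewrite -(mulr0 e^-1); apply: cvgMr.
  move=> n m; rewrite -mulrDr mulrC ler_pdivlMr// -ler_sqr ?nnegrE ?mulr_ge0 ?nrm_ge0 ?(ltW e0)//.
  by apply: le_trans (mid n m); rewrite exprMn mulrC lerDr sqr_ge0.
have Nuw : graph N (u, w).
  apply: (closed_graph_cvg cN u_lim w_lim) => n.
  by rewrite -surjective_pairing; case: (hp n).
have Juw q : graph N q -> J (u, w) <= J q.
  move=> Nq; apply: le_trans (Imin _ Nq).
  have c1 : (fun n => J (p n)) @ \oo --> J (u, w).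
    rewrite /J/=; apply: cvgD.
      rewrite expr2; under eq_fun do rewrite expr2.
      by apply: cvgM; apply: cvg_nrm; apply: cvgB => //; exact: cvg_cst.
    apply: cvgMr; rewrite expr2; under eq_fun do rewrite expr2.
    by apply: cvgM; apply: cvg_nrm.
  have c2 : (fun n => I + d n ^+ 2) @ \oo --> I.
    rewrite -[X in _ --> X]addr0 -[X in _ --> _ + X](mulr0 0).
    apply: cvgD; first exact: cvg_cst.
    by under eq_fun do rewrite expr2; apply: cvgM; exact: cvg_inv_succ.
  by apply: (ler_cvg_to c1 c2); apply: nearW => n; apply: ltW; case: (hp n).
exists u, w; split => // -[a b] Nab /=.
(* Up to a factor -2, the derivative of [J] at the minimizer in the direction [(a, b)]; that it
   vanishes is the adjoint relation. *)
set v := hdot (z - u) a - (e ^+ 2)%:C * hdot w b.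
suff v0 : v = 0.
  rewrite hdotZr conj_real [RHS]mulrC; apply/esym.
  rewrite (hdotC a) (hdotC b).
  have /eqP := v0; rewrite subr_eq0 => /eqP ->.
  rewrite rmorphM/= conj_real mulrC mulrA -rmorphM/= mulVf ?mul1r//.
  by rewrite expf_neq0// gt_eqF.
pose c := nrm a ^+ 2 + e ^+ 2 * nrm b ^+ 2.
have c0 : 0 <= c by rewrite /c addr_ge0 ?sqr_ge0// mulr_ge0 ?sqr_ge0.
have var (r : R) : 0 <= - 2 * r * nrm v ^+ 2 + r ^+ 2 * nrm v ^+ 2 * c.
  have := Juw _ (graphD Nuw (graphZ (r%:C * v) Nab)); rewrite /J/=.
  rewrite opprD addrA (nrm_sqrB (z - u)) (nrm_sqrDE w) !nrmZ !hdotZr.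
  have -> : e ^+ 2 * (nrm w ^+ 2 + 2 * complex.Re ((r%:C * v)^* * hdot w b) + (nrm (r%:C * v) * nrm b) ^+ 2) =
     e ^+ 2 * nrm w ^+ 2 + 2 * complex.Re ((r%:C * v)^* * ((e ^+ 2)%:C * hdot w b)) + e ^+ 2 * (nrm (r%:C * v) * nrm b) ^+ 2.
    by rewrite [_^* * (_%:C * _)]mulrCA Re_realM; ring.
  set t := (_ * v); rewrite -lerBlDl => h.
  have {h} : 0 <= - 2 * complex.Re (t^* * v) + nrm t ^+ 2 * c.
    rewrite /v mulrBr raddfB/= /c; move: h; rewrite !exprMn; lra.
  rewrite /t rmorphM/= conj_real -mulrA Re_realM [v^* * v]mulrC -normCK nrmE -rmorphXn/=.
  rewrite nrmM nrm_real exprMn real_normK ?num_real//; lra.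
have [//|vn0] := eqVneq v 0.
have v2 : 0 < nrm v ^+ 2.
  rewrite exprn_gt0// lt0r nrm_ge0 andbT; apply: contra vn0 => /eqP h.
  by rewrite -normr_eq0 nrmE h.
(* Adding 1 covers [c = 0]; unless [v] is 0, the expression in [var] is negative at this [r]. *)
have := var (c + 1)^-1.
have c1 : 0 < c + 1 by rewrite ltr_wpDl.
have -> : - 2 * (c + 1)^-1 * nrm v ^+ 2 + (c + 1)^-1 ^+ 2 * nrm v ^+ 2 * c =
   - (nrm v ^+ 2 * (c + 2)) / (c + 1) ^+ 2 by field; rewrite gt_eqF.
rewrite pmulr_lge0 ?invr_gt0 ?exprn_gt0// oppr_ge0 leNgt mulr_gt0//.
by rewrite ltr_wpDl.
Qed.

End Graphs.

(** * Orbits of a normal operator and of its adjoint *)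

Section NormalOperators.
Context (R : realType) (H : hilbertType R) (N : operator H H).
Hypothesis normalN : normal_op N.
Implicit Types (x y z u w : H).

Let denseN : densely_defined N. Proof. by case: normalN. Qed.
Let closedN : closed (graph N). Proof. by case: normalN. Qed.

Lemma normal_comm x z :
  (exists2 y, graph N (x, y) & adjoint N (y, z)) <->
  (exists2 y, adjoint N (x, y) & graph N (y, z)).
Proof.
case: normalN => _ _ /seteqP[h1 h2].
by split=> h; [exact: (h1 (x, z) h)|exact: (h2 (x, z) h)].
Qed.

(** Up to conjugation both squared norms are the inner product of [z] and [x], where [z] is the
    value at [x] of both products of [N] with its adjoint. *)
Lemma normal_nrm x y y' z : graph N (x, y) -> adjoint N (y, z) ->
  adjoint N (x, y') -> graph N (y', z) -> nrm y = nrm y'.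
Proof.
move=> xy yz xy' yz'; apply/eqP; rewrite -(@eqrXn2 _ 2) ?nrm_ge0//; apply/eqP.
have := yz _ xy; have := xy' _ yz'; rewrite /= !nrm_hdot => <- ->.
by rewrite [hdot z x]hdotC complexRe_conj.
Qed.

(* [x] is approximated by [u_n := (1 + N^* N / n^2)^-1 x], which lies in the domain
   of [N^*]; as [||N^* (u_n - u_m)|| = ||N (u_n - u_m)||], the images [N^* u_n]
   converge. *)
Lemma normal_sub_adjoint x x1 x2 : graph N (x, x1) -> graph N (x1, x2) ->
  exists y, adjoint N (x, y).
Proof.
move=> Nx Nx1.
pose e n : R := n.+1%:R^-1.
have e0 n : 0 < e n by rewrite invr_gt0.
have : forall n, exists p : H * H * H, [/\ graph N (p.1.1, p.1.2),
    adjoint N (p.1.2, ((e n ^+ 2)^-1)%:C *: (x - p.1.1)), adjoint N (p.1.1, p.2) &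
    graph N (p.2, ((e n ^+ 2)^-1)%:C *: (x - p.1.1))].
  move=> n; have [u [w [Nuw Nw]]] := graph_resolvent x closedN (e0 n).
  have [|y Ny Nyz] := (normal_comm u (((e n ^+ 2)^-1)%:C *: (x - u))).1; first by exists w.
  by exists (u, w, y).
move=> /choice[p hp].
pose u n := (p n).1.1; pose w n := (p n).1.2; pose y n := (p n).2.
have est n a b c : graph N (a, b) -> graph N (b, c) -> forall u w, graph N (u, w) ->
    adjoint N (w, ((e n ^+ 2)^-1)%:C *: (a - u)) -> nrm (a - u) <= e n * nrm b.
  move=> Nab Nbc u' w' Nu Nw.
  have := Nw _ (graphB Nab Nu); rewrite /= hdotZr conj_real hdot_nrm -rmorphM/=.
  move=> /(congr1 (@complex.Re R))/=; rewrite hdotBl raddfB/= -nrm_hdot => h.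
  rewrite -ler_sqr ?nnegrE ?mulr_ge0 ?nrm_ge0 ?(ltW (e0 n))//.
  have -> : nrm (a - u') ^+ 2 = e n ^+ 2 * (complex.Re (hdot b w') - nrm w' ^+ 2).
    by rewrite h mulrA mulfV ?mul1r// expf_neq0// gt_eqF.
  rewrite exprMn ler_wpM2l ?sqr_ge0//.
  have := le_trans (ler_norm _) (le_trans (Re_le_nrm _) (hdot_CauchySchwarz b w')).
  have := nrm_ge0 b; have := nrm_ge0 w'; have := sqr_ge0 (nrm b - nrm w'); nra.
have ux n : nrm (x - u n) <= e n * nrm x1.
  by have [h1 h2 _ _] := hp n; exact: (est n _ _ _ Nx Nx1 _ _ h1 h2).
have wx n : nrm (x1 - w n) <= e n * nrm x2.
  have [h1 h2 h3 h4] := hp n.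
  (* Applying [N] to the adjoint's value at [w n] gives a multiple of [x1 - w n]. By normality [w n]
     is thus the resolvent applied to [x1], and the estimate made for [u n] repeats with [x2] in
     place of [x1]. *)
  have Nxu := graphZ ((e n ^+ 2)^-1)%:C (graphB Nx h1).
  have [|w2 Nw2 Nw2'] := (normal_comm (w n) (((e n ^+ 2)^-1)%:C *: (x1 - w n))).2.
    by exists (((e n ^+ 2)^-1)%:C *: (x - u n)).
  have := Nw2' _ (graphB Nx1 Nw2); rewrite /= hdotZr conj_real hdot_nrm -rmorphM/=.
  move=> /(congr1 (@complex.Re R))/=; rewrite hdotBl raddfB/= -nrm_hdot => h.
  rewrite -ler_sqr ?nnegrE ?mulr_ge0 ?nrm_ge0 ?(ltW (e0 n))//.
  have -> : nrm (x1 - w n) ^+ 2 = e n ^+ 2 * (complex.Re (hdot x2 w2) - nrm w2 ^+ 2).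
    by rewrite h mulrA mulfV ?mul1r// expf_neq0// gt_eqF.
  rewrite exprMn ler_wpM2l ?sqr_ge0//.
  have := le_trans (ler_norm _) (le_trans (Re_le_nrm _) (hdot_CauchySchwarz x2 w2)).
  have := nrm_ge0 x2; have := nrm_ge0 w2; have := sqr_ge0 (nrm x2 - nrm w2); nra.
have e_0 (c : R) : (fun n => e n * c) @ \oo --> 0.
  by rewrite -(mul0r c); apply: cvgMl; exact: cvg_inv_succ.
have /cvg_ex[l yl] : cvgn y.
  apply: (cvgn_cauchy (e_0 (nrm x2))) => n m.
  have [n1 n2 n3 n4] := hp n; have [m1 m2 m3 m4] := hp m.
  rewrite -(normal_nrm (graphB n1 m1) (adjointB n2 m2) (adjointB n3 m3) (graphB n4 m4)).
  rewrite -/(w n) -/(w m) (_ : w n - w m = (x1 - w m) - (x1 - w n)); last first.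
    by rewrite opprB [RHS]addrC subrKA.
  by rewrite (le_trans (nrmD _ _))// nrmN addrC lerD.
have ul : u @ \oo --> x by apply: (cvg_nrm_sqz (e_0 (nrm x1))).
exists l; apply: (adjoint_cvg ul yl) => n.
by have [] := hp n.
Qed.

Definition chain (x : nat -> H) : Prop := forall n, graph N (x n, x n.+1).

(** [y n.+1] is the adjoint's value at [N (x n)]. By normality it is also [N] applied to the
    adjoint's value at [x n], and this value is [y n] because the adjoint of a densely defined
    operator is single valued. *)
Lemma chain_adjoint (x : nat -> H) : chain x -> exists y : nat -> H, chain y /\ forall n, adjoint N (x n, y n).
Proof.
move=> cx.
have /choice[y hy] : forall n, exists y, adjoint N (x n, y).
  by move=> n; exact: normal_sub_adjoint (cx n) (cx n.+1).
exists y; split => // n.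
have [|z xz zy] := (normal_comm (x n) (y n.+1)).1; first by exists (x n.+1).
by rewrite (adjoint_fun denseN (hy n) xz).
Qed.

(* The vectors [X a n] form a grid on which [N] increases [n] and its adjoint increases
   [a]; [z i := X i i] plays the part of [N^*^i N^i x 0]. *)
Lemma normal_hankel (x : nat -> H) : chain x -> exists z : nat -> H,
  forall i j, hdot (z i) (z j) = (nrm (x (i + j)%N) ^+ 2)%:C.
Proof.
move=> cx.
have next (c : {x | chain x}) : exists d : {x | chain x},
    forall n, adjoint N (sval c n, sval d n).
  by case: c => c hc; have [d [cd hd]] := chain_adjoint hc; exists (exist _ d cd).
have /choice[f hf] := next.
pose X a := sval (iter a f (exist _ x cx)).
have NX a n : graph N (X a n, X a n.+1) by rewrite /X; case: (iter _ _ _).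
have AX a n : adjoint N (X a n, X a.+1 n) by rewrite /X/=; exact: hf.
have swap b m a i n : hdot (X b m) (X (a + i)%N n) = hdot (X b (m + i)%N) (X a n).
  elim: i m => [|i IH] m; first by rewrite !addn0.
  by rewrite !addnS; have := AX (a + i)%N n _ (NX b m) => /= <-; rewrite IH addSn.
exists (fun i => X i i) => i j.
(* Moving the [j] adjoints off the second vector, and then the [i] adjoints off the first, leaves
   [X 0 (i + j)] on both sides. *)
have := swap i i 0%N j j; rewrite add0n => ->; rewrite hdotC.
have := swap 0%N j 0%N i (i + j)%N; rewrite add0n => ->.
by rewrite [(j + i)%N]addnC hdot_nrm conj_real.
Qed.

End NormalOperators.

(** * Positive definite kernels and sequences *)

Section RealKernels.
Context (R : realType) (X : Type).
Implicit Types (K : X -> X -> R) (v : seq (R * X)) (x y : X).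

Definition qform K v : R := \sum_(p <- v) \sum_(q <- v) p.1 * q.1 * K p.2 q.2.

(** Symmetry is included because a real quadratic form does not see the antisymmetric part of its
    kernel; with it, [psd_kernel_ge0] extends positivity to complex coefficients. *)
Definition psd K : Prop := (forall x y, K x y = K y x) /\ forall v, 0 <= qform K v.

Lemma qform_cons K t x v : (forall x y, K x y = K y x) ->
  qform K ((t, x) :: v) = t ^+ 2 * K x x + 2 * t * (\sum_(p <- v) p.1 * K p.2 x) + qform K v.
Proof.
move=> sK; rewrite /qform big_cons/= big_cons/=.
under [X in _ + X = _]eq_bigr do rewrite big_cons/=.
rewrite big_split/= (_ : \sum_(q <- v) t * q.1 * K x q.2 = t * \sum_(p <- v) p.1 * K p.2 x); last first.
  by rewrite mulr_sumr; apply: eq_bigr => p _; rewrite (sK x) mulrA.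
rewrite (_ : \sum_(p <- v) p.1 * t * K p.2 x = t * \sum_(p <- v) p.1 * K p.2 x); last first.
  by rewrite mulr_sumr; apply: eq_bigr => p _; ring.
ring.
Qed.

Lemma psd_ge0 K x : psd K -> 0 <= K x x.
Proof. by move=> [_ /(_ [:: (1, x)])]; rewrite /qform !big_seq1 !mul1r. Qed.

Lemma psd_row0 K x y : psd K -> K x x = 0 -> K x y = 0.
Proof.
move=> [sK pK] Kx0; apply/eqP; apply: contraT => K0.
(* The first coefficient is chosen so that the form takes the value -1. *)
have := pK [:: (- (K y y + 1) / (2 * K x y), x); (1, y)].
rewrite qform_cons// Kx0 mulr0 add0r big_seq1 mul1r /qform !big_seq1 !mul1r (sK y x)/=.
have -> : 2 * (- (K y y + 1) / (2 * K x y)) * K x y = - (K y y + 1) by field.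
lra.
Qed.

(** If [K x0 x0 = 0], the quotient is 0 by convention and the complement is [K] itself; this is the
    right value, since the row of [x0] then vanishes by [psd_row0]. *)
Definition schur_compl K x0 x y : R := K x y - K x x0 * K x0 y / K x0 x0.

Lemma schur_compl_psd K x0 : psd K -> psd (schur_compl K x0).
Proof.
move=> pK; have [sK qK] := pK; split=> [x y|v].
  by rewrite /schur_compl (sK x y) (sK x x0) (sK x0 y) [K x0 x * _]mulrC.
set e := \sum_(p <- v) p.1 * K p.2 x0.
have -> : qform (schur_compl K x0) v = qform K v - e ^+ 2 / K x0 x0.
  rewrite /qform expr2 {1}/e mulr_suml mulr_suml -sumrB; apply: eq_bigr => p _.
  rewrite /e mulr_sumr mulr_suml -sumrB; apply: eq_bigr => q _.
  by rewrite /schur_compl (sK x0 q.2); ring.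
have [->|K0] := eqVneq (K x0 x0) 0; first by rewrite invr0 mulr0 subr0.
(* The coefficient at [x0] minimizes the form of [v] extended by [x0]; the minimum is the form of
   the Schur complement. *)
have := qK ((- e / K x0 x0, x0) :: v); rewrite qform_cons// -/e.
by congr (0 <= _); field.
Qed.

Lemma schur_compl0 K x0 y : psd K -> schur_compl K x0 x0 y = 0.
Proof.
move=> pK; rewrite /schur_compl.
have [K0|K0] := eqVneq (K x0 x0) 0; last by rewrite mulrAC mulfV// mul1r subrr.
by rewrite (psd_row0 y pK K0) !mulr0 mul0r subr0.
Qed.

Lemma schur_compl_row0 K x0 x y : psd K -> (forall y, K x y = 0) ->
  schur_compl K x0 x y = 0.
Proof. by move=> pK Kx0; rewrite /schur_compl !Kx0 !mul0r subr0. Qed.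

Lemma psd_scale K (u : X -> R) : psd K -> psd (fun x y => u x * u y * K x y).
Proof.
move=> [sK qK]; split=> [x y|v]; first by rewrite (sK x y) (mulrC (u x)).
have := qK [seq (p.1 * u p.2, p.2) | p <- v]; rewrite /qform big_map.
congr (0 <= _); apply: eq_bigr => p _; rewrite big_map; apply: eq_bigr => q _ /=; ring.
Qed.

Lemma psdD K L : psd K -> psd L -> psd (fun x y => K x y + L x y).
Proof.
move=> [sK qK] [sL qL]; split=> [x y|v]; first by rewrite sK sL.
have := addr_ge0 (qK v) (qL v); rewrite /qform -big_split/=.
congr (0 <= _); apply: eq_bigr => p _; rewrite -big_split/=; apply: eq_bigr => q _; ring.
Qed.

Lemma psdZ K a : 0 <= a -> psd K -> psd (fun x y => a * K x y).
Proof.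
move=> a0 [sK qK]; split=> [x y|v]; first by rewrite sK.
have := mulr_ge0 a0 (qK v); rewrite /qform mulr_sumr.
congr (0 <= _); apply: eq_bigr => p _; rewrite mulr_sumr; apply: eq_bigr => q _; ring.
Qed.

Lemma psd1 : psd (fun _ _ => 1).
Proof.
split=> // v; have := sqr_ge0 (\sum_(p <- v) p.1); rewrite expr2 mulr_suml.
congr (0 <= _); apply: eq_bigr => p _; rewrite mulr_sumr; apply: eq_bigr => q _; ring.
Qed.

Lemma cvg_qform (K : nat -> X -> X -> R) L v :
  (forall x y, (fun n => K n x y) @ \oo --> L x y) ->
  (fun n => qform (K n) v) @ \oo --> qform L v.
Proof.
move=> KL; rewrite /qform; apply: cvg_big => [xy|p _]; first exact: add_continuous.
apply: cvg_big => [xy|q _]; first exact: add_continuous.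
by apply: cvgMr.
Qed.

Lemma psd_cvg (K : nat -> X -> X -> R) (L : X -> X -> R) : (forall n, psd (K n)) ->
  (forall x y, (fun n => K n x y) @ \oo --> L x y) -> psd L.
Proof.
move=> pK KL; split=> [x y|v].
  have h := KL x y; rewrite (_ : (fun n => K n x y) = (fun n => K n y x)) in h.
    by rewrite -(cvg_lim (@Rhausdorff R) h) (cvg_lim (@Rhausdorff R) (KL y x)).
  by apply/funext => n; have [-> _] := pK n.
have h := @cvg_qform K L v KL; apply: (ler_cvg_to (cvg_cst (0 : R)) h).
by apply: nearW => n; have [_] := pK n.
Qed.

(** Real and imaginary parts of the coefficients contribute one real form each. The imaginary part
    of the sum changes sign when the two summation variables are exchanged, so it is 0. *)
Lemma psd_kernel_ge0 K (v : seq (R[i] * X)) : psd K ->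
  0 <= kform (fun x y => (K x y)%:C) v v.
Proof.
move=> [sK qK].
have -> : kform (fun x y => (K x y)%:C) v v =
   (qform K [seq (complex.Re p.1, p.2) | p <- v] +
    qform K [seq (complex.Im p.1, p.2) | p <- v])%:C.
  rewrite kformE /qform !big_map -big_split/=.
  under [X in _ = X%:C]eq_bigr do rewrite !big_map -big_split/=.
  apply: complex_eqE.
    rewrite raddf_sum; apply: eq_bigr => p _; rewrite raddf_sum; apply: eq_bigr => q _.
    by case: p.1 q.1 => [a b] [c d] /=; ring.
  rewrite [RHS]/= raddf_sum; under eq_bigr do rewrite raddf_sum.
  set S := LHS; suff : S = - S by move=> h; lra.
  rewrite /S [in RHS]exchange_big/= -sumrN; apply: eq_bigr => p _.
  rewrite -sumrN; apply: eq_bigr => q _; rewrite (sK q.2 p.2).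
  by case: p.1 q.1 => [a b] [c d] /=; ring.
by rewrite ler0c addr_ge0.
Qed.

Lemma psd_kernelC K x y : psd K -> ((K y x)%:C : R[i]) = ((K x y)%:C)^*.
Proof. by move=> [sK _]; rewrite conj_real sK. Qed.

Definition kernel_of K (pK : psd K) : psdkernel R X :=
  @PsdKernel R X (fun x y => (K x y)%:C) (fun x y => psd_kernelC x y pK)
    (fun w => @psd_kernel_ge0 K w pK).

End RealKernels.

(** * Products and exponentials of positive semidefinite kernels *)

Section Schur.
Context (R : realType).
Implicit Types (K L : nat -> nat -> R).

(* Symmetric Gaussian elimination of the first [n] points. *)
Lemma psd_decomp K n : psd K -> exists (us : seq (nat -> R)) L,
  [/\ psd L, forall x y, (x < n)%N -> L x y = 0 &
      forall x y, K x y = \sum_(u <- us) u x * u y + L x y].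
Proof.
move=> pK; elim: n => [|n [us [L [pL L0 KL]]]].
  by exists [::], K; split => // x y; rewrite big_nil add0r.
exists ((fun x => L x n / Num.sqrt (L n n)) :: us), (schur_compl L n); split.
- exact: schur_compl_psd.
- move=> x y; rewrite ltnS leq_eqVlt => /predU1P[->|xn]; first exact: schur_compl0.
  by apply: schur_compl_row0 => // z; exact: L0.
move=> x y; rewrite KL big_cons /schur_compl.
have [sL _] := pL; rewrite (sL n y); have hl := sqr_sqrtr (psd_ge0 n pL).
set r := Num.sqrt (L n n) in hl *; rewrite -hl.
have [->|s0] := eqVneq r 0; first by rewrite expr0n/= invr0 !mulr0 add0r subr0.
by field.
Qed.

(** Schur's product theorem. On the finitely many points of [v], [K] is a sum of kernels
    [u x * u y], and the product of such a kernel with [L] is [L] rescaled. *)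
Lemma psd_mul K L : psd K -> psd L -> psd (fun x y => K x y * L x y).
Proof.
move=> pK pL; have [sK qK] := pK; have [sL qL] := pL.
split=> [x y|v]; first by rewrite sK sL.
pose n := (\max_(p <- v) p.2).+1.
have [us [K' [pK' K'0 KE]]] := psd_decomp n pK.
have -> : qform (fun x y => K x y * L x y) v =
    \sum_(u <- us) qform (fun x y => u x * u y * L x y) v.
  rewrite /qform [RHS]exchange_big/=; apply: eq_big_seq => p pv.
  rewrite [RHS]exchange_big/=; apply: eq_bigr => q _.
  rewrite KE K'0 ?addr0 ?mulr_suml ?mulr_sumr; last first.
    by rewrite ltnS (big_rem p)//= leq_max leqnn.
  by apply: eq_bigr => u _; ring.
by apply: sumr_ge0 => u _; have [_] := psd_scale u pL.
Qed.

(** The partial sums of the exponential series are positive semidefinite by [psd_mul], and this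
    passes to pointwise limits. *)
Lemma psd_expR K : psd K -> psd (fun x y => expR (K x y)).
Proof.
move=> pK; apply: (@psd_cvg R nat (fun n x y => \sum_(i < n.+1) K x y ^+ i / i`!%:R)).
  move=> n.
  have pX i : psd (fun x y => K x y ^+ i).
    elim: i => [|i IH]; first by under eq_fun2 do rewrite expr0; exact: psd1.
    by under eq_fun2 do rewrite exprS; exact: psd_mul.
  elim: n => [|n IH].
    by under eq_fun2 do rewrite big_ord1 mulrC; apply: psdZ => //; rewrite invr_ge0.
  under eq_fun2 do rewrite big_ord_recr/=; apply: psdD => //.
  by under eq_fun2 do rewrite mulrC; apply: psdZ => //; rewrite invr_ge0.
move=> x y; have h : series (exp_coeff (K x y)) @ \oo --> expR (K x y).
  exact: is_cvg_series_exp_coeff.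
have := cvg_comp _ _ (cvg_addnr 1%N) h; apply: cvg_trans; apply: near_eq_cvg.
by apply: nearW => n; rewrite /= /series/= addn1 big_mkord.
Qed.

End Schur.

(** * Hankel matrices: Schoenberg's theorem and Hausdorff's differences *)

Section Hankel.
Context (R : realType).
Implicit Types (c g : nat -> R) (v : seq (R * nat)).

Definition hankel c (i j : nat) : R := c (i + j)%N.

Lemma hankelC c i j : hankel c i j = hankel c j i.
Proof. by rewrite /hankel addnC. Qed.

Definition cpd c : Prop := forall v, \sum_(p <- v) p.1 = 0 -> 0 <= qform (hankel c) v.

Lemma sum_bucket v (f : nat -> R) n : (forall p, p \in v -> (p.2 < n)%N) ->
  \sum_(p <- v) p.1 * f p.2 = \sum_(i < n) (\sum_(p <- v | p.2 == i) p.1) * f i.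
Proof.
move=> vn; under [RHS]eq_bigr do rewrite mulr_suml.
rewrite (exchange_big_dep predT)//=; apply: eq_big_seq => p /vn pn.
rewrite (big_pred1 (Ordinal pn)) => [|i]; last by rewrite /= eq_sym.
by [].
Qed.

Lemma sum_bucketP v n (f : nat -> R) : (forall p, p \in v -> (p.2 < n)%N) ->
  qform (hankel f) v = \sum_(i < n) \sum_(j < n) f (i + j)%N *
    (\sum_(p <- v | p.2 == i) p.1) * (\sum_(p <- v | p.2 == j) p.1).
Proof.
move=> vn; rewrite /qform.
rewrite (_ : \sum_(p <- v) _ = \sum_(p <- v) p.1 * (\sum_(q <- v) q.1 * f (p.2 + q.2)%N)); last first.
  by apply: eq_bigr => p _; rewrite mulr_sumr; apply: eq_bigr => q _; rewrite mulrA.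
rewrite (sum_bucket (fun i => \sum_(q <- v) q.1 * f (i + q.2)%N) vn).
apply: eq_bigr => i _; rewrite (sum_bucket (fun j => f (i + j)%N) vn) mulr_sumr.
by apply: eq_bigr => j _; ring.
Qed.

(** From lists to sequences, the coefficients at a repeated index are added up. In the other
    direction the real and imaginary parts of [lam] both sum to 0, and the mixed terms cancel by
    symmetry of the Hankel matrix. *)
Lemma cpd_seqP c : cpd_seq c <-> cpd c.
Proof.
split=> [cc v v0|cc k lam lam0].
  pose k := \max_(p <- v) p.2.
  have vk p : p \in v -> (p.2 < k.+1)%N.
    by move=> pv; rewrite ltnS /k (big_rem p)//= leq_max leqnn.
  pose a i := \sum_(p <- v | p.2 == i) p.1.
  rewrite (sum_bucketP c vk) -ler0c.
  have := cc k (fun i => (a i)%:C) _.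
  rewrite (_ : \sum_(i < k.+1) \sum_(j < k.+1) _ =
      (\sum_(i < k.+1) \sum_(j < k.+1) c (i + j)%N * a i * a j)%:C); last first.
    rewrite [RHS]rmorph_sum; apply: eq_bigr => i _; rewrite [RHS]rmorph_sum; apply: eq_bigr => j _.
    by rewrite conj_real !rmorphM.
  apply; rewrite -rmorph_sum -[in RHS](rmorph0 (real_complex R)); congr (_%:C).
  rewrite -[RHS]v0; have := sum_bucket (fun=> 1) vk.
  under [X in X = _]eq_bigr do rewrite mulr1.
  by under [X in _ = X]eq_bigr do rewrite mulr1.
pose v f := [seq (f (lam i), i) | i <- iota 0 k.+1] : seq (R * nat).
have qv f : qform (hankel c) (v f) = \sum_(i < k.+1) \sum_(j < k.+1) f (lam i) * f (lam j) * c (i + j)%N.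
  rewrite /qform big_map -[iota _ _]/(index_iota 0 k.+1) big_mkord; apply: eq_bigr => i _.
  by rewrite big_map -[iota _ _]/(index_iota 0 k.+1) big_mkord.
have v0 (f : {additive R[i] -> R}) : \sum_(p <- v f) p.1 = 0.
  rewrite big_map -[iota _ _]/(index_iota 0 k.+1) big_mkord/=.
  by rewrite -raddf_sum lam0 raddf0.
suff -> : \sum_(i < k.+1) \sum_(j < k.+1) (c (i + j)%N)%:C * lam i * (lam j)^* =
    (qform (hankel c) (v (@complex.Re R)) + qform (hankel c) (v (@complex.Im R)))%:C.
  by rewrite ler0c addr_ge0//; apply: cc; exact: v0.
rewrite !qv -big_split/=; under [in RHS]eq_bigr do rewrite -big_split/=.
apply: complex_eqE.
  rewrite raddf_sum; apply: eq_bigr => i _; rewrite raddf_sum; apply: eq_bigr => j _.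
  by case: (lam i) (lam j) => [a b] [x y] /=; ring.
rewrite [RHS]/= raddf_sum; under eq_bigr do rewrite raddf_sum.
set S := LHS; suff : S = - S by move=> h; lra.
rewrite /S [in RHS]exchange_big/= -sumrN; apply: eq_bigr => i _.
rewrite -sumrN; apply: eq_bigr => j _; rewrite [(j + i)%N]addnC.
by case: (lam i) (lam j) => [a b] [x y] /=; ring.
Qed.

Lemma psd_cpd c : psd (hankel c) -> cpd c.
Proof. by move=> [_ h] v _. Qed.

(* Schoenberg: [K] is psd, and [exp (c (i + j))] is [exp (K i j)] up to a rescaling of
   the rows and columns. *)
Lemma psd_hankel_expR c : cpd c -> psd (hankel (fun n => expR (c n))).
Proof.
move=> cc.
pose K i j := hankel c i j - c i - c j + c 0%N.
have pK : psd K.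
  split=> [i j|v]; first by rewrite /K hankelC; ring.
  (* The mass placed at index 0 makes the coefficients sum to 0 and contributes exactly the terms by
     which [K] differs from [hankel c]. *)
  have := cc ((- \sum_(p <- v) p.1, 0%N) :: v).
  rewrite big_cons/= addNr => /(_ erefl); rewrite qform_cons; last exact: hankelC.
  congr (0 <= _); set s := \sum_(p <- v) p.1.
  have -> : qform K v = qform (hankel c) v - 2 * s * (\sum_(p <- v) p.1 * c p.2) + s ^+ 2 * c 0%N.
    rewrite [2 * s]mulr_natl mulr2n mulrDl opprD addrA -[X in _ - X - _]mulrC.
    rewrite /s expr2 !mulr_suml /qform -!sumrB -big_split/=; apply: eq_bigr => p _.
    rewrite !mulr_sumr mulr_suml -!sumrB -big_split/=; apply: eq_bigr => q _.
    by rewrite /K; ring.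
  by rewrite /hankel/=; under eq_bigr do rewrite addn0; ring.
(* The exponents add up because [K i j + (c i - c 0 / 2) + (c j - c 0 / 2) = c (i + j)]. *)
have := psd_scale (fun i => expR (c i - c 0%N / 2)) (psd_expR pK).
congr psd; apply/funext => i; apply/funext => j; rewrite -!expRD /K /hankel.
congr expR; lra.
Qed.

(** This follows from [1 - x <= expR (- x)]. With [expR_ge1Dx] it squeezes the difference quotients
    of the exponential at 0 in [cpd_of_expR]. *)
Lemma expR_sub1_le (x : R) : x < 1 -> expR x - 1 <= x / (1 - x).
Proof.
move=> x1; have h : 0 < 1 - x by rewrite subr_gt0.
rewrite ler_pdivlMr// mulrBl mul1r.
have := expR_ge1Dx (- x); rewrite expRN => h1.
have : expR x * (1 - x) <= 1.
  by rewrite -ler_pdivlMl ?expR_gt0// mulr1.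
lra.
Qed.

(* [g] is the derivative at [t = 0] of [exp (t g)], and constants vanish on the test
   vectors. *)
Lemma cpd_of_expR g : (forall t, 0 < t -> cpd (fun n => expR (t * g n))) -> cpd g.
Proof.
move=> eg v v0.
pose t m : R := m.+1%:R^-1.
have t0 m : 0 < t m by rewrite invr_gt0.
have lim x : (fun m => (expR (t m * x) - 1) / t m) @ \oo --> x.
  have tx : (fun m => t m * x) @ \oo --> 0.
    by rewrite -(mul0r x); apply: cvgMl; exact: cvg_inv_succ.
  apply: (@squeeze_cvgr _ _ _ _ (cst x) (fun m => x / (1 - t m * x))).
  - near=> m.
    have tx1 : t m * x < 1 by near: m; exact: (cvgr_lt _ tx).
    have tm := t0 m; apply/andP; split.
      by rewrite /= ler_pdivlMr// mulrC; have := expR_ge1Dx (t m * x); lra.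
    rewrite ler_pdivrMr// mulrAC; have := expR_sub1_le tx1; by rewrite [x * _]mulrC.
  - exact: cvg_cst.
  rewrite -[x in X in _ --> X]divr1 -[X in x / X](subr0 1); apply: cvgMr.
  apply: cvgV; first by rewrite subr0 oner_neq0.
  by apply: cvgB => //; exact: cvg_cst.
have h := @cvg_qform R nat (fun m => hankel (fun n => (expR (t m * g n) - 1) / t m)) (hankel g) v
  (fun i j => lim (g (i + j)%N)).
apply: (ler_cvg_to (cvg_cst (0 : R)) h); apply: nearW => m.
have := eg _ (t0 m) v v0.
have -> : qform (hankel (fun n => (expR (t m * g n) - 1) / t m)) v =
    qform (hankel (fun n => expR (t m * g n))) v / t m.
  have z : \sum_(p <- v) \sum_(q <- v) p.1 * q.1 = 0.
    by under eq_bigr do rewrite -mulr_sumr v0 mulr0; rewrite big1.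
  rewrite -[in RHS](subr0 (qform _ _)) -[X in _ - X]z /qform -sumrB mulr_suml.
  apply: eq_bigr => p _; rewrite -sumrB mulr_suml; apply: eq_bigr => q _.
  by rewrite /hankel; ring.
by move=> h0; rewrite divr_ge0// ltW.
Unshelve. all: by end_near. Qed.

Lemma cvg_subseq (g : nat -> R) (l : R) (f : nat -> nat) : g @ \oo --> l ->
  (forall m, (m <= f m)%N) -> (fun m => g (f m)) @ \oo --> l.
Proof.
move=> gl fm; apply/cvgrPdist_lt => e e0.
move/cvgrPdist_lt: gl => /(_ _ e0)[N _ hN].
by exists N => // m /= Nm; apply: hN => /=; exact: leq_trans (fm m).
Qed.

(* Test the form on [v] corrected by the mass [- s] at a point [m] tending to
   infinity. *)
Lemma psd_of_cpd_cvg g (l : R) : cpd g -> g @ \oo --> l -> 0 <= l -> psd (hankel g).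
Proof.
move=> cg gl l0; split=> [i j|v]; first exact: hankelC.
set s := \sum_(p <- v) p.1.
have h m : 0 <= s ^+ 2 * g (m + m)%N + 2 * - s * (\sum_(p <- v) p.1 * g (p.2 + m)%N)
    + qform (hankel g) v.
  have := cg ((- s, m) :: v); rewrite big_cons/= addNr => /(_ erefl).
  by rewrite qform_cons ?sqrrN//; exact: hankelC.
have c1 : (fun m => s ^+ 2 * g (m + m)%N + 2 * - s * (\sum_(p <- v) p.1 * g (p.2 + m)%N)
    + qform (hankel g) v) @ \oo --> s ^+ 2 * l + 2 * - s * (\sum_(p <- v) p.1 * l) +
    qform (hankel g) v.
  apply: cvgD; last exact: cvg_cst.
  apply: cvgD; apply: cvgMr.
    by apply: (@cvg_subseq g l) => // m; rewrite leq_addr.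
  apply: cvg_big => [xy|p _]; first exact: add_continuous.
  by apply: cvgMr; apply: (@cvg_subseq g l) => // m; rewrite leq_addl.
have : 0 <= s ^+ 2 * l + 2 * - s * (\sum_(p <- v) p.1 * l) + qform (hankel g) v.
  by apply: (ler_cvg_to (cvg_cst (0 : R)) c1); apply: nearW.
rewrite -mulr_suml -/s => h1.
have : 0 <= s ^+ 2 * l by rewrite mulr_ge0 ?sqr_ge0.
by move: h1; rewrite expr2; lra.
Qed.

(** The increments of a convex sequence do not decrease, so a positive first one would force linear
    growth. This is how positivity together with mere boundedness yields contractivity. *)
Lemma convex_bounded_nonincr (u : nat -> R) (M : R) :
  (forall n, 2 * u n.+1 <= u n + u n.+2) -> (forall n, u n <= M) -> u 1%N <= u 0%N.
Proof.
move=> cu uM; rewrite leNgt; apply/negP => u01.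
pose d := u 1%N - u 0%N; have d0 : 0 < d by rewrite subr_gt0.
have dn n : d <= u n.+1 - u n.
  by elim: n => [|n IH] //; have := cu n; lra.
have un n : u 0%N + n%:R * d <= u n.
  elim: n => [|n IH]; first by rewrite mul0r addr0.
  by have := dn n; rewrite -natr1 mulrDl mul1r; lra.
have [n hn] : exists n : nat, (M - u 0%N) / d < n%:R.
  exists (Num.bound ((M - u 0%N) / d)); apply: archi_boundP.
  by apply: divr_ge0; [rewrite subr_ge0 uM|exact: ltW].
move: hn; rewrite ltr_pdivrMr// => hn.
by have := un n; have := uM n; lra.
Qed.

Definition diff_seq g n : R := g n - g n.+1.

(* [g] is the moment sequence of a measure on [0, 1], and [diff_seq] multiplies that
   measure by [1 - t]. *)
Lemma hausdorff_diff g (M : R) : psd (hankel g) -> psd (hankel (fun n => g n.+1)) ->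
  (forall n, `|g n| <= M) ->
  [/\ psd (hankel (diff_seq g)), psd (hankel (fun n => diff_seq g n.+1)) &
      forall n, `|diff_seq g n| <= 2 * M].
Proof.
move=> [_ p0] [_ p1] gM.
(* Moving all points by one raises the Hankel index by two, so the two given forms yield those of
   all shifts of [g]. *)
have shift2 n (v : seq (R * nat)) : 0 <= qform (hankel (fun m => g (m + n)%N)) v.
  suff [h1 h2] : (forall v, 0 <= qform (hankel (fun m => g (m + n)%N)) v) /\
     (forall v, 0 <= qform (hankel (fun m => g (m + n).+1)) v) by exact: h1.
  elim: n => [|n [IH1 IH2]].
    split=> w; first by under [hankel _]eq_fun2 do rewrite /hankel addn0; exact: p0.
    by under [hankel _]eq_fun2 do rewrite /hankel addn0; exact: p1.
  split=> w.
    by under [hankel _]eq_fun2 do rewrite /hankel addnS; exact: IH2.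
  have := IH1 [seq (p.1, p.2.+1) | p <- w]; rewrite /qform big_map.
  congr (0 <= _); apply: eq_bigr => p _; rewrite big_map; apply: eq_bigr => q _ /=.
  by rewrite /hankel; congr (_ * g _); lia.
pose u v n := qform (hankel (fun m => g (m + n)%N)) v.
(* This is the form at [v] minus its translate by one; for a moment sequence it integrates
   [(1 - t)^2 t^n] against the square of the polynomial of [v]. *)
have ucx v n : 2 * u v n.+1 <= u v n + u v n.+2.
  have := shift2 n ([seq (p.1, p.2) | p <- v] ++ [seq (- p.1, p.2.+1) | p <- v]).
  rewrite /u /qform big_cat/= !big_map/=.
  under eq_bigr do rewrite big_cat/= !big_map/=.
  under [X in _ + X]eq_bigr do rewrite big_cat/= !big_map/=.
  rewrite -!big_split/= => h; rewrite -subr_ge0; move: h; congr (0 <= _).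
  rewrite mulr_sumr -sumrB; apply: eq_bigr => p _.
  rewrite mulr_sumr -!big_split/= -sumrB; apply: eq_bigr => q _.
  rewrite /hankel (_ : p.2.+1 + q.2 + n = p.2 + q.2 + n.+1)%N; last by lia.
  rewrite (_ : p.2 + q.2.+1 + n = p.2 + q.2 + n.+1)%N; last by lia.
  rewrite (_ : p.2.+1 + q.2.+1 + n = p.2 + q.2 + n.+2)%N; last by lia.
  ring.
have ub v : exists B, forall n, u v n <= B.
  exists (\sum_(p <- v) \sum_(q <- v) `|p.1 * q.1| * M) => n.
  apply: ler_sum => p _; apply: ler_sum => q _.
  by rewrite (le_trans (ler_norm _))// [leLHS]normrM ler_wpM2l// /hankel gM.
have u01 v n : u v n.+1 <= u v n.
  have [B uB] := ub v.
  have := @convex_bounded_nonincr (fun m => u v (n + m)%N) B.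
  rewrite addn0 addn1; apply=> m; last exact: uB.
  by rewrite !addnS; exact: ucx.
split.
- split=> [i j|v]; first exact: hankelC.
  have := u01 v 0%N; rewrite -subr_ge0 /u /qform -sumrB; congr (0 <= _).
  apply: eq_bigr => p _; rewrite -sumrB; apply: eq_bigr => q _.
  by rewrite /hankel /diff_seq addn0 addn1 mulrBr.
- split=> [i j|v]; first exact: hankelC.
  have := u01 v 1%N; rewrite -subr_ge0 /u /qform -sumrB; congr (0 <= _).
  apply: eq_bigr => p _; rewrite -sumrB; apply: eq_bigr => q _.
  by rewrite /hankel /diff_seq addn1 addn2 mulrBr.
by move=> n; rewrite (le_trans (ler_normB _ _))// mulr_natl mulr2n lerD.
Qed.

Lemma hausdorff_diff_ge0 g (M : R) l : psd (hankel g) -> psd (hankel (fun n => g n.+1)) ->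
  (forall n, `|g n| <= M) -> 0 <= iter l diff_seq g 0%N.
Proof.
elim: l g M => [|l IH] g M p0 p1 gM; first exact: (psd_ge0 0%N p0).
by rewrite iterSr; have [q0 q1 qM] := hausdorff_diff p0 p1 gM; exact: IH q0 q1 qM.
Qed.

End Hankel.

(** * Normal extensions of contractions *)

Section Coefficients.
Context (R : realType).

(* An approximation of [(m / N) ^ c]. *)
Definition fcoef (N c m : nat) : R := (m ^_ c)%:R / (N ^_ c)%:R.

Lemma fcoef_ge0 N c m : 0 <= fcoef N c m.
Proof. by rewrite divr_ge0. Qed.

Lemma fcoefS N c m : (c < N)%N -> fcoef N c.+1 m = fcoef N c m * ((m - c)%N%:R / (N - c)%N%:R).
Proof.
move=> cN; rewrite /fcoef !ffactnSr !natrM invfM; ring.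
Qed.

Lemma fcoef_le1 N c m : (c <= N)%N -> (m <= N)%N -> fcoef N c m <= 1.
Proof.
elim: c => [|c IH] cN mN; first by rewrite /fcoef !ffactn0 divr1.
rewrite fcoefS// mulr_ile1 ?fcoef_ge0 ?divr_ge0// ?IH ?(ltnW cN)//.
by rewrite ler_pdivrMr ?mul1r ?ler_nat ?ltr0n ?subn_gt0//; lia.
Qed.

Lemma ratio_shift (x M a : nat) : (x <= M)%N -> (a < M)%N ->
  `|x%:R / M%:R - (x - a)%N%:R / (M - a)%N%:R| <= a%:R / (M - a)%N%:R :> R.
Proof.
move=> xM aM.
have M0 : 0 < M%:R :> R by rewrite ltr0n; lia.
have Ma0 : 0 < (M - a)%N%:R :> R by rewrite ltr0n; lia.
have Ma : (M - a)%N%:R = M%:R - a%:R :> R by rewrite natrB// ltnW.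
have [ax|xa] := leqP a x.
  have xa' : (x - a)%N%:R = x%:R - a%:R :> R by rewrite natrB.
  have -> : x%:R / M%:R - (x - a)%N%:R / (M - a)%N%:R =
      a%:R / (M - a)%N%:R * ((M%:R - x%:R) / M%:R) :> R.
    rewrite xa' Ma in Ma0 *; field; rewrite !gt_eqF//.
  rewrite ger0_norm; last by rewrite !(mulr_ge0, invr_ge0)// subr_ge0 ler_nat.
  rewrite ler_piMr ?divr_ge0// ler_pdivrMr// mul1r lerBlDr lerDl//.
(* Here [x < a], so the truncated difference makes the second ratio 0. *)
rewrite (_ : (x - a)%N = 0%N) ?mul0r ?subr0; last by lia.
rewrite ger0_norm ?divr_ge0// ler_pM ?invr_ge0 ?ler_nat ?(ltnW xa)//.
by rewrite lef_pV2 ?posrE// ler_nat leq_subr.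
Qed.

(** Both sides are products of [b] ratios in [0, 1], compared factor by factor. With
    [N = 2 K + n.+1] every denominator that occurs stays at least [n.+1], which makes the error of
    each factor at most [K / n.+1]. *)
Lemma fcoef_shift (K n a b m : nat) : (a <= K)%N -> (b <= K)%N -> (m <= 2 * K + n.+1)%N ->
  `|fcoef (2 * K + n.+1) b m - fcoef (2 * K + n.+1 - a) b (m - a)| <= b%:R * (K%:R / n.+1%:R).
Proof.
move=> aK; set N := (2 * K + n.+1)%N.
elim: b => [|b IH] bK mN; first by rewrite /fcoef !ffactn0 subrr normr0 mul0r.
rewrite !fcoefS; [|lia..].
set w := fcoef _ b _ in IH *; set w' := fcoef _ b _ in IH *.
set f := _ / _; set g := (_ - b)%N%:R / _.
have -> : w * f - w' * g = (w - w') * f + w' * (f - g) by ring.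
have f0 : 0 <= f by rewrite divr_ge0.
have f1 : f <= 1.
  rewrite /f ler_pdivrMr ?mul1r ?ler_nat ?ltr0n; lia.
have w'0 : 0 <= w' by exact: fcoef_ge0.
have w'1 : w' <= 1 by apply: fcoef_le1; lia.
have fg : `|f - g| <= K%:R / n.+1%:R.
  rewrite /f /g (_ : m - a - b = m - b - a)%N; last by lia.
  rewrite (_ : N - a - b = N - b - a)%N; last by lia.
  apply: le_trans (ratio_shift _ _) _; [lia|lia|].
  rewrite ler_pM ?invr_ge0 ?ler_nat// lef_pV2 ?posrE ?ltr0n ?ler_nat; lia.
rewrite (le_trans (ler_normD _ _))// normrM [X in _ + X]normrM (ger0_norm f0) (ger0_norm w'0).
rewrite -natr1 mulrDl mul1r lerD//.
  by rewrite (le_trans _ (IH _ mN))//; [rewrite ler_piMr|lia].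
by rewrite (le_trans _ fg)// ler_piMl.
Qed.

Lemma fcoefD N a b m : fcoef N (a + b) m = fcoef N a m * fcoef (N - a) b (m - a).
Proof.
have ffactD x : (x ^_ (a + b) = x ^_ a * (x - a) ^_ b)%N.
  elim: a x => [|c IH] x; first by rewrite subn0 ffactn0 mul1n.
  by case: x => [|x]; [rewrite !ffact0n|rewrite !ffactSS IH mulnA subSS].
by rewrite /fcoef !ffactD !natrM invfM; ring.
Qed.

(** [fcoef] is multiplicative only in the limit. The error is kept relative to [fcoef N a m], so
    that its weighted sums remain bounded, see [bform_fcoef_diag]. *)
Lemma fcoef_mul (K n a b m : nat) : (a <= K)%N -> (b <= K)%N -> (m <= 2 * K + n.+1)%N ->
  `|fcoef (2 * K + n.+1) (a + b) m
    - fcoef (2 * K + n.+1) a m * fcoef (2 * K + n.+1) b m| <=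
  (K * K)%:R / n.+1%:R * fcoef (2 * K + n.+1) a m.
Proof.
move=> aK bK mN; rewrite fcoefD -mulrBr normrM (ger0_norm (fcoef_ge0 _ _ _)) mulrC.
rewrite ler_wpM2r ?fcoef_ge0// distrC (le_trans (fcoef_shift aK bK mN))//.
by rewrite natrM -mulrA ler_wpM2r ?divr_ge0// ler_nat.
Qed.

(** This exact identity is the reason for falling factorials instead of powers of [m / N]: all
    expansions can be taken at the same order [N]. *)
Lemma bin_fcoef N c m : (c <= N)%N -> (m <= N - c)%N ->
  'C(N, m + c)%:R * fcoef N c (m + c) = 'C(N - c, m)%:R.
Proof.
move=> cN mN; have h : ('C(N, m + c) * (m + c) ^_ c = N ^_ c * 'C(N - c, m))%N.
  apply/eqP; rewrite -(eqn_pmul2r (fact_gt0 m)) -(eqn_pmul2r (fact_gt0 (N - c - m))).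
  have e1 := @ffact_fact (m + c) c (leq_addl _ _); rewrite addnK in e1.
  rewrite -(mulnA 'C(N, _)) e1.
  have mcN : (m + c <= N)%N by lia.
  have := bin_fact mcN; rewrite (_ : N - (m + c) = N - c - m)%N; last by lia.
  rewrite mulnA => ->; have := bin_fact mN => e2.
  by rewrite -!mulnA e2 ffact_fact.
rewrite /fcoef mulrA -natrM h natrM mulrAC mulfV ?mul1r//.
by rewrite pnatr_eq0 -lt0n ffact_gt0.
Qed.

Lemma sum_bin_fcoef N c (G : nat -> R) : (c <= N)%N ->
  \sum_(m < N.+1) 'C(N, m)%:R * fcoef N c m * G m =
  \sum_(m < (N - c).+1) 'C(N - c, m)%:R * G (m + c)%N.
Proof.
move=> cN; rewrite -(big_mkord xpredT (fun m => 'C(N, m)%:R * fcoef N c m * G m)).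
rewrite (@big_cat_nat _ _ _ c)//=; last by lia.
rewrite big_nat big1 ?add0r; last first.
  by move=> m /andP[_ mc]; rewrite /fcoef ffact_small// !(mul0r, mulr0).
rewrite -{1}[c]add0n big_addn big_mkord (_ : N.+1 - c = (N - c).+1)%N; last by lia.
by apply: eq_bigr => m _; rewrite bin_fcoef// -ltnS.
Qed.

(** [F j m] behaves like the integral of [(1 - t)^j t^m]; the induction is Pascal's rule. *)
Lemma binomial_unfold (F : nat -> nat -> R) n :
  (forall j m, F j m = F j.+1 m + F j m.+1) ->
  F 0%N 0%N = \sum_(m < n.+1) 'C(n, m)%:R * F (n - m)%N m.
Proof.
elim: n F => [|n IH] F FE; first by rewrite big_ord1 mul1r.
rewrite FE (IH (fun j m => F j.+1 m)) => [|j m]; last exact: FE.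
rewrite (IH (fun j m => F j m.+1)) => [|j m]; last exact: FE.
rewrite [RHS]big_ord_recl [in LHS]big_ord_recl/= !bin0 !subn0 -!addrA; congr (_ + _).
rewrite [X in _ + X]big_ord_recr/= binn subnn.
rewrite [in RHS]big_ord_recr/= /bump/= !add1n binn subnn addrA; congr (_ + _).
rewrite -big_split/=; apply: eq_bigr => i _.
by rewrite /bump/= !add1n binS natrD mulrDl subSS subnSK ?ltn_ord// addrC.
Qed.

End Coefficients.

Section BoundedOperators.
Context (R : realType) (H : hilbertType R).
Implicit Types (A B : {linear H -> H}) (x y : H).

Lemma adjoint_closed (S : set (H * H)) : closed (adjoint S).
Proof.
move=> p clp q Sq; apply/eqP; rewrite -subr_eq0 -normr_eq0 nrmE.
suff -> : nrm (hdot q.2 p.1 - hdot q.1 p.2) = 0 by [].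
apply/eqP; rewrite eq_le nrm_ge0 andbT; apply/ler_addgt0Pr => e e0; rewrite add0r.
pose M := nrm q.1 + nrm q.2 + 1.
have M0 : 0 < M by rewrite ltr_wpDl ?addr_ge0 ?nrm_ge0.
have d0 : (0 : R[i]) < (e / M)%:C by rewrite ltcR divr_gt0.
have [|p' [Sp' [b1 b2]]] := clp (ball p.1 (e / M)%:C `*` ball p.2 (e / M)%:C).
  by exists (ball p.1 (e / M)%:C, ball p.2 (e / M)%:C) => //=; split; exact: nbhsx_ballx.
move: b1 b2; rewrite -!ball_normE/= !nrmE !ltcR => b1 b2.
rewrite (_ : _ - _ = hdot q.2 (p.1 - p'.1) - hdot q.1 (p.2 - p'.2)); last first.
  by rewrite !hdotBr (Sp' _ Sq) opprB addrA subrK.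
rewrite (le_trans (nrmD _ _))// nrmN.
rewrite (le_trans (lerD (hdot_CauchySchwarz _ _) (hdot_CauchySchwarz _ _)))//.
have h1 := ler_wpM2l (nrm_ge0 q.2) (ltW b1); have h2 := ler_wpM2l (nrm_ge0 q.1) (ltW b2).
rewrite (le_trans (lerD h1 h2))// -mulrDl mulrA ler_pdivrMr// mulrC ler_wpM2l ?(ltW e0)//.
by rewrite /M addrC lerDl.
Qed.

Lemma hdot_injr x y : (forall z, hdot z x = hdot z y) -> x = y.
Proof. by move=> h; apply: hdot_inj => z; rewrite hdotC h -hdotC. Qed.

Lemma lin_op_bounded A (M : R) : (forall x, nrm (A x) <= M * nrm x) ->
  bounded_op (lin_op A) /\ (0 <= M -> (opnorm (lin_op A) <= M%:E)%E).
Proof.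
move=> AM; have M0 : (opnorm (lin_op A) <= `|M|%:E)%E.
  apply: ge_ereal_sup => _ [p [/= -> p1] <-]; rewrite lee_fin (le_trans (AM _))//.
  rewrite (le_trans (ler_norm _))// normrM ler_piMr// ger0_norm//; exact: nrm_ge0.
split; last by move=> h; rewrite ger0_norm in M0.
split; last by rewrite (le_lt_trans M0)// ltry.
by apply/seteqP; split => // x _; exists (A x).
Qed.

Lemma lin_op_normal A B : (forall x y, hdot (A x) y = hdot x (B y)) ->
  (forall x, A (B x) = B (A x)) -> normal_op (lin_op A).
Proof.
move=> AB ABC.
have adjA : adjoint (lin_op A) = graph (lin_op B).
  apply/seteqP; split=> [p Ap|p /= pB q /= ->]; last by rewrite pB AB.
  apply: hdot_injr => z; have := Ap (z, A z) erefl => /= <-.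
  by rewrite AB.
have adjB : adjoint (lin_op B) = graph (lin_op A).
  apply/seteqP; split=> [p Ap|p /= pB q /= ->].
    apply: hdot_injr => z; have := Ap (z, B z) erefl => /= <-.
    by rewrite hdotC -AB -hdotC.
  by rewrite pB hdotC -AB -hdotC.
split.
- apply/seteqP; split => // x _; apply: subset_closure; by exists (A x).
- by rewrite -adjB; exact: adjoint_closed.
rewrite adjA; apply/seteqP; split=> -[x z] [y /= -> ->].
  by exists (B x); rewrite /= ?ABC.
by exists (A x); rewrite /= ?ABC.
Qed.

End BoundedOperators.

(** * The Bram-Halmos kernel of a contraction *)

Section Contraction.
Context (R : realType) (H : hilbertType R) (T : {linear H -> H}).
Implicit Types (f g h : H).
Hypothesis T_contr : forall h, nrm (T h) <= nrm h.
Hypothesis T_psd : forall h, psd (hankel (fun n => nrm (iter n T h) ^+ 2)).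

Lemma iterT_linear n : linear (iter n T).
Proof. by elim: n => [|n IH] a f g //=; rewrite IH linearP. Qed.

Lemma iterT0 n : iter n T 0 = 0.
Proof. by elim: n => [|n IH] //=; rewrite IH linear0. Qed.

Lemma iterTZ n (a : R[i]) h : iter n T (a *: h) = a *: iter n T h.
Proof. by have := iterT_linear n a h 0; rewrite !addr0 iterT0 addr0. Qed.

Lemma nrm_iterT n h : nrm (iter n T h) <= nrm h.
Proof. by elim: n => [|n IH] //=; exact: le_trans (T_contr _) IH. Qed.

(* [bform l f g] is the real part of [sum_(r <= l) (-1)^r 'C(l, r) <T^r f, T^r g>]. *)
Fixpoint bform l f g : R :=
  if l is l'.+1 then bform l' f g - bform l' (T f) (T g) else complex.Re (hdot f g).

Lemma bformDl l f f' g : bform l (f + f') g = bform l f g + bform l f' g.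
Proof.
elim: l f f' g => [|l IH] f f' g /=; first by rewrite hdotDl raddfD.
by rewrite linearD !IH; ring.
Qed.

Lemma bformC l f g : bform l f g = bform l g f.
Proof.
elim: l f g => [|l IH] f g /=; first by rewrite hdotC complexRe_conj.
by rewrite !(IH f) (IH (T f)).
Qed.

Lemma bformDr l f g g' : bform l f (g + g') = bform l f g + bform l f g'.
Proof. by rewrite bformC bformDl !(bformC l f). Qed.

Lemma bformZl l (a : R) f g : bform l (a%:C *: f) g = a * bform l f g.
Proof.
elim: l f g => [|l IH] f g /=; first by rewrite hdotZl Re_realM.
by rewrite linearZ/= !IH; ring.
Qed.

Lemma bformZr l (a : R) f g : bform l f (a%:C *: g) = a * bform l f g.
Proof. by rewrite bformC bformZl bformC. Qed.

Lemma bform0l l g : bform l 0 g = 0.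
Proof. by have := bformZl l 0 0 g; rewrite scaler0 mul0r. Qed.

Lemma bform0r l g : bform l g 0 = 0.
Proof. by rewrite bformC bform0l. Qed.

Lemma bform_suml l I (r : seq I) (F : I -> H) g :
  bform l (\sum_(i <- r) F i) g = \sum_(i <- r) bform l (F i) g.
Proof. exact: (big_morph (bform l ^~ g) (fun x y => bformDl l x y g) (bform0l l g)). Qed.

Lemma bform_sumr l I (r : seq I) (F : I -> H) g :
  bform l g (\sum_(i <- r) F i) = \sum_(i <- r) bform l g (F i).
Proof. exact: (big_morph (bform l g) (bformDr l g) (bform0r l g)). Qed.

Lemma bform_diff l m f : bform l (iter m T f) (iter m T f) =
  iter l (@diff_seq R) (fun n => nrm (iter n T f) ^+ 2) m.
Proof.
elim: l m => [|l IH] m /=; first by rewrite hdot_nrm.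
by rewrite -!iterS !IH.
Qed.

(** By [bform_diff] the value is an iterated difference of the squared norms along the orbit of [f].
    The shifted Hankel matrix required by Hausdorff's argument belongs to the orbit of [T f]. *)
Lemma bform_ge0 l f : 0 <= bform l f f.
Proof.
have := bform_diff l 0 f => /= ->; apply: (@hausdorff_diff_ge0 R _ (nrm f ^+ 2)).
- exact: T_psd.
- have := T_psd (T f); congr psd; apply/funext => i; apply/funext => j.
  by rewrite /hankel iterSr.
by move=> n; rewrite ger0_norm ?sqr_ge0// ler_sqr ?nnegrE ?nrm_ge0 ?nrm_iterT.
Qed.

Lemma bform_le l f g : `|bform l f g| <= (bform l f f + bform l g g) / 2.
Proof.
have := bform_ge0 l (f + g); have := bform_ge0 l (f + (-1)%:C *: g).
rewrite !(bformDl, bformDr, bformZl, bformZr) (bformC l g f) => h1 h2.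
by rewrite ler_norml; apply/andP; split; lra.
Qed.

(* Integrating [1 = (t + (1 - t)) ^ n] against the moments. *)
Lemma bform_unfold n f g : complex.Re (hdot f g) =
  \sum_(m < n.+1) 'C(n, m)%:R * bform (n - m) (iter m T f) (iter m T g).
Proof.
rewrite -(@binomial_unfold R (fun j m => bform j (iter m T f) (iter m T g)))//.
by move=> j m /=; ring.
Qed.

(** The expansion of order [N - (a + b)] is indexed by [m - (a + b)], so that sums for different [a]
    and [b] run over the same [m]. The truncated exponents are harmless: [fcoef] vanishes for
    [m < a + b]. *)
Lemma bform_fcoef N a b f g : (a + b <= N)%N ->
  complex.Re (hdot (iter b T f) (iter a T g)) =
  \sum_(m < N.+1) 'C(N, m)%:R * fcoef R N (a + b) m *
     bform (N - m) (iter (m - a) T f) (iter (m - b) T g).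
Proof.
move=> abN; rewrite (bform_unfold (N - (a + b))).
rewrite (sum_bin_fcoef (fun m => bform (N - m) (iter (m - a) T f) (iter (m - b) T g)) abN).
apply: eq_bigr => m _; rewrite -!iterD (_ : N - (a + b) - m = N - (m + (a + b)))%N; last by lia.
rewrite (_ : m + (a + b) - a = m + b)%N; last by lia.
by rewrite (_ : m + (a + b) - b = m + a)%N; last by lia.
Qed.

Lemma bform_fcoef_diag N a f : (a <= N)%N ->
  \sum_(m < N.+1) 'C(N, m)%:R * fcoef R N a m *
     bform (N - m) (iter (m - a) T f) (iter (m - a) T f) = nrm f ^+ 2.
Proof.
move=> aN; rewrite nrm_hdot (bform_unfold (N - a)).
rewrite (sum_bin_fcoef (fun m => bform (N - m) (iter (m - a) T f) (iter (m - a) T f)) aN).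
apply: eq_bigr => m _; rewrite addnK (_ : N - a - m = N - (m + a))%N//; last by lia.
Qed.

(** In any normal extension this is the inner product of the vectors obtained from [x.2] and [y.2]
    by applying the adjoint [x.1] and [y.1] times. *)
Definition bram_kernel (x y : nat * H) : R[i] := hdot (iter y.1 T x.2) (iter x.1 T y.2).

Lemma bram_kernelC x y : bram_kernel y x = (bram_kernel x y)^*.
Proof. exact: hdotC. Qed.

Definition bram_vec (p : R[i] * (nat * H)) : H := p.1 *: p.2.2.

Lemma bram_kform v : complex.Re (kform bram_kernel v v) =
  \sum_(p <- v) \sum_(q <- v)
    complex.Re (hdot (iter q.2.1 T (bram_vec p)) (iter p.2.1 T (bram_vec q))).
Proof.
rewrite kformE raddf_sum; apply: eq_bigr => p _; rewrite raddf_sum; apply: eq_bigr => q _.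
by rewrite /bram_vec !iterTZ hdotZl hdotZr /bram_kernel mulrA.
Qed.

(** If [fcoef N (a + b) m] were the product of the weights for [a] and [b], the form would be a sum
    of squares for the forms [bform]; the defect is of order [1 / n.+1]. *)
Lemma bram_kform_approx (v : seq (R[i] * (nat * H))) (K n : nat) :
  (forall p, p \in v -> (p.2.1 <= K)%N) ->
  - ((K * K)%:R / n.+1%:R * \sum_(p <- v) \sum_(q <- v)
      (nrm (bram_vec p) ^+ 2 + nrm (bram_vec q) ^+ 2) / 2) <= complex.Re (kform bram_kernel v v).
Proof.
move=> vK; set N := (2 * K + n.+1)%N; set e := _ / _.
pose w a m := fcoef R N a m.
pose G m (p q : R[i] * (nat * H)) := bform (N - m) (iter (m - p.2.1) T (bram_vec p))
  (iter (m - q.2.1) T (bram_vec q)).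
(* With product weights, the terms of index [m] combine into [bform (N - m)] at the single vector
   [A m]. *)
have pos : 0 <= \sum_(p <- v) \sum_(q <- v) \sum_(m < N.+1)
    'C(N, m)%:R * (w p.2.1 m * w q.2.1 m) * G m p q.
  pose A m : H := \sum_(p <- v) (w p.2.1 m)%:C *: iter (m - p.2.1) T (bram_vec p).
  have -> : \sum_(p <- v) \sum_(q <- v) \sum_(m < N.+1)
      'C(N, m)%:R * (w p.2.1 m * w q.2.1 m) * G m p q =
      \sum_(m < N.+1) 'C(N, m)%:R * bform (N - m) (A m) (A m).
    under eq_bigr do rewrite exchange_big/=.
    rewrite exchange_big/=; apply: eq_bigr => m _.
    rewrite [X in bform _ X _]/A bform_suml mulr_sumr; apply: eq_bigr => p _.
    rewrite /A bform_sumr mulr_sumr; apply: eq_bigr => q _.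
    by rewrite bformZl bformZr /G; ring.
  by apply: sumr_ge0 => m _; rewrite mulr_ge0// bform_ge0.
apply: (@le_trans _ _ (\sum_(p <- v) \sum_(q <- v) (\sum_(m < N.+1)
    'C(N, m)%:R * (w p.2.1 m * w q.2.1 m) * G m p q -
    e * ((nrm (bram_vec p) ^+ 2 + nrm (bram_vec q) ^+ 2) / 2)))).
  have -> : \sum_(p <- v) \sum_(q <- v) (\sum_(m < N.+1)
    'C(N, m)%:R * (w p.2.1 m * w q.2.1 m) * G m p q -
    e * ((nrm (bram_vec p) ^+ 2 + nrm (bram_vec q) ^+ 2) / 2)) =
    \sum_(p <- v) \sum_(q <- v) \sum_(m < N.+1)
      'C(N, m)%:R * (w p.2.1 m * w q.2.1 m) * G m p q -
    e * \sum_(p <- v) \sum_(q <- v) (nrm (bram_vec p) ^+ 2 + nrm (bram_vec q) ^+ 2) / 2.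
    rewrite mulr_sumr -sumrB; apply: eq_bigr => p _.
    by rewrite mulr_sumr -sumrB; apply: eq_bigr => q _.
  by rewrite -[leLHS]add0r lerD2r.
rewrite bram_kform big_seq [leRHS]big_seq; apply: ler_sum => p pv.
rewrite big_seq [leRHS]big_seq; apply: ler_sum => q qv.
have aK := vK _ pv; have bK := vK _ qv.
set a := p.2.1 in aK *; set b := q.2.1 in bK *.
have aN : (a <= N)%N by rewrite /N; lia.
have bN : (b <= N)%N by rewrite /N; lia.
have abN : (a + b <= N)%N by rewrite /N; lia.
rewrite (bform_fcoef (bram_vec p) (bram_vec q) abN).
rewrite -(bform_fcoef_diag (bram_vec p) aN) -(bform_fcoef_diag (bram_vec q) bN).
rewrite -big_split/= mulr_suml mulr_sumr -sumrB; apply: ler_sum => m _.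
have mN : (m <= 2 * K + n.+1)%N by have := ltn_ord m; rewrite ltnS.
have d1 := @fcoef_mul R K n a b m aK bK mN.
have d2 := @fcoef_mul R K n b a m bK aK mN.
rewrite -/N [(b + a)%N]addnC [fcoef R N b m * _]mulrC -/e in d2.
rewrite -/N -/e in d1.
set D := fcoef R N (a + b) m - _ in d1 d2.
have := bform_le (N - m) (iter (m - a) T (bram_vec p)) (iter (m - b) T (bram_vec q)).
have := bform_ge0 (N - m) (iter (m - a) T (bram_vec p)).
have := bform_ge0 (N - m) (iter (m - b) T (bram_vec q)).
rewrite /G -/a -/b; set xp := iter (m - a) T _; set xq := iter (m - b) T _.
set g := bform _ xp xq; set gp := bform _ xp xp; set gq := bform _ xq xq.
move=> gq0 gp0 hg.
(* [D] is small relative to either weight. Pairing each weight with its own diagonal form leaves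
   sums that [bform_fcoef_diag] turns into squared norms. *)
have h : `|D * g| <= e * ((fcoef R N a m * gp + fcoef R N b m * gq) / 2).
  rewrite normrM (le_trans (ler_wpM2l (normr_ge0 _) hg))//.
  have := ler_wpM2r gp0 d1; have := ler_wpM2r gq0 d2; lra.
have c0 : 0 <= 'C(N, m)%:R :> R by [].
have := ler_wpM2l c0 h; rewrite /w.
have : - `|D * g| <= D * g by rewrite lerNl -normrN ler_norm.
move=> /(ler_wpM2l c0); rewrite /D; lra.
Qed.

Lemma bram_kform_ge0 v : 0 <= kform bram_kernel v v.
Proof.
have im0 : complex.Im (kform bram_kernel v v) = 0.
  have := kform_conj v v bram_kernelC; case: kform => a b /(congr1 (@complex.Im R))/=.
  by move=> h; lra.
pose K := \max_(p <- v) p.2.1.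
have vK p : p \in v -> (p.2.1 <= K)%N by move=> pv; rewrite /K (big_rem p)//= leq_maxl.
have h n := bram_kform_approx n vK.
set S := \sum_(p <- v) _ in h.
have c1 : (fun n => - ((K * K)%:R / n.+1%:R * S)) @ \oo --> (0 : R).
  rewrite -oppr0; apply: cvgN; rewrite -(mul0r S); apply: cvgMl.
  by rewrite -(mulr0 (K * K)%:R); apply: cvgMr; exact: cvg_inv_succ.
rewrite lecE/= im0 eqxx/=; apply: (ler_cvg_to c1 (cvg_cst _)); exact: nearW.
Qed.

Definition bram : psdkernel R (nat * H) := PsdKernel bram_kernelC bram_kform_ge0.

Let up (x : nat * H) : nat * H := (x.1.+1, x.2).
Let tp (x : nat * H) : nat * H := (x.1, T x.2).

Let shiftv n (v : seq (R[i] * (nat * H))) := cmap (fun=> 1) (iter n up) v.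

Let iterup m z : iter m up z = ((m + z.1)%N, z.2).
Proof. by elim: m => [|m IH]; [case: z|rewrite iterS IH]. Qed.

Lemma bram_shift n x y : bram_kernel (iter n up x) (iter n up y) =
  hdot (iter n T (iter y.1 T x.2)) (iter n T (iter x.1 T y.2)).
Proof.
by rewrite !iterup /bram_kernel/= !iterD.
Qed.

Lemma kq_shiftv n v : kq bram (shiftv n v) = complex.Re (\sum_(p <- v) \sum_(q <- v)
  p.1 * q.1^* * hdot (iter n T (iter q.2.1 T p.2.2)) (iter n T (iter p.2.1 T q.2.2))).
Proof.
rewrite /kq kformE big_map; congr complex.Re; apply: eq_bigr => p _.
rewrite big_map; apply: eq_bigr => q _ /=.
by rewrite bram_shift rmorph1 !mulr1.
Qed.

(* The squared norms of the shifted vectors form a convex bounded sequence. *)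
Lemma kq_up v : kq bram (cmap (fun=> 1) up v) <= kq bram v.
Proof.
pose u n := kq bram (shiftv n v).
have sh w : w = shiftv 0 w.
  by rewrite /shiftv /cmap -[LHS]map_id; apply: eq_map => -[c x] /=; rewrite rmorph1 mulr1.
have -> : kq bram (cmap (fun=> 1) up v) = u 1%N by [].
have -> : kq bram v = u 0%N by rewrite /u -sh.
apply: (@convex_bounded_nonincr R u
  (\sum_(p <- v) \sum_(q <- v) nrm (p.1 * q.1^*) * (nrm p.2.2 * nrm q.2.2))) => n.
  (* [up \o tp] stands for the product of the adjoint and [N]. As the form at [up] applied to [w] is
     the inner product of [w] and [w'], positivity at [w - w'] is convexity of [u]. *)
  pose w := shiftv n v; pose w' := cmap (fun=> 1) (up \o tp) w.
  have := kq_ge0 bram (w ++ combZ (-1) w').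
  rewrite kq_cat_scale rmorphN rmorph1 mulN1r raddfN/= nrmN (_ : nrm 1 = 1); last first.
    by rewrite (_ : 1 = (1 : R)%:C)// nrm_real normr1.
  rewrite expr1n mul1r.
  have -> : kq bram w' = u n.+2.
    rewrite /u kq_shiftv /w' /w /shiftv /cmap -!map_comp /kq kformE big_map.
    congr complex.Re; apply: eq_bigr => p _; rewrite big_map; apply: eq_bigr => q _ /=.
    rewrite rmorph1 !mulr1; congr (_ * _).
    by rewrite !iterup /bram_kernel/= -!iterSr -!iterS -!iterD !addSn.
  have -> : complex.Re (kform bram w w') = u n.+1.
    rewrite /u kq_shiftv /w' /w /shiftv /cmap -!map_comp kformE big_map.
    congr complex.Re; apply: eq_bigr => p _; rewrite big_map; apply: eq_bigr => q _ /=.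
    rewrite rmorph1 !mulr1; congr (_ * _).
    by rewrite !iterup /bram_kernel/= -!iterSr -!iterS -!iterD !addSn.
  rewrite -/(u n) mulrN; lra.
rewrite /u kq_shiftv raddf_sum; apply: ler_sum => p _; rewrite raddf_sum; apply: ler_sum => q _.
rewrite (le_trans (ler_norm _))// (le_trans (Re_le_nrm _))// nrmM ler_wpM2l ?nrm_ge0//.
rewrite (le_trans (hdot_CauchySchwarz _ _))// ler_pM ?nrm_ge0//.
  by rewrite (le_trans (nrm_iterT _ _))// nrm_iterT.
by rewrite (le_trans (nrm_iterT _ _))// nrm_iterT.
Qed.

(** Formally [N] and its adjoint have equal norms at every vector: both maps change the form in the
    same way. *)
Lemma kq_tp v : kq bram (cmap (fun=> 1) tp v) <= kq bram v.
Proof.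
apply: le_trans (kq_up v); rewrite /kq !kformE !big_map le_eqVlt; apply/orP; left; apply/eqP.
congr complex.Re; apply: eq_bigr => p _; rewrite !big_map; apply: eq_bigr => q _ /=.
by rewrite /bram_kernel/= -!iterSr.
Qed.

Lemma bram_adj (x y : nat * H) :
  (1 : R[i]) * bram y (up x) = (1 : R[i])^* * bram (tp y) x.
Proof. by rewrite rmorph1 !mul1r /= /bram_kernel/= -iterSr. Qed.

(** Elements are functions, so composition with [up] is [N] and not its adjoint: the value at
    [(a.+1, g)] is an inner product with one more adjoint on the right, which moves to the left as
    [N]. *)
Definition bram_wmap : wmap bram := Wmap bram_adj kq_up kq_tp.

Definition bram_emb (f : H) : rkhs bram := iota_rk bram (0%N, f).

Lemma bram_embE f x : bram_emb f x = hdot (iter x.1 T f) x.2.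
Proof. by rewrite /bram_emb iota_rkE. Qed.

Lemma bram_emb_linear : linear bram_emb.
Proof.
move=> a f g; apply: rkhsP => x.
rewrite -[(a *: bram_emb f + bram_emb g) x]/(a * bram_emb f x + bram_emb g x).
by rewrite !bram_embE iterT_linear hdotDl hdotZl.
Qed.

HB.instance Definition _ :=
  GRing.isLinear.Build R[i] H (rkhs bram) _ bram_emb bram_emb_linear.

(* The minimal normal extension: [(a, f)] stands for [N^*^a f]. *)
Lemma contraction_subnormal : exists (K : hilbertType R) (V : {linear H -> K})
  (N : operator K K), bounded_op N /\ normal_extension (lin_op T) V N.
Proof.
exists (rkhs bram), bram_emb, (lin_op (wop bram_wmap)); split.
  by have [|//] := @lin_op_bounded R _ (wop bram_wmap) 1 => x; rewrite mul1r wop_nrm.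
split.
- move=> x; rewrite !nrmE; congr (_%:C); apply/eqP.
  by rewrite -(@eqrXn2 _ 2) ?nrm_ge0// !nrm_hdot hdot_iota bram_embE.
- apply: (@lin_op_normal _ _ _ (wop (wadj bram_wmap))) => [f g|f]; first exact: wop_adj.
  by apply: rkhsP => -[a f']; rewrite !wopE.
move=> x y /= ->; apply: rkhsP => -[a f].
by rewrite wopE !bram_embE/= mul1r -iterSr.
Qed.

End Contraction.

Lemma nrm1 (R : realType) : nrm (1 : R[i]) = 1.
Proof. by rewrite (_ : 1 = (1 : R)%:C)// nrm_real normr1. Qed.

(** * Normal extensions of weighted shifts *)

Section OrthonormalSeries.
Context (R : realType) (K : hilbertType R) (u : nat -> K).
Hypothesis uo : forall i j, hdot (u i) (u j) = (i == j)%:R.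

Definition on_sum (f : l2 R) n : K := \sum_(i < n) f i *: u i.

Lemma on_sum_nrm (f : nat -> R[i]) (P : pred nat) n :
  nrm (\sum_(i < n | P i) f i *: u i) ^+ 2 = \sum_(i < n | P i) nrm (f i) ^+ 2.
Proof.
rewrite nrm_hdot hdot_suml raddf_sum; apply: eq_bigr => i Pi.
rewrite hdot_sumr (bigD1 i)//= big1 ?addr0; last first.
  move=> j /andP[_ ji]; rewrite hdotZl hdotZr uo (_ : (i == j :> nat) = false) ?mulr0//.
  by rewrite eq_sym; exact: negbTE.
by rewrite hdotZl hdotZr uo eqxx mulr1 -normCK nrmE -rmorphXn.
Qed.

Lemma on_sum_cvg f : cvgn (on_sum f).
Proof.
pose s n := \sum_(i < n) nrm (f i) ^+ 2.
pose L := nrm f ^+ 2.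
have sL : s @ \oo --> L.
  have := @l2_summable _ f; rewrite /sq_summable => h.
  rewrite /L l2_nrm_sqr; rewrite (_ : s = series (fun n => nrm (f n) ^+ 2))//.
  by apply/funext => n; rewrite /s /series/= big_mkord.
have sle n : s n <= L by exact: l2_nrm_ge.
apply: (@cvgn_cauchy _ _ _ (fun n => Num.sqrt (L - s n))).
  have h : (fun n => L - s n) @ \oo --> 0.
    by rewrite -(subrr L); apply: cvgB => //; exact: cvg_cst.
  rewrite -(sqrtr0 R); exact: (cvg_comp _ _ h (@sqrt_continuous R 0)).
move=> n m; wlog nm : n m / (n <= m)%N.
  move=> h; have [/h//|/ltnW/h] := leqP n m.
  by move=> h'; rewrite -nrmN opprB [leRHS]addrC.
have -> : on_sum f n - on_sum f m = - \sum_(i < m | (n <= i)%N) f i *: u i.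
  rewrite /on_sum (bigID (fun i : 'I_m => (i < n)%N))/= opprD addrA.
  rewrite (big_ord_widen_cond m xpredT (fun i => f i *: u i)) ?subrr ?sub0r//.
  by congr (- _); apply: eq_bigl => i; rewrite -leqNgt.
rewrite nrmN -ler_sqr ?nnegrE ?nrm_ge0 ?addr_ge0 ?sqrtr_ge0//.
rewrite (on_sum_nrm f (fun i => n <= i)%N).
have -> : \sum_(i < m | (n <= i)%N) nrm (f i) ^+ 2 = s m - s n.
  rewrite /s [in RHS](bigID (fun i : 'I_m => (i < n)%N))/=.
  rewrite (big_ord_widen_cond m xpredT (fun i => nrm (f i) ^+ 2))// addrC addrK.
  by apply: eq_bigl => i; rewrite -leqNgt.
rewrite sqrrD !sqr_sqrtr ?subr_ge0//.
have := mulr_ge0 (sqrtr_ge0 (L - s n)) (sqrtr_ge0 (L - s m)).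
have := sle m; lra.
Qed.

Definition on_emb (f : l2 R) : K := limn (on_sum f).

Lemma on_emb_cvg f : on_sum f @ \oo --> on_emb f.
Proof. exact: on_sum_cvg. Qed.

Lemma on_emb_linear : linear on_emb.
Proof.
move=> a f g; apply: (cvg_lim (@norm_hausdorff _ K)).
rewrite (_ : on_sum _ = (fun n => a *: on_sum f n + on_sum g n)).
  by apply: cvgD; [apply: cvgZr|]; exact: on_emb_cvg.
apply/funext => n; rewrite /on_sum scaler_sumr -big_split/=; apply: eq_bigr => i _.
by transitivity ((a * f i + g i) *: u i); rewrite // scalerDl scalerA.
Qed.

HB.instance Definition _ :=
  GRing.isLinear.Build R[i] (l2 R) K _ on_emb on_emb_linear.

Definition on_isom : {linear l2 R -> K} := on_emb.

Lemma on_emb_nrm f : nrm (on_emb f) = nrm f.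
Proof.
apply/eqP; rewrite -(@eqrXn2 _ 2) ?nrm_ge0//; apply/eqP.
have h : (fun n => nrm (on_sum f n) ^+ 2) @ \oo --> nrm (on_emb f) ^+ 2.
  rewrite expr2; under eq_fun do rewrite expr2.
  by apply: cvgM; apply: cvg_nrm; exact: on_emb_cvg.
have h2 : (fun n => nrm (on_sum f n) ^+ 2) @ \oo --> nrm f ^+ 2.
  rewrite l2_nrm_sqr (_ : (fun n => _) = series (fun n => nrm (f n) ^+ 2)).
    exact: l2_summable.
  by apply/funext => n; rewrite (on_sum_nrm f xpredT) /series/= big_mkord.
by rewrite -(cvg_lim (@Rhausdorff R) h) -(cvg_lim (@Rhausdorff R) h2).
Qed.

End OrthonormalSeries.

Section UnitVectors.
Context (R : realType).

Definition unit_seq (n m : nat) : R[i] := (n == m)%:R.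

Lemma unit_seq_summable n : sq_summable (unit_seq n).
Proof.
apply/sq_summableP; exists 1 => N; rewrite /unit_seq.
have h i : nrm ((n == i)%:R : R[i]) ^+ 2 = (n == i)%:R.
  by case: eqP; rewrite ?nrm1 ?nrm0 ?expr1n ?expr0n.
under eq_bigr do rewrite h.
have [nN|Nn] := ltnP n N.
  rewrite (bigD1 (Ordinal nN))//= eqxx big1 ?addr0// => i.
  by rewrite -val_eqE/= eq_sym => /negbTE ->.
by rewrite big1// => i _; rewrite gtn_eqF// (leq_trans (ltn_ord i)).
Qed.

Definition unit_vec n : l2 R := l2_of (@unit_seq_summable n).

Lemma hdot_unit (f : l2 R) n : hdot f (unit_vec n) = f n.
Proof.
apply: (cvg_lim (@norm_hausdorff _ R[i])).
apply: (@cvg_trans _ ((fun=> f n) @ \oo)); last exact: cvg_cst.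
apply: near_eq_cvg; near=> N.
have nN : (n < N)%N by near: N; exact: nbhs_infty_gt.
rewrite /series/= big_mkord (bigD1 (Ordinal nN))//= big1 ?addr0.
  by rewrite /unit_seq eqxx rmorph1 mulr1.
move=> i; rewrite -val_eqE/= => /negbTE h.
by rewrite /unit_seq eq_sym h rmorph0 mulr0.
Unshelve. all: by end_near. Qed.

Lemma unit_vec_on i j : hdot (unit_vec i) (unit_vec j) = (i == j)%:R.
Proof. by rewrite hdot_unit. Qed.

Lemma unit_sum_cvg (f : l2 R) : on_sum unit_vec f @ \oo --> f.
Proof.
have h := @on_emb_cvg _ _ _ unit_vec_on f; suff e : on_emb unit_vec f = f by rewrite e in h; exact: h.
apply: l2P => n; rewrite -!hdot_unit.
apply: (cvgn_uniq (@cvg_hdotl _ _ _ _ (unit_vec n) h)).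
apply: (@cvg_trans _ ((fun=> hdot f (unit_vec n)) @ \oo)); last exact: cvg_cst.
apply: near_eq_cvg; near=> N.
have nN : (n < N)%N by near: N; exact: nbhs_infty_gt.
rewrite hdot_unit /on_sum hdot_suml (bigD1 (Ordinal nN))//= big1 ?addr0.
  by rewrite hdotZl unit_vec_on eqxx mulr1.
move=> i; rewrite -val_eqE/= => /negbTE h'.
by rewrite hdotZl unit_vec_on h' mulr0.
Unshelve. all: by end_near. Qed.

Lemma weighted_shift_unit (w : nat -> R[i]) n :
  graph (weighted_shift w) (unit_vec n, w n *: unit_vec n.+1).
Proof.
apply/weighted_shiftE; split=> [|m]; first by rewrite l2Z /= /unit_seq mulr0.
rewrite l2Z /= /unit_seq eqSS; case: eqP => [->//|_]; by rewrite !mulr0.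
Qed.

Lemma weighted_shift_dense (w : nat -> R[i]) : densely_defined (weighted_shift w).
Proof.
apply/seteqP; split => // f _ B /= Bf.
have [N _ hN] := @unit_sum_cvg f B Bf.
exists (on_sum unit_vec f N); split; last exact: (hN N (leqnn N)).
exists (\sum_(i < N) f i *: (w i *: unit_vec i.+1)); rewrite /on_sum.
suff h : graph (weighted_shift w) (\sum_(i < N) f i *: unit_vec i,
    \sum_(i < N) f i *: (w i *: unit_vec i.+1)) by exact: h.
elim: N {hN} => [|N IH]; first by rewrite !big_ord0; exact: graph0.
rewrite !big_ord_recr/=; exact: (graphD IH (graphZ (f N) (weighted_shift_unit w N))).
Qed.

End UnitVectors.

(* A selfadjoint [S] commuting with a unitary [U] gives the normal operator [U S]. *)
Section UnitaryTimesSelfadjoint.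
Context (R : realType) (K : hilbertType R) (S : set (K * K)) (U U' : {linear K -> K}).
Hypothesis S_dense : densely_defined S.
Hypothesis S_self : adjoint S = S.
Hypothesis U_adj : forall x y, hdot (U x) y = hdot x (U' y).
Hypothesis UK : forall x, U' (U x) = x.
Hypothesis UK' : forall x, U (U' x) = x.
Hypothesis SU : forall x y, S (x, y) -> S (U x, U y).
Hypothesis SU' : forall x y, S (x, y) -> S (U' x, U' y).

Definition us_graph : set (K * K) := [set p | S (p.1, U' p.2)].

Lemma us_graph0 : us_graph 0.
Proof. by rewrite /us_graph/= linear0 -S_self => q _ /=; rewrite !hdot0r. Qed.

Lemma us_graph_lin (a : R[i]) p q : us_graph p -> us_graph q -> us_graph (a *: p + q).
Proof.
rewrite /us_graph/= linearP -S_self => hp hq.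
by apply: adjointD => //; apply: adjointZ.
Qed.

Lemma us_graph_fun x y z : us_graph (x, y) -> us_graph (x, z) -> y = z.
Proof.
rewrite /us_graph/= -S_self => hy hz; rewrite -[y]UK' -[z]UK'.
by rewrite (adjoint_fun S_dense hy hz).
Qed.

Definition us_op : operator K K := Operator us_graph0 us_graph_lin us_graph_fun.

Lemma us_opE x y : S (x, y) -> graph us_op (x, U y).
Proof. by rewrite /= /us_graph/= UK. Qed.

(** Adjoints are closed, and [U S] is the adjoint of [S U']. *)
Lemma us_closed : closed (graph us_op).
Proof.
have -> : graph us_op = adjoint [set q | exists2 p, S p & q = (U p.1, p.2)].
  apply/seteqP; split=> [p /= Sp _ [q Sq ->] /=|p h].
    by rewrite U_adj; move: Sp; rewrite /us_graph/= -{1}S_self => /(_ _ Sq).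
  rewrite /= /us_graph/= -S_self => q Sq /=; rewrite -U_adj.
  by apply: (h (U q.1, q.2)); exists q.
exact: adjoint_closed.
Qed.

Lemma us_normal : normal_op us_op.
Proof.
have adjN p : adjoint us_op p <-> S (U' p.1, p.2).
  split=> [h|Sp q /= Sq].
    rewrite -S_self => -[x y] Sxy /=; have := h _ (us_opE Sxy) => /= <-.
    by rewrite U_adj.
  have := Sp; rewrite -{1}S_self => /(_ _ Sq)/= <-.
  by rewrite -U_adj UK'.
split.
- apply/seteqP; split => // x _; have : closure (opdom S) x by rewrite S_dense.
  apply: closure_subset => y [z Syz]; exists (U z); exact: us_opE.
- exact: us_closed.
apply/seteqP; split=> -[x z].
  move=> [y /= xy /adjN/= yz].
  (* If [y = U (S x)], the intermediate vector of the other product is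
     [S (U' x) = U' (S x) = U' (U' y)]. *)
  exists (U' (U' y)); last exact: SU'.
  by apply/adjN; exact: SU'.
move=> [y /adjN/= xy yz]; exists (U (U y)).
  by rewrite /= /us_graph/= UK -[x]UK'; exact: SU.
by apply/adjN; rewrite /= UK -[z]UK'; exact: SU.
Qed.

End UnitaryTimesSelfadjoint.

Section BlockKernels.
Context (R : realType) (X : Type) (T : eqType) (cl : X -> T) (K : X -> X -> R).
Hypothesis KC : forall x y, K x y = K y x.
Hypothesis K0 : forall x y, cl x != cl y -> K x y = 0.

Lemma qform_split t (v : seq (R * X)) : qform K v =
  qform K [seq p <- v | cl p.2 == t] + qform K [seq p <- v | cl p.2 != t].
Proof.
rewrite /qform !big_filter [LHS](bigID (fun p => cl p.2 == t))/=; congr (_ + _).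
  apply: eq_bigr => p /eqP pt.
  rewrite big_filter [LHS](bigID (fun p => cl p.2 == t))/= [X in _ + X]big1 ?addr0//.
  by move=> q qt; rewrite K0 ?mulr0// pt eq_sym.
apply: eq_bigr => p pt.
rewrite big_filter [LHS](bigID (fun p => cl p.2 == t))/= big1 ?add0r//.
by move=> q /eqP qt; rewrite K0 ?mulr0// qt.
Qed.

(** Distinct classes are orthogonal. The class of the first entry is split off, and the rest of the
    list is shorter. *)
Lemma psd_blocks : (forall t v, all (fun p => cl p.2 == t) v -> 0 <= qform K v) -> psd K.
Proof.
move=> Kt; split => // v; have [n] := ubnP (size v).
elim: n v => // n IH [|p v] vn; first by rewrite /qform big_nil.
rewrite (qform_split (cl p.2)) addr_ge0//; first by apply: (Kt (cl p.2)); exact: filter_all.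
have vn' : (size v < n)%N by [].
by apply: IH; rewrite /= eqxx/= (leq_ltn_trans _ vn')// size_filter count_size.
Qed.

End BlockKernels.

(** * Multiplication by [z] in the space generated by the symbols *)

Section ShiftExtension.
Context (R : realType) (c : nat -> R).
Hypothesis c_gt0 : forall n, 0 < c n.
Hypothesis c_psd : psd (hankel c).
Hypothesis c_psd1 : psd (hankel (fun n => c n.+1)).

(* [(n, i)] stands for the function [z^n |z|^(i - n)], so that [(n, n)] is [z^n]. *)
Notation X := (int * nat)%type.

Definition pclass (x : X) : int * bool := (x.1, odd x.2).

(** For a rotation invariant measure with moments [c n] of [|z|^(2 n)], symbols with different
    powers of [z / |z|] are orthogonal, and the others pair to the moment of [|z|^(i + j)]. Only
    even orders are available, so symbols of different parity are declared orthogonal. *)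
Definition shift_form (x y : X) : R :=
  if pclass x == pclass y then c ((x.2 + y.2)./2) else 0.

Lemma shift_form_psd : psd shift_form.
Proof.
apply: (@psd_blocks R X _ pclass).
- by move=> x y; rewrite /shift_form eq_sym addnC.
- by move=> x y /negbTE h; rewrite /shift_form h.
move=> [m b] v /allP vt.
(* In the class of parity [b] the second index is [2 i' + b], hence half the sum of two such indices
   is [b + i' + j']; the odd class needs the shifted Hankel matrix. *)
have -> : qform shift_form v = qform (hankel (fun n => c (b + n)%N)) [seq (p.1, p.2.2./2) | p <- v].
  rewrite /qform big_map; apply: eq_big_seq => p pv.
  rewrite big_map; apply: eq_big_seq => q qv; congr (_ * _).
  have /eqP e1 := vt _ pv; have /eqP e2 := vt _ qv.
  rewrite /shift_form e1 e2 eqxx /hankel/= halfD.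
  by case: e1 => _ ->; case: e2 => _ ->; rewrite andbb.
by case: b {vt}; [case: c_psd1|case: c_psd].
Qed.

Let k : psdkernel R X := kernel_of shift_form_psd.

Lemma shift_formE x y : k x y = (shift_form x y)%:C.
Proof. by []. Qed.

Let translate (d : int) (x : X) : X := (x.1 + d, x.2).

Lemma translate_adj d x y : (1 : R[i]) * k y (translate d x) = (1 : R[i])^* * k (translate (- d) y) x.
Proof.
rewrite rmorph1 !mul1r !shift_formE; congr (_%:C).
rewrite /shift_form /pclass /translate/= !xpair_eqE; congr (if _ && _ then _ else _).
by rewrite -subr_eq.
Qed.

Lemma translate_kq d w : kq k (cmap (fun=> 1) (translate d) w) <= kq k w.
Proof.
rewrite /kq !kformE big_map le_eqVlt; apply/orP; left; apply/eqP; congr complex.Re.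
apply: eq_bigr => p _; rewrite big_map; apply: eq_bigr => q _ /=.
rewrite rmorph1 !mulr1; congr (_ * _%:C).
by rewrite /shift_form /pclass /translate/= !xpair_eqE (inj_eq (addIr d)).
Qed.

(** Composition with a translation by [d] sends the symbol [(n, i)] to [(n - d, i)]; multiplication
    by [z / |z|] is therefore the case [d = - 1]. *)
Definition translate_wmap d : wmap k :=
  Wmap (translate_adj d) (translate_kq d) (translate_kq (- d)).

Let sgn (x : X) : R[i] := (-1) ^+ odd x.2.

Let sgn_conj x : (sgn x)^* = sgn x.
Proof. by rewrite /sgn; case: odd; rewrite ?expr1 ?expr0 ?rmorphN rmorph1. Qed.

Lemma sgn_adj x y : sgn x * k y x = (sgn y)^* * k y x.
Proof.
rewrite sgn_conj !shift_formE /shift_form; case: eqP => [[_ h]|_]; last by rewrite !mulr0.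
by rewrite /sgn h.
Qed.

Lemma sgn_kq w : kq k (cmap sgn id w) <= kq k w.
Proof.
rewrite /kq !kformE big_map le_eqVlt; apply/orP; left; apply/eqP; congr complex.Re.
apply: eq_bigr => p _; rewrite big_map; apply: eq_bigr => q _ /=.
rewrite !sgn_conj /shift_form; case: eqP => [[_ h]|_]; last by rewrite !mulr0.
rewrite rmorphM/= sgn_conj /sgn h mulrACA -expr2 sqrr_sign mulr1//.
Qed.

(** It gives the symmetry whose eigenspaces for 1 and -1 are the even and the odd functions. *)
Definition sgn_wmap : wmap k := Wmap sgn_adj sgn_kq sgn_kq.

Let K : hilbertType R := rkhs k.
Let e (n : int) (i : nat) : K := iota_rk k (n, i).
Let U d : {linear K -> K} := wop (translate_wmap d).
Let J : {linear K -> K} := wop sgn_wmap.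

Let K_ext (f g : K) : (forall n i, hdot f (e n i) = hdot g (e n i)) -> f = g.
Proof. by move=> h; apply: rkhsP => -[n i]; rewrite -!hdot_iota; exact: h. Qed.

Let eE n i m j : hdot (e n i) (e m j) = (shift_form (n, i) (m, j))%:C.
Proof. by rewrite /e hdot_iota iota_rkE. Qed.

Let UE d (f : K) n i : hdot (U d f) (e n i) = hdot f (e (n + d) i).
Proof. by rewrite /e !hdot_iota /U wopE mul1r. Qed.

Let JE (f : K) n i : hdot (J f) (e n i) = (-1) ^+ odd i * hdot f (e n i).
Proof. by rewrite /e !hdot_iota /J wopE. Qed.

Let U_adj d (f g : K) : hdot (U d f) g = hdot f (U (- d) g).
Proof.
by rewrite /U wop_adj; apply: (congr1 (hdot f)); exact: rkhsP.
Qed.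

Let UK d (f : K) : U (- d) (U d f) = f.
Proof. by apply: K_ext => n i; rewrite !UE subrK. Qed.

Let JJ (f : K) : J (J f) = f.
Proof. by apply: K_ext => n i; rewrite !JE mulrA -expr2 sqrr_sign mul1r. Qed.

Let J_adj (f g : K) : hdot (J f) g = hdot f (J g).
Proof. by rewrite /J wop_adj; apply: (congr1 (hdot f)); exact: rkhsP. Qed.

Let U_e d n i : U d (e n i) = e (n - d) i.
Proof.
apply: K_ext => m j; rewrite UE !eE; congr (_%:C).
by rewrite /shift_form /pclass/= !xpair_eqE subr_eq.
Qed.

Let J_e n i : J (e n i) = (-1) ^+ odd i *: e n i.
Proof.
apply: K_ext => m j; rewrite JE hdotZl !eE /shift_form; case: eqP => [[_ ->]//|_].
by rewrite !mulr0.
Qed.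

Let UJ d (f : K) : U d (J f) = J (U d f).
Proof. by apply: K_ext => n i; rewrite UE !JE UE. Qed.

Let J_orth (f g : K) : J f = f -> J g = - g -> hdot f g = 0.
Proof.
move=> Jf Jg; have : hdot f g = - hdot f g by rewrite -{1}Jf J_adj Jg hdotNr.
move/eqP; rewrite -addr_eq0 -mulr2n mulrn_eq0/= => /eqP //.
Qed.

Let even_part (f : K) : K := 2^-1 *: (f + J f).
Let odd_part (f : K) : K := 2^-1 *: (f - J f).

Let partsE f : f = even_part f + odd_part f.
Proof.
rewrite /even_part /odd_part -scalerDr addrACA subrr addr0 -[f + f]mulr2n -[f *+ 2]scaler_nat.
by rewrite scalerA mulVf ?pnatr_eq0// scale1r.
Qed.

Let J_even f : J (even_part f) = even_part f.
Proof. by rewrite /even_part linearZ linearD/= JJ addrC. Qed.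

Let J_odd f : J (odd_part f) = - odd_part f.
Proof. by rewrite /odd_part linearZ linearB/= JJ -scalerN opprB. Qed.

Let even_partE f n i : hdot (even_part f) (e n i) = if odd i then 0 else hdot f (e n i).
Proof.
rewrite /even_part hdotZl hdotDl JE; case: odd; rewrite ?expr1 ?expr0.
  by rewrite mulN1r subrr mulr0.
by rewrite mul1r; field.
Qed.

Let odd_partE f n i : hdot (odd_part f) (e n i) = if odd i then hdot f (e n i) else 0.
Proof.
rewrite /odd_part hdotZl hdotBl JE; case: odd; rewrite ?expr1 ?expr0.
  by rewrite mulN1r opprK; field.
by rewrite mul1r subrr mulr0.
Qed.

(* The largest operator extending multiplication by [|z|] from even to odd functions. *)
Let A : set (K * K) := [set p | [/\ J p.1 = p.1, J p.2 = - p.2 &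
  forall n i, odd i -> hdot p.2 (e n i) = hdot p.1 (e n i.+1)]].

(** For an element of the adjoint, the pairs with [i] odd say that its even first part and odd
    second part form a pair in [A]; the pairs of [A] say that its odd first part is treated by the
    adjoint of [A]. *)
Let S0 : set (K * K) := [set q | (exists n i, odd i /\ q = (e n i, e n i.+1)) \/ A q].

(* Multiplication by [|z|], acting as [A] on even functions and as [A^*] on odd ones. *)
Definition mul_abs : set (K * K) := adjoint S0.
Let S := mul_abs.

Let SP p : S p <-> (forall n i, odd i -> hdot p.2 (e n i) = hdot p.1 (e n i.+1)) /\
  (forall q, A q -> hdot q.2 p.1 = hdot q.1 p.2).
Proof.
split=> [h|[h1 h2] q [[n [i [oi ->]]]|/h2//] /=].
  split=> [n i oi|q Aq]; last by apply: h; right.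
  rewrite hdotC [RHS]hdotC; congr (_^*); apply/esym.
  by apply: (h (e n i, e n i.+1)); left; exists n, i.
by rewrite hdotC [RHS]hdotC h1.
Qed.

Let shift_e n i m j : shift_form (n, i.+1) (m, j) = shift_form (n, i) (m, j.+1).
Proof.
rewrite /shift_form (_ : (n, i.+1).2 + (m, j).2 = (n, i).2 + (m, j.+1).2)%N; last by rewrite /= addSnnS.
by rewrite /pclass/= !xpair_eqE; case: odd; case: odd.
Qed.

Let A_e n i : ~~ odd i -> A (e n i, e n i.+1).
Proof.
move=> oi; split; rewrite /= ?J_e/= ?(negbTE oi) ?expr0 ?scale1r ?expr1 ?scaleN1r//.
by move=> m j _; rewrite !eE shift_e.
Qed.

Let S0_S : S0 `<=` S.
Proof.
move=> q [[n [i [oi ->]]]|Aq]; apply/SP; split.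
- by move=> m j _ /=; rewrite !eE shift_e.
- by move=> q' [_ _ h] /=; rewrite h.
- by case: Aq.
case: Aq => J1 J2 _ q' [J1' J2' _].
rewrite (J_orth J1' J2) hdotC (J_orth J1 J2') rmorph0//.
Qed.

Let S_e n i : S (e n i, e n i.+1).
Proof.
apply: S0_S; have [oi|oi] := boolP (odd i); first by left; exists n, i.
by right; exact: A_e.
Qed.

(** [adjoint S] is in [S] because [S0] is. For the converse, let [p] and [q] be in [S]: the even
    part of [q.1] and the odd part of [q.2] form a pair in [A], on which [p] can be tested, and the
    same holds with [p] and [q] exchanged. The two identities add up to symmetry. *)
Lemma mul_abs_self : adjoint S = S.
Proof.
apply/seteqP; split=> [p h q /S0_S|]; first exact: h.
move=> p /SP[p1 p2] q /SP[q1 q2].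
have A_parts f g : (forall n i, odd i -> hdot g (e n i) = hdot f (e n i.+1)) ->
    A (even_part f, odd_part g).
  move=> h; split; [exact: J_even|exact: J_odd|] => n i oi /=.
  by rewrite odd_partE even_partE/= oi h.
have h1 : hdot (odd_part q.2) p.1 = hdot (even_part q.1) p.2 := p2 _ (A_parts _ _ q1).
have h2 : hdot (odd_part p.2) q.1 = hdot (even_part p.1) q.2 := q2 _ (A_parts _ _ p1).
have eo f g : hdot (even_part f) (odd_part g) = 0 by exact: J_orth (J_even f) (J_odd g).
have oe f g : hdot (odd_part f) (even_part g) = 0 by rewrite hdotC eo rmorph0.
have de f g : hdot (even_part f) g = hdot (even_part f) (even_part g).
  by rewrite -[RHS]addr0 -(eo f g) -hdotDr -partsE.
have dodd f g : hdot (odd_part f) g = hdot (odd_part f) (odd_part g).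
  by rewrite -[RHS]add0r -(oe f g) -hdotDr -partsE.
have dd f g : hdot f g = hdot (even_part f) (even_part g) + hdot (odd_part f) (odd_part g).
  by rewrite -de -dodd -hdotDl -partsE.
rewrite (dd q.2) (dd q.1) addrC; congr (_ + _); first by rewrite -dodd -de.
by rewrite hdotC -de -h2 dodd -hdotC.
Qed.

Lemma mul_abs_dense : densely_defined S.
Proof.
apply/seteqP; split => // f _ B Bf.
have /nbhs_ballP[_ /complex_gt0[r r0 ->] rB] := Bf.
have r20 : 0 < r / 2 by rewrite divr_gt0.
have [v fv] := @rkhs_dense _ _ k f (r / 2) r20.
exists (comb_rkhs k v); split.
  exists (\sum_(p <- v) p.1 *: e p.2.1 p.2.2.+1); rewrite comb_rkhs_sum.
  elim: v {fv} => [|[a [n i]] v IH].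
    by rewrite !big_nil => q _ /=; rewrite !hdot0r.
  rewrite !big_cons; apply: adjointD => //; apply: adjointZ; exact: S_e.
apply: rB; rewrite -ball_normE/= nrmE ltcR (le_lt_trans fv)//.
by rewrite ltr_pdivrMr// ltr_pMr// ltr1n.
Qed.

Let A_U d p : A p -> A (U d p.1, U d p.2).
Proof.
move=> [J1 J2 h]; split; rewrite /= -?UJ ?J1 ?J2 ?linearN//.
by move=> n i oi; rewrite !UE h.
Qed.

Lemma mul_abs_U d x y : S (x, y) -> S (U d x, U d y).
Proof.
move=> /SP[h1 h2]; apply/SP; split=> [n i oi|q Aq] /=; first by rewrite !UE h1.
have U_adj' f g : hdot f (U d g) = hdot (U (- d) f) g by rewrite U_adj opprK.
by rewrite !U_adj'; exact: (h2 _ (A_U (- d) Aq)).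
Qed.

Let UK' d (f : K) : U d (U (- d) f) = f.
Proof. by rewrite -{1}[d]opprK UK. Qed.

Definition mul_z : operator K K :=
  us_op mul_abs_dense mul_abs_self (UK' (- 1)).

Let mul_z_normal : normal_op mul_z.
Proof.
apply: us_normal.
- exact: U_adj.
- exact: UK.
- exact: mul_abs_U.
- exact: mul_abs_U.
Qed.

(** The normalized power [z^n]: the squared norm of its symbol is [c n]. *)
Let z_vec (n : nat) : K := ((Num.sqrt (c n))^-1)%:C *: e n%:Z n.

Let sqrt_c_gt0 n : 0 < Num.sqrt (c n). Proof. by rewrite sqrtr_gt0. Qed.

Let z_vec_on i j : hdot (z_vec i) (z_vec j) = (i == j)%:R.
Proof.
rewrite /z_vec hdotZl hdotZr conj_real eE /shift_form /pclass/= xpair_eqE/=.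
have -> : (i%:Z == j%:Z) = (i == j) by [].
have [->|ij] := eqVneq i j; last by rewrite !mulr0.
rewrite eqxx -!rmorphM/= addnn doubleK -{3}(@sqr_sqrtr _ (c j)) ?(ltW (c_gt0 j))//.
by rewrite mulrA -invfM -expr2 mulVf ?rmorph1// expf_neq0// gt_eqF.
Qed.

(** [mul_z] maps the normalized powers as the shift maps the basis. A vector of the maximal domain
    is reached by truncating it at [n] and its image at [n.+1], since [mul_z] is closed. *)
Lemma weighted_shift_normal_extension (w : nat -> R) : (forall n, 0 <= w n) ->
  (forall n, w n ^+ 2 * c n = c n.+1) ->
  exists (K' : hilbertType R) (V : {linear l2 R -> K'}) (N : operator K' K'),
    normal_extension (weighted_shift (fun n => (w n)%:C)) V N.
Proof.
move=> w0 wc; exists K, (on_isom z_vec_on), mul_z; split.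
- by move=> x; rewrite !nrmE; congr (_%:C); exact: on_emb_nrm.
- exact: mul_z_normal.
move=> f g /weighted_shiftE[g0 gS].
have step n : graph mul_z (z_vec n, (w n)%:C *: z_vec n.+1).
  have -> : (w n)%:C *: z_vec n.+1 = ((Num.sqrt (c n))^-1)%:C *: U (- 1) (e n n.+1).
    rewrite U_e opprK /z_vec scalerA -rmorphM/= (_ : n%:Z + 1 = n.+1%:Z); last first.
      by rewrite -addn1 PoszD.
    congr (_%:C *: _); have := sqrt_c_gt0 n.+1.
    rewrite -wc sqrtrM ?sqr_ge0// sqrtr_sqr ger0_norm// => h.
    by rewrite invfM mulrA mulfV ?mul1r//; apply: contraTneq h => ->; rewrite mul0r ltxx.
  have Nz : graph mul_z (e n%:Z n, U (- 1) (e n%:Z n.+1)).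
    by rewrite /= /us_graph/= UK; exact: S_e.
  exact: (graphZ _ Nz).
have part n : graph mul_z (on_sum z_vec f n, on_sum z_vec g n.+1).
  have -> : on_sum z_vec g n.+1 = \sum_(i < n) f i *: ((w i)%:C *: z_vec i.+1).
    rewrite /on_sum big_ord_recl/= g0 scale0r add0r; apply: eq_bigr => i _.
    by rewrite gS mulrC scalerA.
  rewrite /on_sum; elim: n => [|n IH]; first by rewrite !big_ord0; exact: (graph0 mul_z).
  rewrite !big_ord_recr; exact: (graphD IH (graphZ (f n) (step n))).
have [_ cl _] := mul_z_normal.
have cf := @on_emb_cvg _ _ _ z_vec_on f; have cg := @on_emb_cvg _ _ _ z_vec_on g.
have cg' : (fun n => on_sum z_vec g n.+1) @ \oo --> on_emb z_vec g.
  by have := cvg_comp _ _ (cvg_addnr 1%N) cg; under eq_cvg do rewrite /= addn1.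
exact: (closed_graph_cvg cl cf cg' part).
Qed.

End ShiftExtension.

(** * Orbits *)

Section Orbits.
Context (R : realType).

Lemma gram_hankel_psd (H : hilbertType R) (z : nat -> H) (f : nat -> R) :
  (forall i j, hdot (z i) (z j) = (f (i + j)%N)%:C) -> psd (hankel f).
Proof.
move=> zf; split=> [i j|v]; first exact: hankelC.
have -> : qform (hankel f) v = nrm (\sum_(p <- v) p.1%:C *: z p.2) ^+ 2.
  rewrite nrm_hdot hdot_suml raddf_sum; apply: eq_bigr => p _.
  rewrite hdot_sumr raddf_sum; apply: eq_bigr => q _.
  by rewrite hdotZl hdotZr conj_real zf -!rmorphM/= mulrA.
exact: sqr_ge0.
Qed.

Context (H : hilbertType R).

Lemma normal_extension_psd (K : hilbertType R) (S : operator H H) (V : {linear H -> K})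
    (N : operator K K) (x : nat -> H) : normal_extension S V N ->
  (forall n, graph S (x n, x n.+1)) -> psd (hankel (fun n => nrm (x n) ^+ 2)).
Proof.
move=> [Viso Nnormal SN] Sx.
have [|z hz] := @normal_hankel _ _ _ Nnormal (fun n => V (x n)).
  by move=> n; apply: SN.
have -> : (fun n => nrm (x n) ^+ 2) = (fun n => nrm (V (x n)) ^+ 2).
  by apply/funext => n; rewrite /nrm Viso.
exact: gram_hankel_psd hz.
Qed.

Lemma opnorm_le1 (S : operator H H) x y : (opnorm S <= 1)%E -> graph S (x, y) ->
  nrm y <= nrm x.
Proof.
move=> S1 Sxy.
have [x0|x0] := eqVneq (nrm x) 0.
  rewrite (nrm_eq0 x0) in Sxy *; rewrite (graph_fun Sxy (graph0 S)) nrm0//.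
have x1 : 0 < nrm x by rewrite lt0r x0 nrm_ge0.
have := graphZ ((nrm x)^-1)%:C Sxy => Sc.
have nx (u : H) : nrm (((nrm x)^-1)%:C *: u) = (nrm x)^-1 * nrm u.
  by rewrite nrmZ nrm_real ger0_norm// invr_ge0 nrm_ge0.
have h : ((nrm (((nrm x)^-1)%:C *: y))%:E <= opnorm S)%E.
  apply: ereal_sup_ubound; exists (((nrm x)^-1)%:C *: x, ((nrm x)^-1)%:C *: y) => //.
  by split => //=; rewrite nx mulVf.
by have := le_trans h S1; rewrite lee_fin nx mulrC ler_pdivrMr// mul1r.
Qed.

Lemma op_fun_graph (S : operator H H) x : opdom S = setT -> graph S (x, op_fun S x).
Proof.
move=> domS; have [y Sy] : opdom S x by rewrite domS.
by rewrite /op_fun; case: xgetP => [z _ //|/(_ y)].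
Qed.

Lemma op_fun_chain (S : operator H H) (x : nat -> H) : opdom S = setT ->
  (forall n, graph S (x n, x n.+1)) -> forall n, iter n (op_fun S) (x 0%N) = x n.
Proof.
move=> domS Sx; elim=> [|n IH] //=; rewrite IH.
exact: graph_fun (op_fun_graph _ domS) (Sx n).
Qed.

Lemma contractiveP (T : {linear H -> H}) :
  contractive_op (lin_op T) <-> forall h, nrm (T h) <= nrm h.
Proof.
split=> [[_ T1] h|T1]; first exact: (opnorm_le1 T1).
have [|b1 b2] := @lin_op_bounded _ _ T 1; first by move=> x; rewrite mul1r.
by split => //; exact: b2.
Qed.

Lemma cpdZ (c : nat -> R) a : 0 <= a -> cpd c -> cpd (fun n => a * c n).
Proof.
move=> a0 cc v v0; have := mulr_ge0 a0 (cc v v0); congr (0 <= _).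
rewrite /qform mulr_sumr; apply: eq_bigr => p _; rewrite mulr_sumr; apply: eq_bigr => q _.
by rewrite /hankel; ring.
Qed.

End Orbits.

(** * Weighted shifts with weights at most 1 *)

Section ContractiveShift.
Context (R : realType) (c w : nat -> R).
Hypothesis c_gt0 : forall n, 0 < c n.
Hypothesis w_ge0 : forall n, 0 <= w n.
Hypothesis w_le1 : forall n, w n <= 1.
Hypothesis wc : forall n, w n ^+ 2 * c n = c n.+1.
Hypothesis c_psd : forall i, psd (hankel (fun n => c (i + n)%N)).

(** The shift as an everywhere defined linear map, the form in which [contraction_subnormal]
    applies; [wshift_graph] identifies it with the operator. *)
Definition wshift_seq (f : nat -> R[i]) (n : nat) : R[i] :=
  if n is m.+1 then (w m)%:C * f m else 0.

Let wshift_le (f : l2 R) n : \sum_(i < n) nrm (wshift_seq f i) ^+ 2 <= nrm f ^+ 2.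
Proof.
case: n => [|n]; first by rewrite big_ord0 sqr_ge0.
rewrite big_ord_recl/= nrm0 expr0n add0r; apply: le_trans (l2_nrm_ge f n).
apply: ler_sum => i _; rewrite nrmM nrm_real (ger0_norm (w_ge0 i)) exprMn.
by rewrite ler_piMl ?sqr_ge0// expr_le1.
Qed.

Lemma wshift_summable (f : l2 R) : sq_summable (wshift_seq f).
Proof. by apply/sq_summableP; exists (nrm f ^+ 2) => n; exact: wshift_le. Qed.

Definition wshift (f : l2 R) : l2 R := l2_of (@wshift_summable f).

Lemma wshift_linear : linear wshift.
Proof.
move=> a f g; apply: l2P => -[|n]; rewrite l2D l2Z /= ?mulr0 ?addr0//.
by transitivity ((w n)%:C * (a * f n + g n)); rewrite //; ring.
Qed.

HB.instance Definition _ :=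
  GRing.isLinear.Build R[i] (l2 R) (l2 R) _ wshift wshift_linear.

Lemma wshift_graph : graph (weighted_shift (fun n => (w n)%:C)) = graph (lin_op wshift).
Proof.
apply/seteqP; split=> -[f g] /=.
  by move=> /weighted_shiftE[g0 gS]; apply: l2P => -[|n].
by move=> ->; apply/weighted_shiftE; split.
Qed.

Lemma wshift_nrm f : nrm (wshift f) <= nrm f.
Proof.
rewrite -ler_sqr ?nnegrE ?nrm_ge0// l2_nrm_sqr; apply: limr_le.
  exact: (@l2_summable _ (wshift f)).
by apply: nearW => n; rewrite /series/= big_mkord wshift_le.
Qed.

Lemma iter_wshift_unit n i : exists2 a : R, a ^+ 2 = c (i + n)%N / c i &
  iter n wshift (unit_vec R i) = a%:C *: unit_vec R (i + n).
Proof.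
elim: n => [|n [a a2 IH]].
  by exists 1; rewrite ?addn0 ?expr1n ?divff ?gt_eqF// scale1r.
exists (a * w (i + n)%N).
  by rewrite exprMn a2 mulrAC addnS -wc mulrC mulrA; ring.
rewrite iterS IH linearZ/= rmorphM/= -scalerA; congr (_ *: _).
have : graph (lin_op wshift) (unit_vec R (i + n), (w (i + n)%N)%:C *: unit_vec R (i + n).+1).
  by rewrite -wshift_graph; exact: weighted_shift_unit.
by move=> /= <-; rewrite addnS.
Qed.

(* A vector is the limit of its truncations, whose orbits are positive combinations of
   shifts of [c]. *)
Lemma iter_wshift_psd f : psd (hankel (fun n => nrm (iter n wshift f) ^+ 2)).
Proof.
have iterB n x y : iter n wshift x - iter n wshift y = iter n wshift (x - y).
  by elim: n => //= n <-; rewrite linearB.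
have iterN n x : nrm (iter n wshift x) <= nrm x.
  by elim: n => //= n IH; exact: le_trans (wshift_nrm _) IH.
apply: (@psd_cvg _ _ (fun N => hankel (fun n => \sum_(i < N) nrm (f i) ^+ 2 * (c (i + n)%N / c i)))).
  move=> N; elim: N => [|N IH].
    have := psdZ (lexx (0 : R)) (psd1 R nat).
    by congr psd; apply/funext => i; apply/funext => j; rewrite /hankel big_ord0 mul0r.
  have h : 0 <= nrm (f N) ^+ 2 / c N by rewrite divr_ge0 ?sqr_ge0// ltW.
  have := psdD IH (psdZ h (c_psd N)).
  congr psd; apply/funext => i; apply/funext => j; rewrite /hankel big_ord_recr/=.
  by congr (_ + _); ring.
move=> i j; rewrite /hankel; set n := (i + j)%N.
have cv : (fun N => iter n wshift (on_sum (unit_vec R) f N)) @ \oo --> iter n wshift f.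
  apply: (@cvg_nrm_sqz _ _ _ _ (fun N => nrm (f - on_sum (unit_vec R) f N))).
    rewrite -(@nrm0 R (l2 R)) -[X in _ --> nrm X](subrr f).
    by apply: cvg_nrm; apply: cvgB; [exact: cvg_cst|exact: unit_sum_cvg].
  by move=> N; rewrite iterB.
have cv2 : (fun N => nrm (iter n wshift (on_sum (unit_vec R) f N)) ^+ 2) @ \oo -->
    nrm (iter n wshift f) ^+ 2.
  rewrite expr2; under eq_fun do rewrite expr2.
  by apply: cvgM; apply: cvg_nrm.
apply: cvg_trans cv2; apply: near_eq_cvg; apply: nearW => N /=.
have on_shift i' j' : hdot (unit_vec R (i' + n)) (unit_vec R (j' + n)) = (i' == j')%:R.
  by rewrite unit_vec_on eqn_add2r.
pose a k := sval (cid2 (iter_wshift_unit n k)).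
have aP k : a k ^+ 2 = c (k + n)%N / c k /\
    iter n wshift (unit_vec R k) = (a k)%:C *: unit_vec R (k + n).
  by rewrite /a; case: cid2.
have -> : iter n wshift (on_sum (unit_vec R) f N) =
    \sum_(k < N) ((a k)%:C * f k) *: unit_vec R (k + n).
  rewrite /on_sum; elim: N => [|N IH].
    by rewrite !big_ord0; have := iterB n 0 0; rewrite !subrr => <-.
  rewrite !big_ord_recr/= -IH.
  have iterD x y : iter n wshift (x + y) = iter n wshift x + iter n wshift y.
    by elim: n {on_shift a aP IH cv} => //= m ->; rewrite linearD.
  have iterZ b x : iter n wshift (b *: x) = b *: iter n wshift x.
    by elim: n {on_shift a aP IH iterD cv} => //= m ->; rewrite linearZ.
  by rewrite iterD iterZ (aP N).2 scalerA [f N * _]mulrC.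
rewrite (@on_sum_nrm _ _ _ on_shift (fun k => (a k)%:C * f k) xpredT).
apply: eq_bigr => k _; rewrite nrmM nrm_real exprMn real_normK ?num_real//.
by rewrite (aP k).1 mulrC.
Qed.

Lemma contractive_shift_subnormal :
  bounded_subnormal (weighted_shift (fun n => (w n)%:C)).
Proof.
have [|b1 _] := @lin_op_bounded _ _ wshift 1; first by move=> x; rewrite mul1r wshift_nrm.
have [K [V [N [Nb NV]]]] := contraction_subnormal wshift_nrm iter_wshift_psd.
split; first by rewrite /bounded_op /opdom /opnorm wshift_graph.
exists K, V, N; split => //; case: NV => h1 h2 h3; split => // x y.
by rewrite wshift_graph; exact: h3.
Qed.

Lemma contractive_shift_opnorm : w @ \oo --> (1 : R) ->
  opnorm (weighted_shift (fun n => (w n)%:C)) = 1%E.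
Proof.
move=> w1; apply/eqP; rewrite eq_le; apply/andP; split.
  have [|_ b2] := @lin_op_bounded _ _ wshift 1; first by move=> x; rewrite mul1r wshift_nrm.
  by rewrite /opnorm wshift_graph b2.
have ub n : ((w n)%:E <= opnorm (weighted_shift (fun n => (w n)%:C)))%E.
  apply: ereal_sup_ubound; exists (unit_vec R n, (w n)%:C *: unit_vec R n.+1).
    split; first exact: weighted_shift_unit.
    rewrite -ler_sqr ?nnegrE ?nrm_ge0//= nrm_hdot unit_vec_on eqxx expr1n//.
  rewrite /= nrmZ nrm_real (ger0_norm (w_ge0 n)) (_ : nrm _ = 1) ?mulr1//.
  by apply/eqP; rewrite -(@eqrXn2 _ 2) ?nrm_ge0// nrm_hdot unit_vec_on eqxx expr1n.
have := ub; case: (opnorm _) => [r h||h]; last by have := h 0%N.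
  rewrite lee_fin; apply: (ler_cvg_to w1 (cvg_cst r)); apply: nearW => n.
  by have := h n; rewrite lee_fin.
by rewrite leey.
Qed.

End ContractiveShift.

(** * Squared norms along the orbits of [T] and the associated shifts *)

Section Orbit.
Context (R : realType) (H : hilbertType R) (T : {linear H -> H}).
Implicit Types (h : H) (n : nat).

Definition orbit_sqr h n : R := nrm (iter n T h) ^+ 2.

Lemma orbit_sqr_iter h i n : orbit_sqr h (i + n) = orbit_sqr (iter i T h) n.
Proof. by rewrite /orbit_sqr addnC iterD. Qed.

Lemma orbit_sqrZ (t : R) h n : orbit_sqr (t%:C *: h) n = t ^+ 2 * orbit_sqr h n.
Proof.
have -> : orbit_sqr (t%:C *: h) n = nrm (t%:C *: iter n T h) ^+ 2.
  by rewrite /orbit_sqr; congr (nrm _ ^+ 2); elim: n => //= n ->; rewrite linearZ.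
by rewrite nrmZ nrm_real exprMn real_normK ?num_real.
Qed.

Lemma cpd_opP : bounded_op (lin_op T) ->
  cpd_op (lin_op T) <-> forall h, cpd (orbit_sqr h).
Proof.
move=> hT; rewrite /cpd_op lin_opE; split=> [[_ c] h|c]; first exact/cpd_seqP/c.
by split => // h; apply/cpd_seqP; exact: c.
Qed.

Lemma shift_weight_ge0 h n : 0 <= shift_weight T h n.
Proof. exact: expR_ge0. Qed.

Lemma shift_weight_sqr h n :
  shift_weight T h n ^+ 2 * expR (orbit_sqr h n) = expR (orbit_sqr h n.+1).
Proof. by rewrite expr2 -!expRD /orbit_sqr; congr expR; lra. Qed.

(** A shift of the sequence of [h] is the sequence of [iter i T h], so that the hypothesis on all
    vectors covers all shifts. *)
Lemma orbit_expR_psd h : (forall g, cpd (orbit_sqr g)) ->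
  forall i, psd (hankel (fun n => expR (orbit_sqr h (i + n)))).
Proof.
move=> cT i; have := psd_hankel_expR (cT (iter i T h)).
by under [fun n => expR (orbit_sqr h (i + n))]eq_fun do rewrite orbit_sqr_iter.
Qed.

(** The image of the first basis vector under the [n]-th power of the shift; the exponents of the
    weights telescope. *)
Definition Wshift_orbit h n : l2 R :=
  (expR (2^-1 * (orbit_sqr h n - orbit_sqr h 0)))%:C *: unit_vec R n.

Lemma Wshift_orbit_graph h n :
  graph (Wshift T h) (Wshift_orbit h n, Wshift_orbit h n.+1).
Proof.
have := graphZ (expR (2^-1 * (orbit_sqr h n - orbit_sqr h 0)))%:C
  (weighted_shift_unit (fun m => (shift_weight T h m)%:C) n).
rewrite scalerA -rmorphM/= /shift_weight -expRD /Wshift_orbit.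
have -> // : 2^-1 * (orbit_sqr h n - orbit_sqr h 0) +
    2^-1 * (nrm (iter n.+1 T h) ^+ 2 - nrm (iter n T h) ^+ 2) =
    2^-1 * (orbit_sqr h n.+1 - orbit_sqr h 0).
by rewrite /orbit_sqr; lra.
Qed.

Lemma Wshift_orbit_nrm h n :
  nrm (Wshift_orbit h n) ^+ 2 = expR (- orbit_sqr h 0) * expR (orbit_sqr h n).
Proof.
rewrite /Wshift_orbit nrmZ nrm_real ger0_norm ?expR_ge0// exprMn nrm_hdot unit_vec_on eqxx mulr1.
by rewrite expr2 -!expRD; congr expR; lra.
Qed.

Lemma cpd_of_Wshift h : (forall t : R, cpd (fun n => nrm (Wshift_orbit (t%:C *: h) n) ^+ 2)) ->
  cpd (orbit_sqr h).
Proof.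
move=> c; apply: cpd_of_expR => t t0.
(* Scaling [h] by the square root of [t] multiplies its orbit sequence by [t]; the constant factor
   removes the normalization by the term of index 0. *)
have := cpdZ (expR_ge0 (orbit_sqr ((Num.sqrt t)%:C *: h) 0)) (c (Num.sqrt t)).
congr cpd; apply/funext => n.
by rewrite Wshift_orbit_nrm mulrA -expRD subrr expR0 mul1r orbit_sqrZ sqr_sqrtr// ltW.
Qed.

Lemma orbit_sqr_cvg h : (forall g, nrm (T g) <= nrm g) ->
  exists2 l : R, 0 <= l & orbit_sqr h @ \oo --> l.
Proof.
move=> T1; have /cvg_ex[l hl] : cvgn (orbit_sqr h).
  apply: nonincreasing_is_cvgn; last by exists 0 => _ [n _ <-]; exact: sqr_ge0.
  apply/nonincreasing_seqP => n; rewrite /orbit_sqr ler_sqr ?nnegrE ?nrm_ge0//.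
  exact: T1.
exists l => //; apply: (ler_cvg_to (cvg_cst (0 : R)) hl); apply: nearW => n.
exact: sqr_ge0.
Qed.

Lemma shift_weight_cvg h : (forall g, nrm (T g) <= nrm g) -> shift_weight T h @ \oo --> (1 : R).
Proof.
move=> T1; have [l _ hl] := orbit_sqr_cvg h T1.
have hlS : (fun n => orbit_sqr h n.+1) @ \oo --> l by rewrite cvg_shiftS.
have c0 : (fun n => 2^-1 * (orbit_sqr h n.+1 - orbit_sqr h n)) @ \oo --> (0 : R).
  have -> : (0 : R) = 2^-1 * (l - l) by rewrite subrr mulr0.
  by apply: cvgMr; exact: cvgB.
rewrite -(@expR0 R); exact: (cvg_comp _ _ c0 (@continuous_expR R 0)).
Qed.

Lemma shift_weight_le1 h n : (forall g, nrm (T g) <= nrm g) -> shift_weight T h n <= 1.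
Proof.
move=> T1; rewrite /shift_weight -expR0 ler_expR mulr_ge0_le0// subr_le0.
by rewrite ler_sqr ?nnegrE ?nrm_ge0//; exact: T1.
Qed.

End Orbit.

Theorem proposition3p4p9 (R : realType) (H : hilbertType R)
    (T : {linear H -> H}) (hT : bounded_op (lin_op T)) :
  (cpd_op (lin_op T) <-> forall h : H, subnormal (Wshift T h)) /\
  [<-> bounded_subnormal (lin_op T) /\ contractive_op (lin_op T);
       cpd_op (lin_op T) /\ contractive_op (lin_op T);
       forall h : H, bounded_subnormal (Wshift T h) /\
                     opnorm (Wshift T h) = 1%E;
       forall h : H, cpd_op (Wshift T h) /\ opnorm (Wshift T h) = 1%E].
Proof.
split; first split.
- move=> /(cpd_opP hT) cT h; split; first exact: weighted_shift_dense.
  apply: (@weighted_shift_normal_extension _ (fun n => expR (orbit_sqr T h n))).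
  + by move=> n; exact: expR_gt0.
  + exact: (orbit_expR_psd h cT 0).
  + exact: (orbit_expR_psd h cT 1).
  + exact: shift_weight_ge0.
  + exact: shift_weight_sqr.
- move=> W; apply/(cpd_opP hT) => h; apply: cpd_of_Wshift => t; apply: psd_cpd.
  have [_ [K [V [N NW]]]] := W (t%:C%C *: h).
  by apply: (normal_extension_psd NW) => n; exact: Wshift_orbit_graph.
tfae.
- move=> [[_ [K [V [N [_ NT]]]]] T1]; split => //; apply/(cpd_opP hT) => h.
  exact/psd_cpd/(normal_extension_psd NT).
- move=> [/(cpd_opP hT) cT /contractiveP T1] h.
  have w1 n : shift_weight T h n <= 1 by exact: shift_weight_le1.
  have c0 n : 0 < expR (orbit_sqr T h n) by exact: expR_gt0.
  split.
    (* The definition asks for a bounded extension, so the shift is handled as a contraction rather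
       than through [mul_z]. *)
    exact: (contractive_shift_subnormal c0 (shift_weight_ge0 T h) w1
      (shift_weight_sqr T h) (orbit_expR_psd h cT)).
  exact: (contractive_shift_opnorm (shift_weight_ge0 T h) w1 (shift_weight_cvg h T1)).
- move=> W h; have [[Wb [K [V [N [_ NW]]]]] W1] := W h; split => //; split => // x.
  apply/cpd_seqP/psd_cpd/(normal_extension_psd NW) => n.
  by rewrite iterS; apply: op_fun_graph; case: Wb.
- move=> W.
  (* The shift is contractive at the first basis vector, so its first weight is at most 1;
     monotonicity of [expR] turns this into the claim. *)
  have T1 h : nrm (T h) <= nrm h.
    have W1 : (opnorm (Wshift T h) <= 1)%E by rewrite (W h).2.
    have := opnorm_le1 W1 (Wshift_orbit_graph T h 0).
    rewrite -ler_sqr ?nnegrE ?nrm_ge0// !Wshift_orbit_nrm ler_pM2l ?expR_gt0// ler_expR.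
    by rewrite /orbit_sqr/= ler_sqr ?nnegrE ?nrm_ge0.
  have cT h : cpd (orbit_sqr T h).
    apply: cpd_of_Wshift => t; have [[[domW _] cW] _] := W (t%:C%C *: h).
    have /cpd_seqP := cW (Wshift_orbit T (t%:C%C *: h) 0).
    congr cpd; apply/funext => n; congr (nrm _ ^+ 2).
    by apply: (op_fun_chain domW) => m; exact: Wshift_orbit_graph.
  split; last exact/contractiveP.
  split => //; apply: (contraction_subnormal T1) => h.
  have [l l0 hl] := orbit_sqr_cvg h T1.
  exact: psd_of_cpd_cvg (cT h) hl l0.
Qed.
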